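(* Let $p_1<p_2$ be finite real numbers, $p_0\in(p_1,p_2)$, $c\in\mathbb{R}$, and $\psi(p):=-(p-p_0)^2+c$ on $[p_1,p_2]$. Let $\mu\in(0,1)$ and let $U(p)=(p-p_1)^{\mu-1}\tilde u(p)$ for $p\in(p_1,p_2]$, where $\tilde u\in\mathcal{C}^1([p_1,p_2],\mathbb{C})$, $\tilde u(p_1)\ne0$ and $U(p_2)=0$. For $\omega>0$ put $$\tilde H(\omega,\psi,U):=\sqrt\pi\,e^{-i\frac\pi4}e^{i\omega c}\,\tilde u(p_0),\qquad\tilde K_\mu(\omega,\psi,U):=\frac{\Gamma(\mu)}{2^\mu}e^{i\frac{\pi\mu}2}e^{i\omega\psi(p_1)}\,\tilde u(p_1).$$ Let $\delta\in(\frac12,1)$ and let the constants $\tilde R_k^{(i)}(U)\ge0$ and exponents $\tilde\alpha_k^{(i)}\in\mathbb{R}$, $\tilde\beta_k^{(i)}$ be those listed in the context. Then for all $\omega>0$: (1) if $\mu>\frac12$, then each $\tilde\beta_k^{(1)}>\frac12$ and $$\left|\int_{p_1}^{p_2}U(p)e^{i\omega\psi(p)}dp-\tilde H(\omega,\psi,U)(p_0-p_1)^{\mu-1}\omega^{-\frac12}\right|\le\sum_{k=1}^9\tilde R_k^{(1)}(U)(p_0-p_1)^{-\tilde\alpha_k^{(1)}}\omega^{-\tilde\beta_k^{(1)}};$$ (2) if $\mu=\frac12$, then each $\tilde\beta_k^{(2)}>\frac12$ and $$\left|\int_{p_1}^{p_2}U(p)e^{i\omega\psi(p)}dp-\big(\tilde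 H(\omega,\psi,U)+\tilde K_\mu(\omega,\psi,U)\big)(p_0-p_1)^{-\frac12}\omega^{-\frac12}\right|\le\sum_{k=1}^8\tilde R_k^{(2)}(U)(p_0-p_1)^{-\tilde\alpha_k^{(2)}}\omega^{-\tilde\beta_k^{(2)}};$$ (3) if $\mu<\frac12$, then each $\tilde\beta_k^{(3)}>\mu$ and $$\left|\int_{p_1}^{p_2}U(p)e^{i\omega\psi(p)}dp-\tilde K_\mu(\omega,\psi,U)(p_0-p_1)^{-\mu}\omega^{-\mu}\right|\le\sum_{k=1}^9\tilde R_k^{(3)}(U)(p_0-p_1)^{-\tilde\alpha_k^{(3)}}\omega^{-\tilde\beta_k^{(3)}}.$$
   Context: Given $\delta\in(\frac12,1)$ put $\gamma:=2\delta-1\in(0,1)$, let $K>0$ be the unique positive solution of $\frac{\sqrt\pi}2K^2-\frac12K-\frac{\sqrt\pi}4=0$, and $L:=\frac{\sqrt\pi}2K^\gamma$. Put $M_0:=\|\tilde u\|_{L^\infty(p_1,p_2)}$ and $M:=\|\tilde u\|_{W^{1,\infty}(p_1,p_2)}=\|\tilde u\|_{L^\infty(p_1,p_2)}+\|\tilde u'\|_{L^\infty(p_1,p_2)}$. Define the 8-tuples $(r_1,\dots,r_8):=\Big(\frac{2^{2-\mu}}\mu(2-\mu)M,\ \frac{2^{1-\mu}}\mu M,\ (1-\mu)\frac{2^{3-\mu}}3M_0,\ \frac L{1-\gamma}2^{2-\mu}(1-\mu)M,\ \frac L{1-\gamma}2^{1-\mu}M,\ \frac{\sqrt\pi}{2^{\mu-2}}M_0,\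 \frac L{1-\gamma}(1-\mu)(p_2-p_1)^{1-\gamma}M,\ \frac L{1-\gamma}(p_2-p_1)^{1-\gamma}M\Big)$, $(a_1,\dots,a_8):=(2-\mu,\,1-\mu,\,4-\mu,\,1+\gamma-\mu,\,\gamma-\mu,\,3-\mu,\,2-\mu,\,1-\mu)$, $(b_1,\dots,b_8):=(1,\,1,\,2,\,\delta,\,\delta,\,\frac32,\,\delta,\,\delta)$. Then: for $i\in\{1,3\}$ and $k=1,\dots,8$, $\tilde R^{(i)}_{k+1}(U)=r_k$, $\tilde\alpha^{(i)}_{k+1}=a_k$, $\tilde\beta^{(i)}_{k+1}=b_k$; for $i=2$ and $k=1,\dots,8$, $\tilde R^{(2)}_k(U)=r_k$, $\tilde\alpha^{(2)}_k=a_k$, $\tilde\beta^{(2)}_k=b_k$; and $\tilde R_1^{(1)}(U)=\frac{\Gamma(\mu)}{2^\mu}M_0$, $\tilde\alpha_1^{(1)}=\tilde\beta_1^{(1)}=\mu$; $\tilde R_1^{(3)}(U)=\sqrt\pi M_0$, $\tilde\alpha_1^{(3)}=1-\mu$, $\tilde\beta_1^{(3)}=\frac12$. *)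

(* Defs.v *)
From HB Require Import structures.
From mathcomp Require Import all_boot all_order all_algebra.
From mathcomp Require Import complex.
From mathcomp Require Import all_classical all_reals all_analysis.

Set Implicit Arguments.
Unset Strict Implicit.
Unset Printing Implicit Defensive.

Import Order.TTheory GRing.Theory Num.Theory.
Import numFieldNormedType.Exports.
Import ComplexField.Normc.

Local Open Scope classical_set_scope.
Local Open Scope ring_scope.
Local Open Scope complex_scope.

(* The exponential [exp (i t)] of a purely imaginary number. *)
Definition expi {R : realType} (t : R) : R[i] := cos t +i* sin t.

Definition Gamma {R : realType} (z : R) : R :=
  \int[@lebesgue_measure R]_(t in `]0, +oo[) (t `^ (z - 1) * expR (- t)).

Definition cRintegral {R : realType} (D : set R) (f : R -> R[i]) : R[i] :=
  (\int[@lebesgue_measure R]_(x in D) complex.Re (f x)) +i*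
  (\int[@lebesgue_measure R]_(x in D) complex.Im (f x)).

(* C^1([a, b]): the derivative on ]a, b[ has to extend continuously to [a, b],
   so that no derivative at the endpoints is mentioned. *)
Definition C1_itvcc {R : realType} (a b : R) (f : R -> R) : Prop :=
  derivable_oo_LRcontinuous f a b /\
  exists g : R -> R, {within `[a, b], continuous g} /\
    {in `]a, b[, derive1 f =1 g}.

Definition cC1_itvcc {R : realType} (a b : R) (f : R -> R[i]) : Prop :=
  C1_itvcc a b (@complex.Re R \o f) /\ C1_itvcc a b (@complex.Im R \o f).

Definition cderive1 {R : realType} (f : R -> R[i]) (x : R) : R[i] :=
  derive1 (@complex.Re R \o f) x +i* derive1 (@complex.Im R \o f) x.

(* The norm of L^oo(a, b); [fine] makes it a real number, which loses nothing
   on functions that are bounded on ]a, b[. *)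
Definition Linfty {R : realType} (a b : R) (f : R -> R[i]) : R :=
  fine (Lnorm (mrestr (@lebesgue_measure R) (measurable_itv `]a, b[)) +oo%E
    (fun x => (normc (f x))%:E)).

Definition W1infty {R : realType} (a b : R) (f : R -> R[i]) : R :=
  Linfty a b f + Linfty a b (cderive1 f).

Definition Hterm {R : realType} (p0 c omega : R) (u : R -> R[i]) : R[i] :=
  (Num.sqrt pi)%:C * expi (- (pi / 4)) * expi (omega * c) * u p0.

Definition Kterm {R : realType} (p1 mu omega : R) (psi : R -> R)
    (u : R -> R[i]) : R[i] :=
  (Gamma mu / 2 `^ mu)%:C * expi (pi * mu / 2) * expi (omega * psi p1) * u p1.

(* The remainder terms are sum_k R_k (p0 - p1)^(- alpha_k) omega^(- beta_k);
   [rem_r], [rem_a] and [rem_b] list the eight terms common to the cases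
   1/2 < mu, mu = 1/2 and mu < 1/2 (suffixes 1, 2, 3). Entries are counted
   from 0. *)
Definition rem_r {R : realType} (p1 p2 mu delta K : R) (u : R -> R[i])
    : seq R :=
  let gamma := 2 * delta - 1 in
  let L := Num.sqrt pi / 2 * K `^ gamma in
  let M0 := Linfty p1 p2 u in
  let M := W1infty p1 p2 u in
  [:: 2 `^ (2 - mu) / mu * (2 - mu) * M;
      2 `^ (1 - mu) / mu * M;
      (1 - mu) * (2 `^ (3 - mu) / 3) * M0;
      L / (1 - gamma) * 2 `^ (2 - mu) * (1 - mu) * M;
      L / (1 - gamma) * 2 `^ (1 - mu) * M;
      Num.sqrt pi / 2 `^ (mu - 2) * M0;
      L / (1 - gamma) * (1 - mu) * (p2 - p1) `^ (1 - gamma) * M;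
      L / (1 - gamma) * (p2 - p1) `^ (1 - gamma) * M].

Definition rem_a {R : realType} (mu delta : R) : seq R :=
  let gamma := 2 * delta - 1 in
  [:: 2 - mu; 1 - mu; 4 - mu; 1 + gamma - mu; gamma - mu; 3 - mu;
      2 - mu; 1 - mu].

Definition rem_b {R : realType} (delta : R) : seq R :=
  [:: 1; 1; 2; delta; delta; 3 / 2; delta; delta].

Definition rem_R1 {R : realType} (p1 p2 mu delta K : R) (u : R -> R[i])
    : seq R :=
  Gamma mu / 2 `^ mu * Linfty p1 p2 u :: rem_r p1 p2 mu delta K u.
Definition rem_alpha1 {R : realType} (mu delta : R) : seq R :=
  mu :: rem_a mu delta.
Definition rem_beta1 {R : realType} (mu delta : R) : seq R :=
  mu :: rem_b delta.

Definition rem_R2 {R : realType} (p1 p2 mu delta K : R) (u : R -> R[i])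
    : seq R :=
  rem_r p1 p2 mu delta K u.
Definition rem_alpha2 {R : realType} (mu delta : R) : seq R := rem_a mu delta.
Definition rem_beta2 {R : realType} (delta : R) : seq R := rem_b delta.

Definition rem_R3 {R : realType} (p1 p2 mu delta K : R) (u : R -> R[i])
    : seq R :=
  Num.sqrt pi * Linfty p1 p2 u :: rem_r p1 p2 mu delta K u.
Definition rem_alpha3 {R : realType} (mu delta : R) : seq R :=
  1 - mu :: rem_a mu delta.
Definition rem_beta3 {R : realType} (delta : R) : seq R :=
  2^-1 :: rem_b delta.

(* Main.v *)
(** The tail [F s] of the integral of [t ^ (nu - 1) exp (i t)], with [F = 0] at
    infinity, is estimated by writing [t ^ (nu - 1)] as a Laplace transform:
    [F s] is then [- exp (i s)] times an absolutely convergent integral, which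
    gives [|F s| <= Gamma nu], [|F s| <= s ^ (nu - 1)] and
    [|F s + i s ^ (nu - 1) exp (i s)| <= (1 - nu) s ^ (nu - 2)] with these
    constants. The value [F 0 = - Gamma nu * exp (i pi nu / 2)] comes from
    rotating the pole of the Laplace integral from [- 1] to [i].

    The interval is cut at the midpoint [q] of [p1, p0] and at [p0]. On
    [[p1, q]] the substitution [s = (p0 - p1) ^ 2 - (p - p0) ^ 2] makes the phase
    linear and one integrates by parts against the tail for [nu = mu]; on
    [[q, p0]] and [[p0, p2]] one integrates by parts against the Fresnel tail,
    which is the case [nu = 1 / 2]. The boundary values at [p1] and [p0] are the
    main terms, the one at [p2] vanishes with [U], the leading terms at [q]
    cancel, and what remains is bounded by the eight common terms. When [mu] is
    not [1 / 2], the lower-order main term is moved to the remainder. *)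

(* Integrating [exp (i t - x t)] in [t] first leaves the multiplier [1 / (x - i)] under the Laplace
   integral. It has modulus at most 1 for [x > 0], which is why the tail bounds carry no extra
   constant. The tail is defined by the resulting convergent formula and recognised as a primitive
   by differentiating it, so no conditionally convergent integral has to be handled. No contour is
   deformed either: the pole moves along the unit circle and the integral solves a linear
   differential equation in the angle. Integration by parts takes the same form: for a primitive [S]
   of the integrand and an approximate primitive [phi], the derivative of [S - phi] is bounded by
   that of an explicit [W], and increments are compared. The exponent [delta] arises at [p0]. There
   the Fresnel tail is bounded by [1 / (2 omega x)], not integrable in [x], and by a multiple of
   [omega ^ (- 1 / 2)], only the order of the main term. Interpolation gives
   [omega ^ (- delta) x ^ (- gamma)], which is integrable because [gamma < 1] and of smaller order
   because [delta > 1 / 2]. *)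
Require Import Defs.
From HB Require Import structures.
From mathcomp Require Import all_boot all_order all_algebra.
From mathcomp Require Import complex ring lra.
From mathcomp Require Import all_classical all_reals all_analysis.
From mathcomp Require Import measurable_realfun ess_sup_inf.

Set Implicit Arguments.
Unset Strict Implicit.
Unset Printing Implicit Defensive.

Import Order.TTheory GRing.Theory Num.Theory.
Import numFieldNormedType.Exports.
Import ComplexField.Normc.

Local Open Scope classical_set_scope.
Local Open Scope ring_scope.
Local Open Scope complex_scope.

(** * Improper integrals *)

(* Not a type class, unlike [is_derive], so that derivatives are computed from
   the arguments given and not searched for. *)
Definition derive_at {R : realType} (f : R -> R) (x a : R) : Prop :=
  is_derive x 1 f a.

Section improper_FTC.
Context {R : realType}.
Notation mu := (@lebesgue_measure R).
Variable a : R.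
Implicit Types f F : R -> R.

(** Compact intervals that avoid both ends of []a, +oo[]: the fundamental theorem of calculus
    applies on each, and a convergence theorem passes to the union. *)
Let exhaustion (n : nat) : set R := `[a + n.+1%:R^-1, a + n.+2%:R]%classic.

Let exhaustion_lt n : n.+1%:R^-1 < n.+2%:R :> R.
Proof.
by rewrite (@le_lt_trans _ _ 1)// ?invf_le1// ?ler1n// ltr1n.
Qed.

Let exhaustion_homo : {homo exhaustion : n m / (n <= m)%N >-> (n <= m)%O}.
Proof.
move=> n m nm; apply/subsetPset => x; rewrite /exhaustion /= !in_itv/= => /andP[nx xn].
apply/andP; split.
  by rewrite (le_trans _ nx)// lerD2l lef_pV2 ?posrE ?ltr0n// ler_nat ltnS.
by rewrite (le_trans xn)// lerD2l ler_nat !ltnS.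
Qed.

Let exhaustion_bigcup : \bigcup_n exhaustion n = `]a, +oo[%classic.
Proof.
apply/seteqP; split=> [x [n _]|x]; rewrite /exhaustion /= !in_itv/= andbT.
  by move=> /andP[nx _]; rewrite (lt_le_trans _ nx)// ltrDl invr_gt0.
move=> xa; have x0 : 0 < x - a by rewrite subr_gt0.
have x'0 : 0 < (x - a)^-1 by rewrite invr_gt0.
(* The sum dominates both [(x - a)^-1] and [x - a], so a single index serves both ends of the
   interval. *)
exists (Num.truncn ((x - a)^-1 + (x - a))) => //=; rewrite /exhaustion /= in_itv/=.
set n := Num.truncn _; have /andP[_ xl] : n%:R <= (x - a)^-1 + (x - a) < n.+1%:R.
  by apply: truncn_itv; rewrite addr_ge0// ltW.
rewrite -lerBrDl; apply/andP; split.
  by rewrite -[leRHS]invrK lef_pV2 ?posrE ?invr_gt0//; lra.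
by rewrite -natr1; lra.
Qed.

Let integral_exhaustion f F (n : nat) :
  (forall x : R, a < x -> derive_at F x (f x)) ->
  (forall x : R, a < x -> {for x, continuous f}) ->
  (\int[mu]_(x in exhaustion n) (f x)%:E = (F (a + n.+2%:R))%:E - (F (a + n.+1%:R^-1))%:E)%E.
Proof.
move=> dF cf.
have p (x : R) : a + n.+1%:R^-1 <= x -> a < x.
  by move=> /(lt_le_trans _); apply; rewrite ltrDl invr_gt0.
have cF (x : R) : a < x -> {for x, continuous F}.
  move=> /dF [+ _] => /derivable1_diffP/differentiable_continuous; exact.
apply: continuous_FTC2 => //.
- by rewrite ltrD2l.
- apply: continuous_in_subspaceT => x; rewrite inE/= in_itv/= => /andP[/p ? _].
  exact: cf.
- split.
  + by move=> x; rewrite in_itv/= => /andP[/ltW/p/dF[]].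
  + by apply: cvg_at_right_filter; apply: cF; rewrite ltrDl invr_gt0.
  + by apply: cvg_at_left_filter; apply: cF; rewrite ltrDl ltr0n.
- move=> x; rewrite in_itv/= => /andP[/ltW/p/dF[_ dFx] _].
  by rewrite derive1E.
Qed.

Let cvg_exhaustion F (l0 l : R) : F x @[x --> a^'+] --> l0 -> F x @[x --> +oo] --> l ->
  ((F (a + n.+2%:R))%:E - (F (a + n.+1%:R^-1))%:E)%E @[n --> \oo] --> (l - l0)%:E.
Proof.
move=> F0 Fy; apply: cvg_EFin; first exact: nearW.
apply: cvgB.
  apply: (cvg_comp _ _ _ Fy).
  apply/cvgryPge => A; near=> n.
  rewrite -lerBlDl (@le_trans _ _ n%:R)//; last by rewrite ler_nat !leqW.
  by near: n; exact: nbhs_infty_ger.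
move/cvg_at_rightP : F0; apply; split=> [n|]; first by rewrite ltrDl invr_gt0.
rewrite -[X in _ --> X]addr0; apply: cvgD; first exact: cvg_cst.
exact: cvg_harmonic.
Unshelve. all: by end_near. Qed.

Lemma measurable_continuous_itvoy f : (forall x : R, a < x -> {for x, continuous f}) ->
  measurable_fun (`]a, +oo[ : set R) f.
Proof.
move=> cf; apply: open_continuous_measurable_fun => //.
by move=> x; rewrite inE/= in_itv/= andbT => /cf.
Qed.

(** Monotone convergence along the exhaustion: each partial integral is an increment of [F], hence
    at most [M + M]. An explicit bounded primitive thus replaces any computation of the integral. *)
Lemma ge0_bounded_integrable f F (M : R) :
  (forall x : R, a < x -> 0 <= f x) ->
  (forall x : R, a < x -> derive_at F x (f x)) ->
  (forall x : R, a < x -> {for x, continuous f}) ->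
  (forall x : R, a < x -> `|F x| <= M) ->
  mu.-integrable (`]a, +oo[ : set R) (EFin \o f).
Proof.
move=> f0 dF cf FM.
have mf n : measurable_fun (exhaustion n) (EFin \o f).
  apply/measurable_EFinP; apply: measurable_funS (measurable_continuous_itvoy cf) => //.
  by rewrite -exhaustion_bigcup; exact: bigcup_sup.
apply/integrableP; split.
  by apply/measurable_EFinP; exact: measurable_continuous_itvoy.
under eq_integral.
  move=> x; rewrite inE/= in_itv/= andbT => x0.
  rewrite ger0_norm ?f0//; over.
have := ge0_nondecreasing_set_cvg_integral (mu := mu) exhaustion_homo
  (fun=> measurable_itv _) mf.
rewrite exhaustion_bigcup => /(_ _) H.
have {}H : (\int[mu]_(x in exhaustion i) (f x)%:E)%E @[i --> \oo] -->
    (\int[mu]_(x in `]a, +oo[) (f x)%:E)%E.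
  apply: H => n x; rewrite /exhaustion /= in_itv/= => /andP[nx _].
  by rewrite lee_fin f0// (lt_le_trans _ nx)// ltrDl invr_gt0.
apply: (@le_lt_trans _ _ (M + M)%:E); last exact: ltry.
rewrite -(cvg_lim _ H)//; apply: lime_le; first by apply/cvg_ex; eexists; exact: H.
apply: nearW => n; rewrite (integral_exhaustion n dF cf) -EFinB lee_fin.
have h1 : a < a + n.+1%:R^-1 by rewrite ltrDl invr_gt0.
have h2 : a < a + n.+2%:R by rewrite ltrDl ltr0n.
have := FM _ h1; have := FM _ h2; rewrite !ler_norml => /andP[] _ + /andP[] + _.
lra.
Qed.

(** Here [f] may change sign, so integrability is a hypothesis and dominated convergence by [|f|]
    replaces monotone convergence. *)
Lemma improper_FTC f F (l0 l : R) :
  mu.-integrable (`]a, +oo[ : set R) (EFin \o f) ->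
  (forall x : R, a < x -> derive_at F x (f x)) ->
  (forall x : R, a < x -> {for x, continuous f}) ->
  F x @[x --> a^'+] --> l0 -> F x @[x --> +oo] --> l ->
  \int[mu]_(x in `]a, +oo[) f x = l - l0.
Proof.
move=> intf dF cf F0 Fy.
have mf := measurable_continuous_itvoy cf.
have exh_sub n : exhaustion n `<=` `]a, +oo[%classic.
  by rewrite -exhaustion_bigcup; exact: bigcup_sup.
have H : (\int[mu]_(x in `]a, +oo[) (((EFin \o f) \_ (exhaustion n)) x))%E @[n --> \oo] -->
    (\int[mu]_(x in `]a, +oo[) (f x)%:E)%E.
  apply: (@dominated_cvg _ _ _ mu _ _ (fun n => (EFin \o f) \_ (exhaustion n))
    (EFin \o f) (abse \o (EFin \o f))) => //.
  - move=> n; apply: (iffLR (measurable_restrict _ (measurable_itv _) (measurable_itv _))).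
    by apply/measurable_EFinP; apply: measurable_funS mf => // x [].
  - move=> x; rewrite -exhaustion_bigcup => -[n _ nx].
    apply: (@cvg_near_cst); exists n => //= m nm.
    rewrite patchE ifT// inE.
    by move/subsetPset : (exhaustion_homo nm); apply.
  - exact: integrable_abse.
  - move=> n x x0; rewrite patchE; case: ifPn => //= _.
    by rewrite normr0 lee_fin normr_ge0.
rewrite /Rintegral (_ : integral _ _ _ = (l - l0)%:E)//.
apply: (cvg_unique _ H) => //.
have -> : (fun n => \int[mu]_(x in `]a, +oo[) ((EFin \o f) \_ (exhaustion n)) x)%E =
   (fun n => (F (a + n.+2%:R))%:E - (F (a + n.+1%:R^-1))%:E)%E.
  apply/funext => n /=; rewrite -integral_mkcondr setIidr//.
  exact: integral_exhaustion.
exact: cvg_exhaustion.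
Qed.

End improper_FTC.

(** * Rules for derivatives of real functions *)

Section real_derivatives.
Context {R : realType}.
Implicit Types (f g : R -> R) (x a b c : R).

Lemma derive_at_continuous f x a : derive_at f x a -> {for x, continuous f}.
Proof. by move=> [+ _] => /derivable1_diffP/differentiable_continuous. Qed.

(** Lets the structural rules produce the value of a derivative as a metavariable, which is
    simplified afterwards in a separate equation. *)
Lemma derive_at_cast f x a b : a = b -> derive_at f x a -> derive_at f x b.
Proof. by move=> ->. Qed.

Lemma derive_at_near f g x a : (\near x, f x = g x) ->
  derive_at f x a -> derive_at g x a.
Proof. exact: near_eq_is_derive. Qed.

Lemma derive_at_addf f g x a b : derive_at f x a -> derive_at g x b ->
  derive_at (fun t => f t + g t) x (a + b).
Proof. by move=> fa gb; exact: is_deriveD. Qed.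

Lemma derive_at_oppf f x a : derive_at f x a ->
  derive_at (fun t => - f t) x (- a).
Proof. by move=> fa; exact: is_deriveN. Qed.

Lemma derive_at_subf f g x a b : derive_at f x a -> derive_at g x b ->
  derive_at (fun t => f t - g t) x (a - b).
Proof. by move=> fa gb; exact: is_deriveB. Qed.

Lemma derive_at_mulf f g x a b : derive_at f x a -> derive_at g x b ->
  derive_at (fun t => f t * g t) x (a * g x + f x * b).
Proof.
move=> fa gb; apply: derive_at_cast (is_deriveM fa gb).
by rewrite /GRing.scale/=; ring.
Qed.

Lemma derive_at_cstf c x : derive_at (fun=> c) x 0.
Proof. exact: is_derive_cst. Qed.

Lemma derive_at_idf x : derive_at (fun t : R => t) x 1.
Proof. exact: is_derive_id. Qed.

Lemma derive_at_invf f x a : f x != 0 -> derive_at f x a ->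
  derive_at (fun t => (f t)^-1) x (- a / (f x) ^+ 2).
Proof.
move=> fx0 fa; apply: derive_at_cast (is_deriveV fx0 fa).
by rewrite /GRing.scale/=; field.
Qed.

Lemma derive_at_compf f g x a b : derive_at f (g x) a -> derive_at g x b ->
  derive_at (fun t => f (g t)) x (a * b).
Proof. by move=> fa gb; exact: is_derive1_comp. Qed.

Lemma derive_at_expf g x b : derive_at g x b ->
  derive_at (fun t => expR (g t)) x (expR (g x) * b).
Proof.
by move=> gb; apply: derive_at_compf => //; exact: is_derive_expR.
Qed.

Lemma derive_at_powf g x b c : 0 < g x -> derive_at g x b ->
  derive_at (fun t => g t `^ c) x (c * g x `^ (c - 1) * b).
Proof.
move=> gx gb; by apply: (@derive_at_compf (fun y => y `^ c)) => //; exact: is_derive1_powR.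
Qed.

Lemma continuous_powf c x : 0 < x -> {for x, continuous (fun t => t `^ c)}.
Proof. by move=> x0; exact: derive_at_continuous (is_derive1_powR _ x0). Qed.

End real_derivatives.

Lemma powRDx {R : realType} (x a b : R) : 0 < x -> x `^ (a + b) = x `^ a * x `^ b.
Proof. by move=> x0; rewrite powRD// (gt_eqF x0) implybT. Qed.

Lemma powRVx {R : realType} (x a : R) : 0 < x -> x^-1 `^ a = (x `^ a)^-1.
Proof. by move=> x0; rewrite -powR_inv1 ?ltW// -powRrM mulN1r powRN. Qed.

Section real_integrable.
Context {R : realType}.
Notation mu := (@lebesgue_measure R).
Variable i : interval R.
Let D : set R := [set` i].
Let mD : measurable D := measurable_itv i.
Implicit Types f g : R -> R.

Lemma integrable_mulf f c : mu.-integrable D (EFin \o f) ->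
  mu.-integrable D (EFin \o (fun x => c * f x)).
Proof.
move=> intf; have := @integrableZl _ _ _ mu _ mD c (EFin \o f) intf.
exact: eq_integrable.
Qed.

Lemma integrable_addf f g : mu.-integrable D (EFin \o f) ->
  mu.-integrable D (EFin \o g) -> mu.-integrable D (EFin \o (fun x => f x + g x)).
Proof.
move=> intf intg; have := @integrableD _ _ _ mu _ mD _ _ intf intg.
exact: eq_integrable.
Qed.

Lemma integrable_dominated f g c : measurable_fun D f ->
  (forall x, D x -> `|f x| <= c * g x) -> mu.-integrable D (EFin \o g) ->
  mu.-integrable D (EFin \o f).
Proof.
move=> mf fg /(integrable_mulf c) intg; apply: (@le_integrable _ _ _ mu _ mD) intg => //.
  exact/measurable_EFinP.
by move=> x Dx; rewrite /= lee_fin (le_trans (fg _ Dx))// ler_norm.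
Qed.

End real_integrable.

(** * The common dominating function *)

Section base_integrability.
Context {R : realType}.
Notation mu := (@lebesgue_measure R).
Variables (nu : R) (nu01 : 0 < nu < 1).

(** For [0 < nu < 1] this is integrable at 0 and at infinity; the Laplace kernels below are all
    dominated by multiples of it. *)
Definition base (x : R) := x `^ (- nu) / (1 + x).

Lemma base_ge0 x : 0 < x -> 0 <= base x.
Proof. by move=> x0; rewrite /base divr_ge0 ?powR_ge0//; lra. Qed.

Lemma continuous_base (x : R) : 0 < x -> {for x, continuous base}.
Proof.
move=> x0; have x1 : 1 + x != 0 by rewrite gt_eqF//; lra.
apply: (@derive_at_continuous _ _ x).
apply: derive_at_mulf; first exact: is_derive1_powR.
apply: derive_at_invf; first by [].
by apply: derive_at_addf; [exact: derive_at_cstf|exact: derive_at_idf].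
Qed.

(** [base] is compared with [f1 + f2], the derivative of the explicit bounded function [F]: [f1] has
    the singularity [x ^ (- nu)] at 0 and [f2] the decay [x ^ (- nu - 1)] at infinity. *)
Lemma integrable_base : mu.-integrable (`]0, +oo[ : set R) (EFin \o base).
Proof.
have [nu0 nu1] := andP nu01.
have p1 (a : R) : 1 `^ a = 1 by rewrite powR1.
pose F (x : R) := (x / (1 + x)) `^ (1 - nu) - (1 + x) `^ (- nu).
pose f1 (x : R) := (1 - nu) * (x / (1 + x)) `^ (- nu) / (1 + x) ^+ 2.
pose f2 (x : R) := nu * (1 + x) `^ (- nu - 1).
pose f x := f1 x + f2 x.
have f1_ge0 x : 0 < x -> 0 <= f1 x.
  by move=> x0; rewrite /f1 divr_ge0 ?exprn_ge0 ?mulr_ge0 ?powR_ge0//; lra.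
have f2_ge0 x : 0 < x -> 0 <= f2 x by move=> x0; rewrite mulr_ge0 ?powR_ge0//; lra.
have dq (x : R) : 0 < x -> derive_at (fun x => x / (1 + x)) x (1 / (1 + x) ^+ 2).
  move=> x0; have x1 : 1 + x != 0 by rewrite gt_eqF//; lra.
  apply: derive_at_cast; last first.
    apply: derive_at_mulf; first exact: derive_at_idf.
    apply: derive_at_invf; first by [].
    by apply: derive_at_addf; [exact: derive_at_cstf|exact: derive_at_idf].
  by rewrite /=; field.
have d1 (x : R) : derive_at (fun x => 1 + x) x (0 + 1).
  by apply: derive_at_addf; [exact: derive_at_cstf|exact: derive_at_idf].
have dF (x : R) : 0 < x -> derive_at F x (f x).
  move=> x0; have x1 : 1 + x != 0 by rewrite gt_eqF//; lra.
  apply: derive_at_cast; last first.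
    apply: derive_at_subf.
      by apply: derive_at_powf; [|exact: dq]; rewrite divr_gt0//; lra.
    by apply: derive_at_powf; [|exact: d1]; lra.
  rewrite /f/f1/f2; rewrite (_ : 1 - nu - 1 = - nu); last by ring.
  by rewrite /=; field.
have cf (x : R) : 0 < x -> {for x, continuous f}.
  move=> x0; have x1 : 1 + x != 0 by rewrite gt_eqF//; lra.
  apply: (@derive_at_continuous _ _ x).
  apply: derive_at_addf; apply: derive_at_mulf.
  - apply: derive_at_mulf; first exact: derive_at_cstf.
    by apply: derive_at_powf; [|exact: dq]; rewrite divr_gt0//; lra.
  - apply: derive_at_invf; first by rewrite expf_neq0.
    by apply: derive_at_mulf; exact: d1.
  - exact: derive_at_cstf.
  - by apply: derive_at_powf; [|exact: d1]; lra.
have intf : mu.-integrable (`]0, +oo[ : set R) (EFin \o f).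
  apply: (ge0_bounded_integrable (F := F) (M := 1)) => // [x x0|x x0].
    by rewrite addr_ge0 ?f1_ge0 ?f2_ge0.
  have A : 0 <= (x / (1 + x)) `^ (1 - nu) <= 1.
    rewrite powR_ge0/= -[leRHS](p1 (1 - nu)) ge0_ler_powR ?nnegrE//; try lra.
      by rewrite divr_ge0//; lra.
    by rewrite ler_pdivrMr; lra.
  have B : 0 <= (1 + x) `^ (- nu) <= 1.
    rewrite powR_ge0/= powRN invf_le1 ?powR_gt0; try lra.
    rewrite -[leLHS](p1 nu) ge0_ler_powR ?nnegrE//; lra.
  by rewrite /F ler_norml; lra.
(* The first summand serves [x <= 1] through [f1], since [2 / (1 + x) >= 1] there; the second serves
   [x > 1] through [f2], since [(1 + x) / 2 <= x] there. *)
pose C := 2 / (1 - nu) + 2 / nu.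
have C0 : 0 <= C by rewrite addr_ge0// divr_ge0//; lra.
apply: (integrable_dominated (g := f) (c := C)) => //.
  by apply: measurable_continuous_itvoy => x; exact: continuous_base.
move=> x /=; rewrite in_itv/= andbT => x0; rewrite ger0_norm ?base_ge0//.
have x1 : 1 + x != 0 by rewrite gt_eqF//; lra.
have [xl|xl] := leP x 1.
  apply: (@le_trans _ _ (2 / (1 - nu) * f1 x)).
    rewrite /base /f1 powRM; [|lra|by rewrite invr_ge0; lra].
    rewrite powRVx; last lra.
    have : 1 <= ((1 + x) `^ (- nu))^-1.
      rewrite powRN invrK -[leLHS](p1 nu) ge0_ler_powR ?nnegrE//; lra.
    set y := _^-1 => y1; set z := x `^ _.
    have z0 : 0 <= z by exact: powR_ge0.
    have -> : 2 / (1 - nu) * ((1 - nu) * (z * y) / (1 + x) ^+ 2) =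
      z / (1 + x) * (y * (2 / (1 + x))).
      by field; rewrite x1 gt_eqF//; lra.
    rewrite ler_peMr ?divr_ge0//; first lra.
    rewrite -[leLHS]mulr1 ler_pM//.
    by rewrite ler_pdivlMr; lra.
  apply: (@le_trans _ _ (2 / (1 - nu) * f x)).
    by rewrite /f ler_wpM2l ?divr_ge0 ?lerDl ?f2_ge0//; lra.
  rewrite /C (mulrDl (2 / (1 - nu))) lerDl mulr_ge0//.
    by rewrite divr_ge0//; lra.
  by rewrite addr_ge0 ?f1_ge0 ?f2_ge0.
apply: (@le_trans _ _ (2 / nu * f2 x)).
  rewrite /base /f2 powRDx ?powRN; last by lra.
  rewrite powRr1; last by lra.
  have -> : 2 / nu * (nu * (((1 + x) `^ nu)^-1 / (1 + x))) =
       (2 * ((1 + x) `^ nu)^-1) / (1 + x).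
    field; rewrite x1 gt_eqF ?powR_gt0//=; lra.
  rewrite ler_pM2r; last by rewrite invr_gt0; lra.
  rewrite -[leRHS]invrK invfM invrK lef_pV2 ?posrE ?powR_gt0//; last first.
    by rewrite mulr_gt0 ?invr_gt0 ?powR_gt0//; lra.
  apply: (@le_trans _ _ (2^-1 `^ nu * (1 + x) `^ nu)).
    rewrite ler_wpM2r ?powR_ge0// -[leLHS]powRr1; last lra.
    by rewrite ger_powR//; lra.
  rewrite -powRM; [|lra|lra].
  by rewrite ge0_ler_powR ?nnegrE//; lra.
apply: (@le_trans _ _ (2 / nu * f x)).
  by rewrite /f ler_wpM2l ?divr_ge0 ?lerDr ?f1_ge0//; lra.
rewrite /C (mulrDl (2 / (1 - nu))) lerDr mulr_ge0//.
  by rewrite divr_ge0//; lra.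
by rewrite addr_ge0 ?f1_ge0 ?f2_ge0.
Qed.

End base_integrability.

(** * Integrals over the half-line depending on a parameter *)

Section parameter_integral.
Context {R : realType}.
Notation mu := (@lebesgue_measure R).
Implicit Types (f d : R -> R -> R) (G : R -> R).

Lemma derive_at_under f d G (u v a : R) : u < a < v ->
  (forall s, u < s < v -> mu.-integrable (`]0, +oo[ : set R) (EFin \o f s)) ->
  (forall s x, u < s < v -> 0 < x -> derive_at (f ^~ x) s (d s x)) ->
  mu.-integrable (`]0, +oo[ : set R) (EFin \o G) ->
  (forall s x, u < s < v -> 0 < x -> `|d s x| <= G x) ->
  derive_at (fun s => \int[mu]_(x in `]0, +oo[) f s x) a
    (\int[mu]_(x in `]0, +oo[) d a x).
Proof.
move=> uav intf df intG dG.
have mI : measurable (`]0, +oo[%classic : set R) := measurable_itv _.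
have Ia : `]u, v[%classic a by rewrite /= in_itv.
have intf' x : `]u, v[%classic x -> mu.-integrable (`]0, +oo[ : set R) (EFin \o f x).
  by rewrite /= in_itv/= => /intf.
have df' x y : `]u, v[%classic x -> (`]0, +oo[%classic : set R) y -> derivable (f ^~ y) x 1.
  by rewrite /= !in_itv/= andbT => xuv y0; have [] := df _ _ xuv y0.
have d1 x y : u < x < v -> 0 < y -> partial1of2 f x y = d x y.
  by move=> xuv y0; have [_ <-] := df _ _ xuv y0; rewrite partial1of2E.
have intG' : mu.-integrable (`]0, +oo[ : set R) (EFin \o (fun x => `|G x|)).
  exact: (@integrable_abse _ _ _ mu _ _ intG).
have G_ub x y : `]u, v[%classic x -> (`]0, +oo[%classic : set R) y -> `|partial1of2 f x y| <= `|G y|.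
  rewrite /= !in_itv/= andbT => xuv y0.
  by rewrite d1// (le_trans (dG _ _ xuv y0))// ler_norm.
apply: DeriveDef.
  exact: (@derivable_under_integral _ _ _ mu f _ mI _ _ _ Ia intf' df' _
    (fun=> normr_ge0 _) intG' G_ub).
rewrite -derive1E (@differentiation_under_integral _ _ _ mu f _ mI _ _ _ Ia intf' df' _
    (fun=> normr_ge0 _) intG' G_ub).
by apply: eq_Rintegral => x; rewrite inE/= in_itv/= andbT => x0; exact: d1.
Qed.

Lemma continuous_under f G (u v a : R) : u < a < v ->
  (forall s, u < s < v -> mu.-integrable (`]0, +oo[ : set R) (EFin \o f s)) ->
  (forall s x, u < s < v -> 0 < x -> {for s, continuous (f ^~ x)}) ->
  mu.-integrable (`]0, +oo[ : set R) (EFin \o G) ->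
  (forall s x, u < s < v -> 0 < x -> `|f s x| <= G x) ->
  {for a, continuous (fun s => \int[mu]_(x in `]0, +oo[) f s x)}.
Proof.
move=> uav intf cf intG fG.
have mI : measurable (`]0, +oo[%classic : set R) := measurable_itv _.
apply: (@continuity_under_integral _ _ _ mu f _ mI u v _ _ G intG); last by rewrite inE/= in_itv.
- by move=> x; rewrite /= in_itv/=; exact: intf.
- apply: aeW => x; rewrite /= in_itv/= andbT => x0 s; rewrite inE/= in_itv/= => suv.
  exact: cf.
- move=> s; rewrite /= in_itv/= => suv; apply: aeW => x; rewrite /= in_itv/= andbT.
  exact: fG.
Qed.

Lemma Rintegral_lin (f g : R -> R) (a b : R) :
  mu.-integrable (`]0, +oo[ : set R) (EFin \o f) ->
  mu.-integrable (`]0, +oo[ : set R) (EFin \o g) ->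
  \int[mu]_(x in `]0, +oo[) (a * f x + b * g x) =
  a * (\int[mu]_(x in `]0, +oo[) f x) + b * (\int[mu]_(x in `]0, +oo[) g x).
Proof.
move=> intf intg.
have mI : measurable (`]0, +oo[%classic : set R) := measurable_itv _.
rewrite (@RintegralD _ _ _ mu _ (fun x => a * f x) (fun x => b * g x) mI);
  [|exact: integrable_mulf|exact: integrable_mulf].
by rewrite !(@RintegralZl _ _ _ mu).
Qed.

Lemma eq_Rintegral0y (f g : R -> R) : (forall x, 0 < x -> f x = g x) ->
  \int[mu]_(x in `]0, +oo[) f x = \int[mu]_(x in `]0, +oo[) g x.
Proof.
by move=> fg; apply: eq_Rintegral => x; rewrite inE/= in_itv/= andbT => /fg.
Qed.

Lemma le_Rintegral0y (f g : R -> R) :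
  mu.-integrable (`]0, +oo[ : set R) (EFin \o f) ->
  mu.-integrable (`]0, +oo[ : set R) (EFin \o g) ->
  (forall x, 0 < x -> f x <= g x) ->
  \int[mu]_(x in `]0, +oo[) f x <= \int[mu]_(x in `]0, +oo[) g x.
Proof.
move=> intf intg fg.
have mI : measurable (`]0, +oo[%classic : set R) := measurable_itv _.
apply: (@le_Rintegral _ _ _ mu _ _ _ mI) => //.
by move=> x; rewrite /= in_itv/= andbT => /fg.
Qed.

Lemma zero_derive_eq (f : R -> R) a b : a < b ->
  (forall x, a <= x <= b -> derive_at f x 0) -> f a = f b.
Proof.
move=> ab df; have cf : {within `[a, b], continuous f}.
  apply: continuous_in_subspaceT => x; rewrite inE/= in_itv/= => /df.
  exact: derive_at_continuous.
have df' x : x \in `]a, b[ -> is_derive x 1 f 0.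
  by rewrite in_itv/= => /andP[/ltW ax /ltW xb]; apply: df; rewrite ax.
have [c _] := MVT ab df' cf.
by rewrite mul0r => /eqP; rewrite subr_eq0 => /eqP.
Qed.

End parameter_integral.

Section limits.
Context {R : realType}.
Implicit Types (F : R -> R) (C a : R).

Lemma cvg0_powR_bound F C a : 0 < a ->
  (forall x, 0 < x < 1 -> `|F x| <= C * x `^ a) -> F x @[x --> 0^'+] --> (0 : R).
Proof.
move=> a0 FC; apply: norm_cvg0.
apply: (@squeeze_cvgr _ _ _ _ (fun=> 0) (fun x => C * x `^ a)).
- near=> x; rewrite normr_ge0/= FC//; apply/andP; split.
    by near: x; exact: nbhs_right_gt.
  by near: x; exact: nbhs_right_lt.
- exact: cvg_cst.
- by rewrite -[X in _ --> X](mulr0 C); apply: cvgMr; exact: powR_cvg0.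
Unshelve. all: by end_near. Qed.

Lemma cvgy_inv_bound F C :
  (forall x, 1 < x -> `|F x| <= C / x) -> F x @[x --> +oo] --> (0 : R).
Proof.
move=> FC; apply: norm_cvg0.
apply: (@squeeze_cvgr _ _ _ _ (fun=> 0) (fun x => C * x^-1)).
- near=> x; rewrite normr_ge0/= FC//.
- exact: cvg_cst.
- rewrite -[X in _ --> X](mulr0 C); apply: cvgMr.
  apply/cvgrPdist_le => e e0; near=> x.
  have x0 : 0 < x by near: x; apply: nbhs_pinfty_gt; rewrite num_real.
  rewrite sub0r normrN ger0_norm ?invr_ge0 ?ltW//.
  rewrite invf_plt ?posrE//; near: x; apply: nbhs_pinfty_gt.
  by rewrite num_real.
Unshelve. all: by end_near. Qed.

(** Half of the exponential absorbs the factor [x], by [1 + y <= expR y] at [y = x * s / 2]; the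
    other half keeps a Laplace kernel integrable. *)
Lemma xexpR_le (x s : R) : 0 < s -> 0 < x ->
  x * expR (- (x * s)) <= 2 / s * expR (- (x * (s / 2))).
Proof.
move=> s0 x0; have -> : - (x * s) = - (x * (s / 2)) - x * (s / 2) by field.
rewrite expRD mulrCA (mulrC (2 / s)) ler_pM2l ?expR_gt0// expRN ler_pdivrMr ?expR_gt0//.
apply: (@le_trans _ _ (2 / s * (1 + x * (s / 2)))).
  rewrite mulrDr (_ : 2 / s * (x * (s / 2)) = x); last by field; rewrite gt_eqF.
  by rewrite lerDr mulr1 divr_ge0//; lra.
by rewrite ler_wpM2l ?expR_ge1Dx// divr_ge0//; lra.
Qed.

(** Both halves of the exponential are spent, each through [y <= expR y] at [y = x * s / 2], which
    leaves decay in [x]. *)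
Lemma xexpR_le_inv (x s : R) : 0 < s -> 0 < x ->
  x * expR (- (x * s)) <= 4 / s ^+ 2 / x.
Proof.
move=> s0 x0; have e0 := expR_gt0 (x * s / 2).
have y0 : 0 < x * s / 2 by rewrite divr_gt0 ?mulr_gt0.
have H : x * s / 2 <= expR (x * s / 2) by have := expR_ge1Dx (x * s / 2); lra.
have -> : - (x * s) = - (x * s / 2 + x * s / 2) by field.
rewrite expRN expRD ler_pdivrMr ?mulr_gt0//.
rewrite [leLHS](_ : x = 4 / s ^+ 2 / x * (x * s / 2 * (x * s / 2))); last first.
  by field; rewrite !gt_eqF.
rewrite ler_wpM2l//; first by rewrite !divr_ge0 ?exprn_ge0 ?ltW.
by rewrite ler_pM// ltW.
Qed.
End limits.

(** * Laplace transforms *)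

Section laplace.
Context {R : realType}.
Notation mu := (@lebesgue_measure R).
Implicit Types (phi psi : R -> R) (s x : R).

Definition laplace phi s : R :=
  \int[mu]_(x in `]0, +oo[) (phi x * expR (- (x * s))).

Lemma derive_at_expRx x s : derive_at (fun s => expR (- (x * s))) s (- (x * expR (- (x * s)))).
Proof.
apply: derive_at_cast; last first.
  apply: derive_at_expf; apply: derive_at_oppf; apply: derive_at_mulf.
    exact: derive_at_cstf.
  exact: derive_at_idf.
by rewrite /=; ring.
Qed.

Lemma continuous_kernel phi s x : {for x, continuous phi} ->
  {for x, continuous (fun x => phi x * expR (- (x * s)))}.
Proof.
move=> cphi; apply: continuousM => //.
apply: (@derive_at_continuous _ _ _ (- (s * expR (- (s * x))))).
under eq_fun do rewrite mulrC; exact: derive_at_expRx.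
Qed.

(** Comes from [expR (- (x * s)) <= (1 + x * s)^-1]. The constant blows up as [s] tends to 0, so
    this serves each fixed [s > 0] only. *)
Lemma expR_base nu s x : 0 < s -> 0 < x ->
  x `^ (- nu) * expR (- (x * s)) <= (1 + 1 / s) * base nu x.
Proof.
move=> s0 x0; rewrite /base mulrCA ler_wpM2l ?powR_ge0//.
rewrite expRN -[leRHS]invrK invfM invrK lef_pV2 ?posrE ?expR_gt0//; last first.
  by rewrite mulr_gt0 ?invr_gt0 ?addr_gt0 ?divr_gt0.
apply: (@le_trans _ _ (1 + x * s)); last exact: expR_ge1Dx.
have -> : (1 + 1 / s)^-1 * (1 + x) = (1 + x) * s / (1 + s).
  by field; rewrite !gt_eqF//; lra.
rewrite ler_pdivrMr; last lra.
have : 0 < x * s by rewrite mulr_gt0.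
nra.
Qed.

Lemma expR_le1_mul s x : 0 <= s -> 0 < x -> expR (- (x * s)) <= 1.
Proof. by move=> s0 x0; rewrite expR_le1 oppr_le0 mulr_ge0// ltW. Qed.

(** * Kernels bounded by [x ^ (- nu)]: transforms at positive [s] *)

Section kernel.
Variables (nu C : R) (phi : R -> R).
Hypotheses (nu01 : 0 < nu < 1) (C0 : 0 <= C).
Hypothesis cphi : forall x, 0 < x -> {for x, continuous phi}.
Hypothesis phi_le : forall x, 0 < x -> `|phi x| <= C * x `^ (- nu).

Let measurable_kernel s psi : (forall x, 0 < x -> {for x, continuous psi}) ->
  measurable_fun (`]0, +oo[%classic : set R) (fun x => psi x * expR (- (x * s))).
Proof.
by move=> cpsi; apply: measurable_continuous_itvoy => x /cpsi; exact: continuous_kernel.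
Qed.

Lemma integrable_laplace s : 0 < s ->
  mu.-integrable (`]0, +oo[ : set R) (EFin \o (fun x => phi x * expR (- (x * s)))).
Proof.
move=> s0; apply: (@integrable_dominated _ _ _ (base nu) (C * (1 + 1 / s))).
- exact: measurable_kernel.
- move=> x; rewrite /= in_itv/= andbT => x0.
  rewrite normrM (ger0_norm (expR_ge0 _)) -mulrA.
  apply: le_trans (ler_wpM2r (expR_ge0 _) (phi_le x0)) _.
  by rewrite -mulrA ler_wpM2l// expR_base.
- exact: integrable_base.
Qed.

Let xphi_le s x : 0 < s -> 0 < x ->
  `|x * phi x * expR (- (x * s))| <= C * (2 / s * (1 + 1 / (s / 2))) * base nu x.
Proof.
move=> s0 x0; rewrite normrM (ger0_norm (expR_ge0 _)) normrM (gtr0_norm x0).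
rewrite (mulrC x) -[leLHS]mulrA.
apply: le_trans (ler_wpM2l (normr_ge0 _) (xexpR_le s0 x0)) _.
apply: le_trans (ler_wpM2r _ (phi_le x0)) _.
  by rewrite mulr_ge0 ?expR_ge0// divr_ge0//; lra.
rewrite -[leLHS]mulrA -[leRHS]mulrA ler_wpM2l// mulrCA -[leRHS]mulrA.
rewrite ler_wpM2l ?divr_ge0 ?(ltW s0)//.
by rewrite expR_base// divr_gt0.
Qed.

Let cxphi x : 0 < x -> {for x, continuous (fun x => x * phi x)}.
Proof. by move=> x0; apply: continuousM; [exact: cvg_id|exact: cphi]. Qed.

Lemma integrable_xlaplace s : 0 < s ->
  mu.-integrable (`]0, +oo[ : set R) (EFin \o (fun x => x * phi x * expR (- (x * s)))).
Proof.
move=> s0; apply: (@integrable_dominated _ _ _ (base nu)).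
- exact: measurable_kernel.
- by move=> x; rewrite /= in_itv/= andbT => x0; exact: xphi_le.
- exact: integrable_base.
Qed.

Lemma derive_at_laplace s : 0 < s ->
  derive_at (laplace phi) s (- laplace (fun x => x * phi x) s).
Proof.
move=> s0.
apply: derive_at_cast; last first.
  (* On []s / 2, s + 1[] the differentiated kernel is dominated by its value at [s / 2], and
     [xphi_le] at [s / 2] supplies the constant. *)
  apply: (@derive_at_under _ (fun s x => phi x * expR (- (x * s)))
    (fun s x => - (x * phi x * expR (- (x * s))))
    (fun x => C * (2 / (s / 2) * (1 + 1 / (s / 2 / 2))) * base nu x) (s / 2) (s + 1)).
  - by lra.
  - by move=> t ts; apply: integrable_laplace; lra.
  - move=> t x ts x0; apply: derive_at_cast; last first.
      by apply: derive_at_mulf; [exact: derive_at_cstf|exact: derive_at_expRx].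
    by rewrite /=; ring.
  - by apply: integrable_mulf; exact: integrable_base.
  - move=> t x /andP[st _] x0; rewrite normrN.
    have s20 : 0 < s / 2 by rewrite divr_gt0.
    apply: le_trans (xphi_le s20 x0).
    rewrite !normrM ler_wpM2l ?mulr_ge0// !(ger0_norm (expR_ge0 _)) ler_expR lerN2.
    by rewrite ler_wpM2l// ltW.
rewrite /laplace -[RHS]mulN1r -(@RintegralZl _ _ _ mu)//; last exact: integrable_xlaplace.
by apply: eq_Rintegral => x _; rewrite mulN1r.
Qed.

End kernel.

(** * Kernels bounded by [base]: transforms continuous up to [s = 0] *)

Section bounded_kernel.
Variables (nu C : R) (phi : R -> R).
Hypotheses (nu01 : 0 < nu < 1) (C0 : 0 <= C).
Hypothesis cphi : forall x, 0 < x -> {for x, continuous phi}.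
Hypothesis phi_le : forall x, 0 < x -> `|phi x| <= C * base nu x.

Let kernel_le s x : 0 <= s -> 0 < x -> `|phi x * expR (- (x * s))| <= C * base nu x.
Proof.
move=> s0 x0; rewrite normrM (ger0_norm (expR_ge0 _)).
by apply: le_trans (phi_le x0); rewrite ler_piMr// expR_le1_mul.
Qed.

Lemma integrable_laplace0 s : 0 <= s ->
  mu.-integrable (`]0, +oo[ : set R) (EFin \o (fun x => phi x * expR (- (x * s)))).
Proof.
move=> s0; apply: (@integrable_dominated _ _ _ (base nu) C).
- by apply: measurable_continuous_itvoy => x /cphi; exact: continuous_kernel.
- by move=> x; rewrite /= in_itv/= andbT => x0; exact: kernel_le.
- exact: integrable_base.
Qed.

(** The domination by [C * base nu] is uniform in [s >= 0]. The even extension through [|s|] makes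
    continuity at 0 two-sided, so no one-sided limits enter later. *)
Lemma continuous_laplace : continuous (fun s => laplace phi `|s|).
Proof.
move=> s; apply: (@continuous_under _ (fun s x => phi x * expR (- (x * `|s|)))
  (fun x => C * base nu x) (s - 1) (s + 1)).
- by lra.
- by move=> t _; apply: integrable_laplace0.
- move=> t x _ x0.
  apply: continuousM; first exact: cvg_cst.
  have c1 : {for `|t|, continuous (fun t => expR (- (x * t)))}.
    exact: derive_at_continuous (derive_at_expRx _ _).
  have c2 : {for t, continuous (fun t : R => `|t|)} by exact: norm_continuous.
  exact: (continuous_comp c2 c1).
- by apply: integrable_mulf; exact: integrable_base.
- by move=> t x _ x0; exact: kernel_le.
Qed.

End bounded_kernel.
End laplace.

(** * The Laplace transform of [x ^ (- nu)] and Gamma *)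

Section gamma_laplace.
Context {R : realType}.
Notation mu := (@lebesgue_measure R).
Variables (nu : R) (nu01 : 0 < nu < 1).

Definition npow (x : R) := x `^ (- nu).

Lemma continuous_npow x : 0 < x -> {for x, continuous npow}.
Proof. exact: continuous_powf. Qed.

Lemma npow_le x : 0 < x -> `|npow x| <= 1 * x `^ (- nu).
Proof. by move=> x0; rewrite mul1r ger0_norm// powR_ge0. Qed.

Lemma mul_npow x : 0 < x -> x * npow x = x `^ (1 - nu).
Proof. by move=> x0; rewrite powRDx// powRr1// ltW. Qed.

Lemma laplace_npow1 : laplace npow 1 = Gamma (1 - nu).
Proof.
apply: eq_Rintegral0y => x x0.
by rewrite /npow mulr1; congr (_ `^ _ * _); ring.
Qed.

Lemma integrable_npow s : 0 < s ->
  mu.-integrable (`]0, +oo[ : set R) (EFin \o (fun x => npow x * expR (- (x * s)))).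
Proof.
by move=> s0; apply: (integrable_laplace (C := 1) nu01) => // x; [exact: continuous_npow|exact: npow_le].
Qed.

Lemma integrable_xnpow s : 0 < s ->
  mu.-integrable (`]0, +oo[ : set R) (EFin \o (fun x => x * npow x * expR (- (x * s)))).
Proof.
by move=> s0; apply: (integrable_xlaplace (C := 1) nu01) => // x; [exact: continuous_npow|exact: npow_le].
Qed.

(** The left side is the integral over []0, +oo[] of the derivative of [x ^ (1 - nu) exp (- x s)], a
    function that vanishes at both ends. *)
Lemma laplace_xnpow s : 0 < s ->
  (1 - nu) * laplace npow s - s * laplace (fun x => x * npow x) s = 0.
Proof.
move=> s0; have [nu0 nu1] := andP nu01.
pose F (x : R) := x `^ (1 - nu) * expR (- (x * s)).
pose f (x : R) := (1 - nu) * (npow x * expR (- (x * s))) +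
  (- s) * (x * npow x * expR (- (x * s))).
have dF (x : R) : 0 < x -> derive_at F x (f x).
  move=> x0; apply: derive_at_cast; last first.
    apply: derive_at_mulf.
      exact: is_derive1_powR.
    apply: derive_at_expf; apply: derive_at_oppf.
    by apply: derive_at_mulf; [exact: derive_at_idf|exact: derive_at_cstf].
  rewrite /f /= mul_npow// /npow (_ : 1 - nu - 1 = - nu); last by ring.
  by ring.
rewrite -mulNr -Rintegral_lin; [|exact: integrable_npow|exact: integrable_xnpow].
rewrite (@improper_FTC _ _ f F 0 0) ?subrr//.
- by apply: integrable_addf; apply: integrable_mulf; [exact: integrable_npow|exact: integrable_xnpow].
- move=> x x0; apply: continuousD; (apply: continuousM; first exact: cvg_cst).
    by apply: continuous_kernel; exact: continuous_npow.
  apply: continuous_kernel; apply: continuousM; first exact: cvg_id.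
  exact: continuous_npow.
- apply: (@cvg0_powR_bound _ _ 1 (1 - nu)); first lra.
  move=> x /andP[x0 _]; rewrite ger0_norm ?mulr_ge0 ?powR_ge0 ?expR_ge0// [leLHS]mulrC.
  by rewrite ler_wpM2r ?powR_ge0 ?expR_le1_mul// ltW.
- apply: (@cvgy_inv_bound _ _ (4 / s ^+ 2)) => x x1.
  rewrite ger0_norm ?mulr_ge0 ?powR_ge0 ?expR_ge0//.
  apply: le_trans (xexpR_le_inv s0 _); last lra.
  rewrite ler_wpM2r ?expR_ge0// -[leRHS]powRr1; last lra.
  by rewrite ler_powR; lra.
Qed.

(** In place of the substitution [x -> x / s]: by [laplace_xnpow] the function [h] has zero
    derivative, and its value at 1 is [Gamma (1 - nu)]. *)
Lemma laplace_npow s : 0 < s -> laplace npow s = Gamma (1 - nu) * s `^ (nu - 1).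
Proof.
pose h s := s `^ (1 - nu) * laplace npow s.
have dh (t : R) : 0 < t -> derive_at h t 0.
  move=> t0; apply: derive_at_cast; last first.
    apply: derive_at_mulf.
      exact: is_derive1_powR.
    apply: (derive_at_laplace nu01 (C := 1)) => // x; [exact: continuous_npow|exact: npow_le].
  rewrite /= mulrN.
  have := laplace_xnpow t0; set A := laplace _ _; set B := laplace _ _ => AB.
  rewrite (_ : 1 - nu = (1 - nu - 1) + 1); last by ring.
  rewrite [in X in _ - X]powRDx// powRr1 ?ltW//.
  rewrite (_ : 1 - nu - 1 + 1 = 1 - nu); last by ring.
  transitivity (t `^ (1 - nu - 1) * ((1 - nu) * A - t * B)); first by ring.
  by rewrite AB mulr0.
have hE (t : R) : 0 < t -> h t = Gamma (1 - nu).
  move=> t0; rewrite -laplace_npow1 (_ : laplace npow 1 = h 1); last first.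
    by rewrite /h powR1 mul1r.
  have [t1|t1|-> //] := ltgtP t 1.
    by apply: zero_derive_eq => // x /andP[tx _]; apply: dh; lra.
  by apply/esym; apply: zero_derive_eq => // x /andP[tx _]; apply: dh; lra.
move=> s0; rewrite -(hE _ s0) /h mulrAC -powRDx// (_ : 1 - nu + (nu - 1) = 0); last by ring.
by rewrite powRr0 mul1r.
Qed.

(** Comparison with [exp (- 2 x)], whose integral is [1 / 2]: one has [x ^ nu <= 1 + x <= exp x]. *)
Lemma Gamma_gt0 : 0 < Gamma (1 - nu).
Proof.
have [nu0 nu1] := andP nu01.
rewrite -laplace_npow1.
have dF (x : R) : 0 < x ->
    derive_at (fun x => - (2^-1) * expR (- (x * 2))) x (expR (- (x * 2))).
  move=> x0; apply: derive_at_cast; last first.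
    apply: derive_at_mulf; first exact: derive_at_cstf.
    apply: derive_at_expf; apply: derive_at_oppf.
    by apply: derive_at_mulf; [exact: derive_at_idf|exact: derive_at_cstf].
  by rewrite /=; field.
have cf (x : R) : {for x, continuous (fun x : R => expR (- (x * 2)))}.
  apply: (@derive_at_continuous _ _ _ (- (2 * expR (- (2 * x))))).
  under eq_fun do rewrite mulrC; exact: derive_at_expRx.
have le_npow (x : R) : 0 < x -> expR (- (x * 2)) <= npow x * expR (- (x * 1)).
  move=> x0; rewrite (_ : - (x * 2) = - x + - (x * 1)); last by ring.
  rewrite expRD ler_wpM2r ?expR_ge0// expRN /npow powRN lef_pV2 ?posrE ?expR_gt0 ?powR_gt0//.
  apply: le_trans (expR_ge1Dx x).
  have [x1|x1] := leP x 1.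
    apply: (@le_trans _ _ (1 `^ nu)); last by rewrite powR1; lra.
    by rewrite ge0_ler_powR ?nnegrE//; lra.
  apply: (@le_trans _ _ (x `^ 1)); last by rewrite powRr1; lra.
  by rewrite ler_powR; lra.
have int2 : mu.-integrable (`]0, +oo[ : set R) (EFin \o (fun x : R => expR (- (x * 2)))).
  apply: (integrable_dominated (c := 1) _ _ (integrable_npow ltr01)).
    by apply: measurable_continuous_itvoy => x _; exact: cf.
  move=> x; rewrite /= in_itv/= andbT => x0.
  by rewrite mul1r ger0_norm ?expR_ge0//; exact: le_npow.
have H : \int[mu]_(x in `]0, +oo[) expR (- (x * 2)) = 0 - - 2^-1 :> R.
  apply: improper_FTC dF _ _ _ => //.
    have : {for (0 : R), continuous (fun x : R => - (2^-1) * expR (- (x * 2)))}.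
      by apply: continuousM; [exact: cvg_cst|exact: cf].
    rewrite /prop_for /continuous_at mul0r oppr0 expR0 mulr1.
    exact: cvg_at_right_filter.
  apply: (@cvgy_inv_bound _ _ 1) => x x1.
  rewrite normrM normrN (ger0_norm (expR_ge0 _)) ger0_norm// expRN mul1r.
  have := expR_ge1Dx (x * 2) => xe.
  apply: (@le_trans _ _ (expR (x * 2))^-1).
    by rewrite ler_piMl ?invr_ge0 ?expR_ge0//; lra.
  by rewrite lef_pV2 ?posrE ?expR_gt0//; lra.
apply: (@lt_le_trans _ _ (\int[mu]_(x in `]0, +oo[) expR (- (x * 2)))).
  by rewrite H; lra.
exact: (le_Rintegral0y int2 (integrable_npow ltr01)).
Qed.

End gamma_laplace.

(** * The resolvent kernel and the reflection of Gamma *)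

Section resolvent_kernel.
Context {R : realType}.
Notation mu := (@lebesgue_measure R).
Variables (nu : R) (nu01 : 0 < nu < 1).
Implicit Types c sg x s : R.

(* With [z = c - i sg] of modulus 1, [1 / (x + z)] is
   [(x + c + i sg) / (x ^ 2 + 2 c x + 1)]; [rker] and [iker] are the real and the
   imaginary part of [x ^ (- nu) / (x + z)]. *)
Definition rden c x := x ^+ 2 + 2 * c * x + 1.
Definition rker c x := npow nu x * ((x + c) / rden c x).
Definition iker c sg x := npow nu x * (sg / rden c x).

(** At [c = - (3 / 4)] the difference of the two sides is exactly [7 (x - 1) ^ 2], and in [rden_ge4]
    it is [3 (x - 1) ^ 2]; hence the constants 8 and 4. The margin below [c = 0] lets the angle pass
    a little beyond [pi / 2], so that two-sided derivatives exist there. *)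
Lemma rden_ge c x : - (3 / 4) <= c -> 0 < x -> (1 + x) ^+ 2 <= 8 * rden c x.
Proof.
rewrite /rden => c1 x0; have := sqr_ge0 (x - 1).
have : 0 <= (c + 3 / 4) * x by rewrite mulr_ge0//; lra.
by nra.
Qed.

Lemma rden_ge4 c x : - (3 / 4) <= c -> 0 < x -> x ^+ 2 + 1 <= 4 * rden c x.
Proof.
rewrite /rden => c1 x0; have := sqr_ge0 (x - 1).
have : 0 <= (c + 3 / 4) * x by rewrite mulr_ge0//; lra.
by nra.
Qed.

Lemma rden_gt0 c x : - (3 / 4) <= c -> 0 < x -> 0 < rden c x.
Proof. by move=> c1 x0; have := rden_ge4 c1 x0; have := sqr_ge0 x; lra. Qed.

Lemma derive_at_rden c x : derive_at (rden c) x (2 * (x + c)).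
Proof.
apply: derive_at_cast; last first.
  apply: derive_at_addf; last exact: derive_at_cstf.
  apply: derive_at_addf.
    by apply: derive_at_mulf; exact: derive_at_idf.
  by apply: derive_at_mulf; [exact: derive_at_cstf|exact: derive_at_idf].
by rewrite /=; ring.
Qed.

Lemma derive_at_rden_param x th : derive_at (fun th => rden (cos th) x) th
  (- (2 * x * sin th)).
Proof.
apply: derive_at_cast; last first.
  apply: derive_at_addf; last exact: derive_at_cstf.
  apply: derive_at_addf; first exact: derive_at_cstf.
  apply: derive_at_mulf; last exact: derive_at_cstf.
  by apply: derive_at_mulf; [exact: derive_at_cstf|exact: is_derive_cos].
by rewrite /=; ring.
Qed.

Let npow_div_le p q r x : 0 < x -> 0 < q -> 0 <= r -> `|p| * (1 + x) <= r * q ->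
  `|npow nu x * (p / q)| <= r * base nu x.
Proof.
move=> x0 q0 r0 pq; rewrite normrM (ger0_norm (powR_ge0 _ _)) normf_div (gtr0_norm q0).
rewrite /base /npow [leRHS]mulrCA ler_wpM2l ?powR_ge0// ler_pdivrMr// mulrAC.
by rewrite ler_pdivlMr//; lra.
Qed.

Lemma rker_le c x : - (3 / 4) <= c <= 1 -> 0 < x -> `|rker c x| <= 8 * base nu x.
Proof.
move=> /andP[c1 c2] x0; apply: npow_div_le => //; first exact: rden_gt0.
apply: le_trans (rden_ge c1 x0); rewrite expr2 ler_wpM2r//; first lra.
by rewrite ler_norml; lra.
Qed.

Lemma iker_le c sg x : - (3 / 4) <= c -> `|sg| <= 1 -> 0 < x ->
  `|iker c sg x| <= 8 * base nu x.
Proof.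
move=> c1 s1 x0; apply: npow_div_le => //; first exact: rden_gt0.
apply: le_trans (rden_ge c1 x0); rewrite expr2 ler_wpM2r//; first lra.
by lra.
Qed.

Lemma base_le x : 0 < x -> base nu x <= x `^ (- nu).
Proof.
move=> x0; rewrite /base ler_piMr ?powR_ge0// invf_le1; lra.
Qed.

Lemma continuous_rker c x : - (3 / 4) <= c -> 0 < x -> {for x, continuous (rker c)}.
Proof.
move=> c1 x0; apply: continuousM; first exact: continuous_npow.
apply: (@derive_at_continuous _ _ _ (1 * (rden c x)^-1 + (x + c) * (- (2 * (x + c)) / (rden c x) ^+ 2))).
apply: derive_at_mulf; last first.
  by apply: derive_at_invf; [rewrite gt_eqF// rden_gt0|exact: derive_at_rden].
apply: derive_at_cast; last by apply: derive_at_addf; [exact: derive_at_idf|exact: derive_at_cstf].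
by rewrite addr0.
Qed.

Lemma continuous_iker c sg x : - (3 / 4) <= c -> 0 < x ->
  {for x, continuous (iker c sg)}.
Proof.
move=> c1 x0; apply: continuousM; first exact: continuous_npow.
apply: continuousM; first exact: cvg_cst.
apply: (@derive_at_continuous _ _ _ (- (2 * (x + c)) / (rden c x) ^+ 2)).
by apply: derive_at_invf; [rewrite gt_eqF// rden_gt0|exact: derive_at_rden].
Qed.

Let rker_npow_le c x : - (3 / 4) <= c <= 1 -> 0 < x -> `|rker c x| <= 8 * x `^ (- nu).
Proof.
by move=> c1 x0; apply: le_trans (rker_le c1 x0) _; rewrite ler_wpM2l// base_le.
Qed.

Let iker_npow_le c sg x : - (3 / 4) <= c -> `|sg| <= 1 -> 0 < x ->
  `|iker c sg x| <= 8 * x `^ (- nu).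
Proof.
by move=> c1 s1 x0; apply: le_trans (iker_le c1 s1 x0) _; rewrite ler_wpM2l// base_le.
Qed.

Lemma continuous_laplace_rker c : - (3 / 4) <= c <= 1 ->
  continuous (fun s => laplace (rker c) `|s|).
Proof.
move=> c1; apply: (continuous_laplace nu01 (C := 8)) => // x x0; last exact: rker_le.
by apply: continuous_rker => //; case/andP: c1.
Qed.

Lemma continuous_laplace_iker c sg : - (3 / 4) <= c -> `|sg| <= 1 ->
  continuous (fun s => laplace (iker c sg) `|s|).
Proof.
move=> c1 s1; apply: (continuous_laplace nu01 (C := 8)) => // x x0; last exact: iker_le.
exact: continuous_iker.
Qed.

Lemma integrable_laplace_rker c s : - (3 / 4) <= c <= 1 -> 0 <= s ->
  mu.-integrable (`]0, +oo[ : set R) (EFin \o (fun x => rker c x * expR (- (x * s)))).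
Proof.
move=> c1 s0; apply: (integrable_laplace0 nu01 (C := 8)) => // x x0; last exact: rker_le.
by apply: continuous_rker => //; case/andP: c1.
Qed.

Lemma integrable_laplace_iker c sg s : - (3 / 4) <= c -> `|sg| <= 1 -> 0 <= s ->
  mu.-integrable (`]0, +oo[ : set R) (EFin \o (fun x => iker c sg x * expR (- (x * s)))).
Proof.
move=> c1 s1 s0; apply: (integrable_laplace0 nu01 (C := 8)) => // x x0; last exact: iker_le.
exact: continuous_iker.
Qed.

(** Differentiation multiplies the kernel by [- x], and [x / (x + z) = 1 - z / (x + z)] with
    [z = c - i sg] brings back the same kernels. This is the real part; the 1 yields the transform
    of [npow]. *)
Lemma derive_at_laplace_rker c sg s : - (3 / 4) <= c <= 1 -> `|sg| <= 1 ->
  c ^+ 2 + sg ^+ 2 = 1 -> 0 < s ->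
  derive_at (laplace (rker c)) s (c * laplace (rker c) s + sg * laplace (iker c sg) s
    - Gamma (1 - nu) * s `^ (nu - 1)).
Proof.
move=> c1 s1 cs s0; have [c11 c12] := andP c1.
apply: derive_at_cast; last first.
  apply: (derive_at_laplace nu01 (C := 8)) => // x x0; first exact: continuous_rker.
  exact: rker_npow_le.
rewrite -laplace_npow//.
have intr := integrable_laplace_rker c1 (ltW s0).
have inti := integrable_laplace_iker c11 s1 (ltW s0).
have intn : mu.-integrable (`]0, +oo[ : set R) (EFin \o (fun x => npow nu x * expR (- (x * s)))).
  by apply: (integrable_laplace (C := 1) nu01) => // x; [exact: continuous_npow|exact: npow_le].
have ints := integrable_addf (integrable_mulf c intr) (integrable_mulf sg inti).
suff H : laplace (fun x => x * rker c x) s = 1 * laplace (npow nu) s +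
    (- 1) * (c * laplace (rker c) s + sg * laplace (iker c sg) s) by rewrite H; ring.
rewrite -(Rintegral_lin c sg intr inti) -(Rintegral_lin 1 (- 1) intn ints).
apply: eq_Rintegral0y => x x0; rewrite [RHS](_ : _ =
  (npow nu x - (c * rker c x + sg * iker c sg x)) * expR (- (x * s))); last first.
  by rewrite /=; ring.
congr (_ * _); rewrite /rker /iker.
have d0 : rden c x != 0 by rewrite gt_eqF// rden_gt0.
rewrite [LHS](_ : _ = npow nu x * (rden c x - (c * (x + c) + sg ^+ 2)) / rden c x).
  by field.
by rewrite (_ : sg ^+ 2 = 1 - c ^+ 2) ?/rden; [field|lra].
Qed.

(** The imaginary part of the same identity, to which the real number 1 contributes nothing. *)
Lemma derive_at_laplace_iker c sg s : - (3 / 4) <= c <= 1 -> `|sg| <= 1 ->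
  0 < s ->
  derive_at (laplace (iker c sg)) s (c * laplace (iker c sg) s - sg * laplace (rker c) s).
Proof.
move=> c1 s1 s0; have [c11 c12] := andP c1.
apply: derive_at_cast; last first.
  apply: (derive_at_laplace nu01 (C := 8)) => // x x0; first exact: continuous_iker.
  exact: iker_npow_le.
have intr := integrable_laplace_rker c1 (ltW s0).
have inti := integrable_laplace_iker c11 s1 (ltW s0).
suff H : laplace (fun x => x * iker c sg x) s =
    sg * laplace (rker c) s + (- c) * laplace (iker c sg) s by rewrite H; ring.
rewrite -(Rintegral_lin sg (- c) intr inti).
apply: eq_Rintegral0y => x x0; rewrite !mulrA -!mulrDl; congr (_ * _); rewrite /rker /iker.
have d0 : rden c x != 0 by rewrite gt_eqF// rden_gt0.
by field.
Qed.

End resolvent_kernel.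

(** * Dependence on the angle of the pole *)

Section resolvent_angle.
Context {R : realType}.
Notation mu := (@lebesgue_measure R).
Variables (nu : R) (nu01 : 0 < nu < 1).
Implicit Types c sg x s th : R.

(** Needed because the boundary term [x ^ (1 - nu) (x + c) / rden c x] decays only like
    [x ^ (- nu)], too slowly for a bound by [C / x]. *)
Lemma cvgy_powRN_bound (F : R -> R) C a : 0 < a ->
  (forall x, 1 < x -> `|F x| <= C * x `^ (- a)) -> F x @[x --> +oo] --> (0 : R).
Proof.
move=> a0 FC; apply: norm_cvg0.
apply: (@squeeze_cvgr _ _ _ _ (fun=> 0) (fun x => C * x `^ (- a))).
- near=> x; rewrite normr_ge0/= FC//.
- exact: cvg_cst.
- rewrite -[X in _ --> X](mulr0 C); apply: cvgMr.
  apply/cvgrPdist_le => e e0; near=> x.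
  have ea : 0 < e `^ (- a^-1) by exact: powR_gt0.
  have xe : e `^ (- a^-1) < x by near: x; apply: nbhs_pinfty_gt; rewrite num_real.
  rewrite sub0r normrN ger0_norm ?powR_ge0//.
  have -> : e = (e `^ (- a^-1)) `^ (- a).
    by rewrite -powRrM mulrNN mulVf ?gt_eqF// powRr1// ltW.
  have x0 : 0 < x := lt_trans ea xe.
  set y := e `^ _ in ea xe *; rewrite (powRN x) (powRN y).
  rewrite lef_pV2 ?posrE ?powR_gt0//.
  by apply: ge0_ler_powR; rewrite ?nnegrE ?ltW.
Unshelve. all: by end_near. Qed.

(** With the next definition, the real and imaginary parts of [x ^ (- nu)] times
    [i z / (x + z) ^ 2], which is the derivative of [1 / (x + z)] in the angle when
    [z = exp (- i th)]. *)
Let drker c sg x := npow nu x * (sg * (x ^+ 2 - 1) / rden c x ^+ 2).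
Let diker c x := npow nu x * ((c * x ^+ 2 + 2 * x + c) / rden c x ^+ 2).

Let sum_sq_le1 c sg : c ^+ 2 + sg ^+ 2 = 1 -> `|sg| <= 1 /\ c <= 1.
Proof.
move=> cs; split; first by rewrite ler_norml; nra.
by nra.
Qed.

(** [32 = 4 * 8]: [rden_ge4] controls the numerator and [rden_ge] the factor [1 + x]. In [diker_le]
    both are controlled by [rden_ge], whence [64 = 8 * 8]. *)
Let drker_le c sg x : - (3 / 4) <= c -> `|sg| <= 1 -> 0 < x ->
  `|drker c sg x| <= 32 * base nu x.
Proof.
move=> c1 s1 x0; have d0 := rden_gt0 c1 x0.
rewrite normrM (ger0_norm (powR_ge0 _ _)) /base /npow [leRHS]mulrCA ler_wpM2l ?powR_ge0//.
rewrite normf_div (gtr0_norm (exprn_gt0 2 d0)) ler_pdivrMr ?exprn_gt0// mulrAC.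
rewrite ler_pdivlMr; last lra.
have h1 : `|sg * (x ^+ 2 - 1)| <= 4 * rden c x.
  rewrite normrM; apply: le_trans (rden_ge4 c1 x0).
  apply: (@le_trans _ _ (1 * `|x ^+ 2 - 1|)); first by rewrite ler_wpM2r.
  by rewrite mul1r ler_norml; have := sqr_ge0 x; lra.
have h2 : 1 + x <= 8 * rden c x.
  by apply: le_trans (rden_ge c1 x0); nra.
apply: le_trans (ler_pM (normr_ge0 _) _ h1 h2) _; first lra.
by rewrite expr2; nra.
Qed.

Let diker_le c x : - (3 / 4) <= c <= 1 -> 0 < x -> `|diker c x| <= 64 * base nu x.
Proof.
move=> /andP[c1 c2] x0; have d0 := rden_gt0 c1 x0.
rewrite normrM (ger0_norm (powR_ge0 _ _)) /base /npow [leRHS]mulrCA ler_wpM2l ?powR_ge0//.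
rewrite normf_div (gtr0_norm (exprn_gt0 2 d0)) ler_pdivrMr ?exprn_gt0// mulrAC.
rewrite ler_pdivlMr; last lra.
have h1 : `|c * x ^+ 2 + 2 * x + c| <= 8 * rden c x.
  apply: le_trans (rden_ge c1 x0).
  by rewrite ler_norml; nra.
have h2 : 1 + x <= 8 * rden c x.
  by apply: le_trans (rden_ge c1 x0); nra.
apply: le_trans (ler_pM (normr_ge0 _) _ h1 h2) _; first lra.
by rewrite expr2; nra.
Qed.

(** [z / (x + z) ^ 2] is the derivative of [x / (x + z)] in [x]. Hence the derivative in the angle
    is, up to [i] and a multiple of the kernel, a derivative in [x]; integrating over []0, +oo[]
    turns differentiation in the angle into multiplication by [i nu]. *)
Let derive_rker_x c sg x : - (3 / 4) <= c -> c ^+ 2 + sg ^+ 2 = 1 -> 0 < x ->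
  derive_at (fun x => x `^ (1 - nu) * ((x + c) / rden c x)) x
    (diker c x - nu * rker nu c x).
Proof.
move=> c1 cs x0; have d0 : rden c x != 0 by rewrite gt_eqF// rden_gt0.
apply: derive_at_cast; last first.
  apply: derive_at_mulf; first exact: is_derive1_powR.
  apply: derive_at_mulf.
    by apply: derive_at_addf; [exact: derive_at_idf|exact: derive_at_cstf].
  by apply: derive_at_invf; [exact: d0|exact: derive_at_rden].
rewrite /= -mul_npow// (_ : 1 - nu - 1 = - nu); last by ring.
rewrite -/(npow nu x) /diker /rker.
by rewrite /rden in d0 *; field.
Qed.

Let derive_iker_x c sg x : - (3 / 4) <= c -> c ^+ 2 + sg ^+ 2 = 1 -> 0 < x ->
  derive_at (fun x => x `^ (1 - nu) * (sg / rden c x)) x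
    (- drker c sg x - nu * iker nu c sg x).
Proof.
move=> c1 cs x0; have d0 : rden c x != 0 by rewrite gt_eqF// rden_gt0.
apply: derive_at_cast; last first.
  apply: derive_at_mulf; first exact: is_derive1_powR.
  apply: derive_at_mulf; first exact: derive_at_cstf.
  by apply: derive_at_invf; [exact: d0|exact: derive_at_rden].
rewrite /= -mul_npow// (_ : 1 - nu - 1 = - nu); last by ring.
rewrite -/(npow nu x) /drker /iker.
by rewrite /rden in d0 *; field.
Qed.

Let integrable_base0 (f : R -> R) C : (forall x, 0 < x -> {for x, continuous f}) ->
  (forall x, 0 < x -> `|f x| <= C * base nu x) ->
  mu.-integrable (`]0, +oo[ : set R) (EFin \o f).
Proof.
move=> cf fC; apply: (integrable_dominated (c := C) _ _ (integrable_base nu01)).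
  exact: measurable_continuous_itvoy.
by move=> x; rewrite /= in_itv/= andbT; exact: fC.
Qed.

Let continuous_drker c sg x : - (3 / 4) <= c -> 0 < x -> {for x, continuous (drker c sg)}.
Proof.
move=> c1 x0; have d0 : rden c x != 0 by rewrite gt_eqF// rden_gt0.
apply: continuousM; first exact: continuous_npow.
apply: continuousM.
  apply: continuousM; first exact: cvg_cst.
  by apply: continuousB; [exact: exprn_continuous|exact: cvg_cst].
apply: continuousV; first by rewrite expf_neq0.
have cr := derive_at_continuous (derive_at_rden c x).
exact: (continuousM cr cr).
Qed.

Let continuous_diker c x : - (3 / 4) <= c -> 0 < x -> {for x, continuous (diker c)}.
Proof.
move=> c1 x0; have d0 : rden c x != 0 by rewrite gt_eqF// rden_gt0.
apply: continuousM; first exact: continuous_npow.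
apply: continuousM.
  apply: continuousD; last exact: cvg_cst.
  apply: continuousD.
    by apply: continuousM; [exact: cvg_cst|exact: exprn_continuous].
  by apply: continuousM; [exact: cvg_cst|exact: cvg_id].
apply: continuousV; first by rewrite expf_neq0.
have cr := derive_at_continuous (derive_at_rden c x).
exact: (continuousM cr cr).
Qed.

Let integral_drker c sg : - (3 / 4) <= c -> c ^+ 2 + sg ^+ 2 = 1 ->
  \int[mu]_(x in `]0, +oo[) drker c sg x = - nu * \int[mu]_(x in `]0, +oo[) iker nu c sg x.
Proof.
move=> c1 cs; have [s1 c2] := sum_sq_le1 cs; have [nu0 nu1] := andP nu01.
have intd : mu.-integrable (`]0, +oo[ : set R) (EFin \o drker c sg).
  by apply: (@integrable_base0 _ 32) => x x0; [exact: continuous_drker|exact: drker_le].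
have inti : mu.-integrable (`]0, +oo[ : set R) (EFin \o iker nu c sg).
  by apply: (@integrable_base0 _ 8) => x x0; [exact: continuous_iker|exact: iker_le].
have := Rintegral_lin (- 1) (- nu) intd inti.
rewrite (@improper_FTC _ _ _ (fun x => x `^ (1 - nu) * (sg / rden c x)) 0 0); first by lra.
- by apply: integrable_addf; apply: integrable_mulf.
- move=> x x0; apply: derive_at_cast (derive_iker_x c1 cs x0).
  by ring.
- move=> x x0; apply: continuousD.
    by apply: continuousM; [exact: cvg_cst|exact: continuous_drker].
  by apply: continuousM; [exact: cvg_cst|exact: continuous_iker].
- apply: (@cvg0_powR_bound _ _ 4 (1 - nu)); first lra.
  move=> x /andP[x0 _]; have d0 := rden_gt0 c1 x0.
  rewrite normrM ger0_norm ?powR_ge0// mulrC ler_wpM2r ?powR_ge0//.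
  rewrite normf_div (gtr0_norm d0) ler_pdivrMr//.
  by have := rden_ge4 c1 x0; have := sqr_ge0 x; lra.
- apply: (@cvgy_inv_bound _ _ 4) => x x1; have x0 : 0 < x by lra.
  have d0 := rden_gt0 c1 x0.
  rewrite normrM ger0_norm ?powR_ge0// -mul_npow// normf_div (gtr0_norm d0).
  have n1 : npow nu x <= 1.
    by rewrite /npow -(powRr0 x) ler_powR; lra.
  have n0 : 0 <= npow nu x by exact: powR_ge0.
  rewrite mulrA ler_pdivrMr// [leRHS]mulrAC ler_pdivlMr//.
  apply: (@le_trans _ _ (x * x)).
    rewrite ler_wpM2r ?(ltW x0)// -[leRHS]mulr1 -mulrA ler_wpM2l ?(ltW x0)//.
    by rewrite -[leRHS]mulr1 ler_pM.
  by have := rden_ge4 c1 x0; rewrite expr2; lra.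
Qed.

Let integral_diker c sg : - (3 / 4) <= c -> c ^+ 2 + sg ^+ 2 = 1 ->
  \int[mu]_(x in `]0, +oo[) diker c x = nu * \int[mu]_(x in `]0, +oo[) rker nu c x.
Proof.
move=> c1 cs; have [s1 c2] := sum_sq_le1 cs; have [nu0 nu1] := andP nu01.
have c12 : - (3 / 4) <= c <= 1 by rewrite c1.
have intd : mu.-integrable (`]0, +oo[ : set R) (EFin \o diker c).
  by apply: (@integrable_base0 _ 64) => x x0; [exact: continuous_diker|exact: diker_le].
have inti : mu.-integrable (`]0, +oo[ : set R) (EFin \o rker nu c).
  by apply: (@integrable_base0 _ 8) => x x0; [exact: continuous_rker|exact: rker_le].
have := Rintegral_lin 1 (- nu) intd inti.
rewrite (@improper_FTC _ _ _ (fun x => x `^ (1 - nu) * ((x + c) / rden c x)) 0 0); first by lra.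
- by apply: integrable_addf; apply: integrable_mulf.
- move=> x x0; apply: derive_at_cast (derive_rker_x c1 cs x0).
  by ring.
- move=> x x0; apply: continuousD.
    by apply: continuousM; [exact: cvg_cst|exact: continuous_diker].
  by apply: continuousM; [exact: cvg_cst|exact: continuous_rker].
- apply: (@cvg0_powR_bound _ _ 8 (1 - nu)); first lra.
  move=> x /andP[x0 x1]; have d0 := rden_gt0 c1 x0.
  rewrite normrM ger0_norm ?powR_ge0// mulrC ler_wpM2r ?powR_ge0//.
  rewrite normf_div (gtr0_norm d0) ler_pdivrMr//.
  by apply: le_trans (rden_ge c1 x0); rewrite ler_norml; nra.
- apply: (@cvgy_powRN_bound _ 8 nu) => // x x1; have x0 : 0 < x by lra.
  have d0 := rden_gt0 c1 x0.
  rewrite normrM ger0_norm ?powR_ge0// -mul_npow// normf_div (gtr0_norm d0).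
  rewrite (mulrC x) -mulrA mulrC ler_wpM2r ?powR_ge0//.
  rewrite mulrA ler_pdivrMr//.
  apply: le_trans (rden_ge c1 x0).
  have : `|x + c| <= 1 + x by rewrite ler_norml; lra.
  by have := normr_ge0 (x + c); nra.
Qed.

(** [- (3 / 4)] is a rational number below [cos (3 pi / 4)], whose square is [1 / 2]. *)
Lemma cos_ge_three_quarters th : - (pi / 4) < th < 3 * pi / 4 -> - (3 / 4) <= cos th.
Proof.
move=> /andP[t1 t2]; have pi0 := pi_gt0 R.
have [t3|t3] := ltP th (pi / 2).
  have : 0 < cos th by apply: cos_gt0_pihalf; apply/andP; split; lra.
  by lra.
have q : cos (pi / 4) ^+ 2 = 1 / 2 :> R.
  have := cosD (pi / 4) (pi / 4 : R).
  rewrite (_ : pi / 4 + pi / 4 = pi / 2); last by field.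
  have := cos2Dsin2 (pi / 4 : R); rewrite cos_pihalf !expr2; lra.
have c0 : 0 < cos (pi / 4 : R) by apply: cos_gt0_pihalf; apply/andP; split; lra.
have e : cos (3 * pi / 4) = - cos (pi / 4) :> R.
  rewrite (_ : 3 * pi / 4 = - (pi / 4) + pi); last by field.
  by rewrite cosDpi cosN.
have : cos (3 * pi / 4) < cos th.
  by rewrite ltr_cos// in_itv/=; apply/andP; split; lra.
rewrite e; nra.
Qed.

Let A th := \int[mu]_(x in `]0, +oo[) rker nu (cos th) x.
Let B th := \int[mu]_(x in `]0, +oo[) iker nu (cos th) (sin th) x.

Let integrable_A th : - (pi / 4) < th < 3 * pi / 4 ->
  mu.-integrable (`]0, +oo[ : set R) (EFin \o rker nu (cos th)).
Proof.
move=> /cos_ge_three_quarters c1; have [_ c2] := sum_sq_le1 (cos2Dsin2 th).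
by apply: (@integrable_base0 _ 8) => x x0; [exact: continuous_rker|apply: rker_le; rewrite ?c1].
Qed.

Let integrable_B th : - (pi / 4) < th < 3 * pi / 4 ->
  mu.-integrable (`]0, +oo[ : set R) (EFin \o iker nu (cos th) (sin th)).
Proof.
move=> /cos_ge_three_quarters c1; have [s1 _] := sum_sq_le1 (cos2Dsin2 th).
by apply: (@integrable_base0 _ 8) => x x0; [exact: continuous_iker|exact: iker_le].
Qed.

Let derive_at_A th : - (pi / 4) < th < 3 * pi / 4 -> derive_at A th (- nu * B th).
Proof.
move=> tI; have c1 := cos_ge_three_quarters tI.
rewrite -(integral_drker c1 (cos2Dsin2 th)).
apply: (@derive_at_under _ (fun th x => rker nu (cos th) x)
  (fun th x => drker (cos th) (sin th) x) (fun x => 32 * base nu x) (- (pi / 4)) (3 * pi / 4)) => //.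
- move=> t x tI' x0; have c1' := cos_ge_three_quarters tI'.
  have d0 : rden (cos t) x != 0 by rewrite gt_eqF// rden_gt0.
  apply: derive_at_cast; last first.
    apply: derive_at_mulf; first exact: derive_at_cstf.
    apply: derive_at_mulf.
      by apply: derive_at_addf; [exact: derive_at_cstf|exact: is_derive_cos].
    by apply: derive_at_invf; [exact: d0|exact: derive_at_rden_param].
  rewrite /= /drker; move: d0; rewrite /rden => d0; by field.
- by apply: integrable_mulf; exact: integrable_base.
- move=> t x tI' x0; have c1' := cos_ge_three_quarters tI'.
  by apply: drker_le => //; have [] := sum_sq_le1 (cos2Dsin2 t).
Qed.

Let derive_at_B th : - (pi / 4) < th < 3 * pi / 4 -> derive_at B th (nu * A th).
Proof.
move=> tI; have c1 := cos_ge_three_quarters tI.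
rewrite -(integral_diker c1 (cos2Dsin2 th)).
apply: (@derive_at_under _ (fun th x => iker nu (cos th) (sin th) x)
  (fun th x => diker (cos th) x) (fun x => 64 * base nu x) (- (pi / 4)) (3 * pi / 4)) => //.
- move=> t x tI' x0; have c1' := cos_ge_three_quarters tI'.
  have d0 : rden (cos t) x != 0 by rewrite gt_eqF// rden_gt0.
  apply: derive_at_cast; last first.
    apply: derive_at_mulf; first exact: derive_at_cstf.
    apply: derive_at_mulf; first exact: is_derive_sin.
    by apply: derive_at_invf; [exact: d0|exact: derive_at_rden_param].
  rewrite /= /diker mul0r add0r; congr (_ * _).
  rewrite [LHS](_ : _ = (cos t * rden (cos t) x + 2 * x * sin t ^+ 2) / rden (cos t) x ^+ 2); last by field.
  have := cos2Dsin2 t => cs; congr (_ / _).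
  by rewrite (_ : sin t ^+ 2 = 1 - cos t ^+ 2) ?/rden; [ring|lra].
- by apply: integrable_mulf; exact: integrable_base.
- move=> t x tI' x0; have c1' := cos_ge_three_quarters tI'.
  by apply: diker_le => //; have [_ ->] := sum_sq_le1 (cos2Dsin2 t); rewrite c1'.
Qed.

(* [A + i B] solves [w' = i nu w], so it is [A 0] times [exp (i nu th)]. *)
Let AB_pihalf : A (pi / 2) = A 0 * cos (nu * (pi / 2)) /\
  B (pi / 2) = A 0 * sin (nu * (pi / 2)).
Proof.
have pi0 := pi_gt0 R.
have dn (f g : R -> R) th : derive_at f (nu * th) (g (nu * th)) ->
    derive_at (fun th => f (nu * th)) th (g (nu * th) * nu).
  move=> df; apply: derive_at_compf => //; apply: derive_at_cast; last first.
    by apply: derive_at_mulf; [exact: derive_at_cstf|exact: derive_at_idf].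
  by rewrite /=; ring.
have tI x : 0 <= x <= pi / 2 -> - (pi / 4) < x < 3 * pi / 4.
  by move=> /andP[x1 x2]; apply/andP; split; lra.
(* [X] and [Y] state that the real and imaginary parts of [(A + i B) exp (- i nu th)] agree at 0 and
   [pi / 2]: both have zero derivative. *)
have X : A 0 * cos (nu * 0) + B 0 * sin (nu * 0) =
    A (pi / 2) * cos (nu * (pi / 2)) + B (pi / 2) * sin (nu * (pi / 2)).
  apply: (@zero_derive_eq _ (fun th => A th * cos (nu * th) + B th * sin (nu * th))).
    by lra.
  move=> x /tI xI; apply: derive_at_cast; last first.
    apply: derive_at_addf; apply: derive_at_mulf.
    - exact: derive_at_A.
    - by apply: (dn cos (fun t => - sin t)); exact: is_derive_cos.
    - exact: derive_at_B.
    - by apply: (dn sin cos); exact: is_derive_sin.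
  by rewrite /=; ring.
have Y : B 0 * cos (nu * 0) - A 0 * sin (nu * 0) =
    B (pi / 2) * cos (nu * (pi / 2)) - A (pi / 2) * sin (nu * (pi / 2)).
  apply: (@zero_derive_eq _ (fun th => B th * cos (nu * th) - A th * sin (nu * th))).
    by lra.
  move=> x /tI xI; apply: derive_at_cast; last first.
    apply: derive_at_subf; apply: derive_at_mulf.
    - exact: derive_at_B.
    - by apply: (dn cos (fun t => - sin t)); exact: is_derive_cos.
    - exact: derive_at_A.
    - by apply: (dn sin cos); exact: is_derive_sin.
  by rewrite /=; ring.
have B0 : B 0 = 0.
  rewrite /B; transitivity (\int[mu]_(x in `]0, +oo[) (0 : R)).
    by apply: eq_Rintegral0y => x _; rewrite /iker sin0 mul0r mulr0.
  rewrite /Rintegral integral0_eq//.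
move: X Y; rewrite !mulr0 cos0 sin0 !mulr0 !mulr1 B0 addr0 subr0.
have := cos2Dsin2 (nu * (pi / 2)); rewrite !expr2.
set C := cos _; set S := sin _; set a := A (pi / 2); set b := B (pi / 2).
move=> cs -> Y; have {}Y : b * C = a * S by lra.
split; apply/esym.
  transitivity (a * (C * C) + b * C * S); first by ring.
  by rewrite Y -mulrA -mulrDr cs mulr1.
transitivity (a * S * C + b * (S * S)); first by ring.
by rewrite -Y -mulrA -mulrDr cs mulr1.
Qed.

(** For [z = 1] the transform [L] of the kernel solves [L' = L - Gamma (1 - nu) s ^ (nu - 1)].
    Multiplying by [exp (- s)] and integrating over []0, +oo[] gives the product of the two Gamma
    values without a double integral. *)
Let A0E : A 0 = Gamma nu * Gamma (1 - nu).
Proof.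
have [nu0 nu1] := andP nu01.
have c1 : - (3 / 4) <= (1 : R) <= 1 by apply/andP; split; lra.
have s1 : `|0 : R| <= 1 by rewrite normr0.
pose F (s : R) := expR (- s) * laplace (rker nu 1) `|s|.
have mu01 : 0 < 1 - nu < 1 by apply/andP; split; lra.
have intn : mu.-integrable (`]0, +oo[ : set R)
    (EFin \o (fun x => npow (1 - nu) x * expR (- (x * 1)))).
  apply: (integrable_laplace (C := 1) mu01) => // x; [exact: continuous_npow|].
  exact: npow_le.
have J : \int[mu]_(s in `]0, +oo[) (- Gamma (1 - nu) * (npow (1 - nu) s * expR (- (s * 1)))) =
    0 - F 0.
  apply: (improper_FTC (F := F)).
  - exact: integrable_mulf.
  - move=> s s0; apply: (@derive_at_near _ (fun s => expR (- s) * laplace (rker nu 1) s)).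
      by near=> t; rewrite /F /= gtr0_norm//; near: t; exact: lt_nbhsr.
    apply: derive_at_cast; last first.
      apply: derive_at_mulf.
        by apply: derive_at_expf; apply: derive_at_oppf; exact: derive_at_idf.
      by apply: (derive_at_laplace_rker (sg := 0) nu01 c1 s1) => //; ring.
    rewrite /= mulr1 /npow opprB; ring.
  - move=> s s0; apply: continuousM; first exact: cvg_cst.
    by apply: continuous_kernel; exact: continuous_npow.
  - apply: cvg_at_right_filter.
    have ce : {for (0 : R), continuous (fun s : R => expR (- s))}.
      apply: (@derive_at_continuous _ _ _ (expR (- 0) * - 1)).
      by apply: derive_at_expf; apply: derive_at_oppf; exact: derive_at_idf.
    have cl : {for (0 : R), continuous (fun s => laplace (rker nu 1) `|s|)}.
      exact: continuous_laplace_rker.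
    exact: (continuousM ce cl).
  - apply: (@cvgy_inv_bound _ _ (laplace (rker nu 1) 0)) => s s1'.
    rewrite /F normrM (ger0_norm (expR_ge0 _)) mulrC (gtr0_norm (lt_trans ltr01 s1')).
    apply: ler_pM => //.
      rewrite ger0_norm; last first.
        apply: Rintegral_ge0 => x; rewrite /= in_itv/= andbT => x0.
        rewrite mulr_ge0 ?expR_ge0// mulr_ge0 ?powR_ge0// divr_ge0 ?ltW ?rden_gt0//; lra.
      apply: le_Rintegral0y; try by apply: integrable_laplace_rker => //; lra.
      move=> x x0; rewrite ler_wpM2l//.
        by rewrite mulr_ge0 ?powR_ge0// divr_ge0 ?ltW ?rden_gt0//; lra.
      by rewrite ler_expR mulr0 oppr0 oppr_le0 mulr_ge0; lra.
    rewrite expRN lef_pV2 ?posrE ?expR_gt0//; last lra.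
    by have := expR_ge1Dx s; lra.
have : F 0 = A 0.
  rewrite /F oppr0 expR0 mul1r normr0 /A cos0.
  by apply: eq_Rintegral0y => x _; rewrite mulr0 oppr0 expR0 mulr1.
move: J; rewrite sub0r (@RintegralZl _ _ _ mu)// -/(laplace _ _) laplace_npow1//.
by rewrite mulNr => /oppr_inj <- <-; rewrite mulrC (_ : 1 - (1 - nu) = nu)//; ring.
Unshelve. all: by end_near. Qed.

Lemma laplace_rker0 : laplace (rker nu 0) 0 =
  Gamma nu * Gamma (1 - nu) * cos (nu * (pi / 2)).
Proof.
rewrite -A0E -AB_pihalf.1 /A cos_pihalf.
by apply: eq_Rintegral0y => x _; rewrite mulr0 oppr0 expR0 mulr1.
Qed.

Lemma laplace_iker0 : laplace (iker nu 0 1) 0 =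
  Gamma nu * Gamma (1 - nu) * sin (nu * (pi / 2)).
Proof.
rewrite -A0E -AB_pihalf.2 /B cos_pihalf sin_pihalf.
by apply: eq_Rintegral0y => x _; rewrite mulr0 oppr0 expR0 mulr1.
Qed.

Lemma Gamma_reflection : laplace (rker nu 1) 0 = Gamma nu * Gamma (1 - nu).
Proof.
rewrite -A0E /A cos0.
by apply: eq_Rintegral0y => x _; rewrite mulr0 oppr0 expR0 mulr1.
Qed.

End resolvent_angle.

(** By reflection the square of [Gamma (1 / 2)] is the integral of [x ^ (- 1 / 2) / (1 + x)], which
    has the primitive [2 atan (sqrt x)] and so equals [pi]. *)
Lemma Gamma_half {R : realType} : Gamma (1 / 2) = Num.sqrt pi :> R.
Proof.
pose F (x : R) := 2 * atan (x `^ (1 / 2)).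
have h01 : (0 : R) < 1 / 2 < (1 : R) by lra.
have hE : 1 - 1 / 2 = 1 / 2 :> R by lra.
have E := Gamma_reflection h01; rewrite hE in E.
have c1 : - (3 / 4) <= (1 : R) <= 1 by apply/andP; split; lra.
have : laplace (rker (1 / 2) 1) 0 = pi - 0 :> R.
  apply: (improper_FTC (F := F)).
  - exact: integrable_laplace_rker.
  - move=> x x0; have x1 : 1 + x != 0 by rewrite gt_eqF//; lra.
    have sx : (x `^ (1 / 2)) ^+ 2 = x by rewrite expr2 -powRDx// (_ : 1 / 2 + 1 / 2 = 1) ?powRr1 ?ltW//; lra.
    apply: derive_at_cast; last first.
      apply: derive_at_mulf; first exact: derive_at_cstf.
      by apply: derive_at_compf; [exact: is_derive1_atan|exact: is_derive1_powR].
    rewrite /= mulr0 oppr0 expR0 mulr1 sx mul0r add0r /rker /npow.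
    rewrite (_ : 1 / 2 - 1 = - (1 / 2)); last by lra.
    by rewrite /rden (_ : x ^+ 2 + 2 * 1 * x + 1 = (1 + x) ^+ 2); [field|ring].
  - move=> x x0; apply: continuous_kernel; apply: continuous_rker => //; lra.
  - rewrite [X in _ --> X](_ : 0 = 2 * atan (0 : R)); last by rewrite atan0 mulr0.
    apply: cvgMr; apply: (@cvg_comp _ _ _ _ atan); first by apply: powR_cvg0; lra.
    exact: continuous_atan.
  - rewrite [X in _ --> X](_ : pi = 2 * (pi / 2)); last by field.
    apply: cvgMr; apply: (cvg_comp _ _ _ (@cvgy_atan R)).
    apply/cvgryPge => M; near=> x.
    have M0 : 0 <= Num.max 0 M by rewrite le_max lexx.
    have xM : Num.max 0 M ^+ 2 <= x by near: x; apply: nbhs_pinfty_ge; rewrite num_real.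
    apply: (@le_trans _ _ (Num.max 0 M)); first by rewrite le_max lexx orbT.
    rewrite [leLHS](_ : _ = (Num.max 0 M ^+ 2) `^ (1 / 2)); last first.
      by rewrite -powR_mulrn// -powRrM (_ : 2%:R * (1 / 2) = 1) ?powRr1//; lra.
    by rewrite ge0_ler_powR ?nnegrE ?exprn_ge0//.
rewrite E subr0 -expr2 => <-; rewrite sqrtr_sqr ger0_norm//.
by rewrite -hE ltW// Gamma_gt0.
Unshelve. all: by end_near. Qed.

(** * Complex-valued functions of a real variable *)

Section within_calculus.
Context {R : realType}.
Implicit Types (A : set R) (f g : R -> R).

Lemma within_addf A f g : {within A, continuous f} -> {within A, continuous g} ->
  {within A, continuous (fun t => f t + g t)}.
Proof. by move=> cf cg t; apply: continuousD; [exact: cf|exact: cg]. Qed.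

Lemma within_oppf A f : {within A, continuous f} ->
  {within A, continuous (fun t => - f t)}.
Proof. by move=> cf t; apply: continuousN; exact: cf. Qed.

Lemma within_mulf A f g : {within A, continuous f} -> {within A, continuous g} ->
  {within A, continuous (fun t => f t * g t)}.
Proof. by move=> cf cg t; apply: continuousM; [exact: cf|exact: cg]. Qed.

Lemma within_cstf A (c : R) : {within A, continuous (fun=> c)}.
Proof. by move=> t; exact: cvg_cst. Qed.

End within_calculus.

Section complex_calculus.
Context {R : realType}.
Implicit Types (f g : R -> R[i]) (z w : R[i]) (x a b : R).

Lemma ReM z w : complex.Re (z * w) = complex.Re z * complex.Re w - complex.Im z * complex.Im w.
Proof. by case: z w => [a b] [c d]. Qed.

Lemma ImM z w : complex.Im (z * w) = complex.Re z * complex.Im w + complex.Im z * complex.Re w.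
Proof. by case: z w => [a b] [c d]. Qed.

Lemma ReD z w : complex.Re (z + w) = complex.Re z + complex.Re w.
Proof. by case: z w => [a b] [c d]. Qed.

Lemma ImD z w : complex.Im (z + w) = complex.Im z + complex.Im w.
Proof. by case: z w => [a b] [c d]. Qed.

Lemma ReN z : complex.Re (- z) = - complex.Re z.
Proof. by case: z. Qed.

Lemma ImN z : complex.Im (- z) = - complex.Im z.
Proof. by case: z. Qed.

Lemma ReJ z : complex.Re (conjc z) = complex.Re z.
Proof. by case: z. Qed.

Lemma ImJ z : complex.Im (conjc z) = - complex.Im z.
Proof. by case: z. Qed.

Definition ReImE := (ReM, ImM, ReD, ImD, ReN, ImN).

Lemma complex_eq z w : complex.Re z = complex.Re w -> complex.Im z = complex.Im w -> z = w.
Proof. by case: z w => [a b] [c d] /= -> ->. Qed.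

Lemma normcE z : normc z = Num.sqrt (complex.Re z ^+ 2 + complex.Im z ^+ 2).
Proof. by case: z. Qed.

Lemma normc_ge0 z : 0 <= normc z.
Proof. by rewrite normcE sqrtr_ge0. Qed.

Lemma normcD z w : normc (z + w) <= normc z + normc w.
Proof. exact: le_normcD. Qed.

Lemma normc_opp z : normc (- z) = normc z.
Proof. exact: normcN. Qed.

Lemma normcB z w : normc (z - w) <= normc z + normc w.
Proof. by rewrite -(normc_opp w) normcD. Qed.

Lemma normc_real a : normc a%:C = `|a|.
Proof. by rewrite normcE/= expr0n addr0 sqrtr_sqr. Qed.

Lemma normc_expi x : normc (expi x) = 1.
Proof. by rewrite normcE/= cos2Dsin2 sqrtr1. Qed.

Lemma normc_conj z : normc (conjc z) = normc z.
Proof. by case: z => a b; rewrite !normcE/= sqrrN. Qed.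

Lemma expiD x y : expi (x + y) = expi x * expi y :> R[i].
Proof. by apply: complex_eq; rewrite !ReImE/= ?cosD ?sinD// addrC mulrC. Qed.

Lemma normc_sqr z : normc z ^+ 2 = complex.Re z ^+ 2 + complex.Im z ^+ 2.
Proof. by rewrite normcE sqr_sqrtr// addr_ge0 ?sqr_ge0. Qed.

Lemma normc_ge_lin z a b : a ^+ 2 + b ^+ 2 = 1 ->
  a * complex.Re z + b * complex.Im z <= normc z.
Proof.
move=> ab; apply: le_trans (ler_norm _) _.
rewrite -[leLHS]sqrtr_sqr normcE ler_wsqrtr//.
have := sqr_ge0 (a * complex.Im z - b * complex.Re z).
set p := complex.Re z; set q := complex.Im z => h.
have -> : p ^+ 2 + q ^+ 2 = (a ^+ 2 + b ^+ 2) * (p ^+ 2 + q ^+ 2) by rewrite ab mul1r.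
by rewrite -subr_ge0 [X in 0 <= X](_ : _ = (a * q - b * p) ^+ 2)//; ring.
Qed.

(** The modulus is the largest projection on a unit vector, attained in the direction of [z] itself.
    Complex bounds are thereby proved on real linear combinations, to which monotonicity of the real
    integral applies. For [z = 0] any direction shows [0 <= M]. *)
Lemma normc_le_lin z M : (forall a b, a ^+ 2 + b ^+ 2 = 1 ->
  a * complex.Re z + b * complex.Im z <= M) -> normc z <= M.
Proof.
move=> H; have [z0|z0] := eqVneq (normc z) 0.
  have H1 : (1 : R) ^+ 2 + 0 ^+ 2 = 1 by rewrite expr1n expr0n addr0.
  apply: le_trans (H _ _ H1); rewrite (eq0_normc z0) normc0/=; lra.
apply: le_trans (H (complex.Re z / normc z) (complex.Im z / normc z) _).
  rewrite [leRHS](_ : _ = (complex.Re z ^+ 2 + complex.Im z ^+ 2) / normc z); last by ring.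
  by rewrite -normc_sqr expr2 mulfK.
by rewrite !expr_div_n -mulrDl -normc_sqr mulfV// expf_neq0.
Qed.

Definition cderive_at f x (df : R[i]) : Prop :=
  derive_at (fun t => complex.Re (f t)) x (complex.Re df) /\
  derive_at (fun t => complex.Im (f t)) x (complex.Im df).

Lemma cderive_at_cast f x z w : z = w -> cderive_at f x z -> cderive_at f x w.
Proof. by move=> ->. Qed.

Lemma cderive_at_add f g x z w : cderive_at f x z -> cderive_at g x w ->
  cderive_at (fun t => f t + g t) x (z + w).
Proof.
move=> [f1 f2] [g1 g2]; split; rewrite ReImE; under eq_fun do rewrite ReImE.
  exact: derive_at_addf.
exact: derive_at_addf.
Qed.

Lemma cderive_at_opp f x z : cderive_at f x z -> cderive_at (fun t => - f t) x (- z).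
Proof.
move=> [f1 f2]; split; rewrite ReImE; under eq_fun do rewrite ReImE.
  exact: derive_at_oppf.
exact: derive_at_oppf.
Qed.

Lemma cderive_at_mul f g x z w : cderive_at f x z -> cderive_at g x w ->
  cderive_at (fun t => f t * g t) x (z * g x + f x * w).
Proof.
move=> [f1 f2] [g1 g2]; split; under eq_fun do rewrite ReImE.
  apply: derive_at_cast; last by apply: derive_at_subf; apply: derive_at_mulf;
    [exact: f1|exact: g1|exact: f2|exact: g2].
  by rewrite !ReImE /=; ring.
apply: derive_at_cast; last by apply: derive_at_addf; apply: derive_at_mulf;
  [exact: f1|exact: g2|exact: f2|exact: g1].
by rewrite !ReImE /=; ring.
Qed.

Lemma cderive_at_cst z x : cderive_at (fun=> z) x 0.
Proof. by split; exact: derive_at_cstf. Qed.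

Lemma cderive_at_real (h : R -> R) x a : derive_at h x a ->
  cderive_at (fun t => (h t)%:C) x a%:C.
Proof. by move=> ha; split=> //=; exact: derive_at_cstf. Qed.

Lemma cderive_at_conj f x z : cderive_at f x z -> cderive_at (fun t => conjc (f t)) x (conjc z).
Proof.
move=> [f1 f2]; split.
  by under eq_fun do rewrite ReJ; rewrite ReJ.
by under eq_fun do rewrite ImJ; rewrite ImJ; exact: derive_at_oppf.
Qed.

Lemma cderive_at_comp f (h : R -> R) x z a : cderive_at f (h x) z -> derive_at h x a ->
  cderive_at (fun t => f (h t)) x (z * a%:C).
Proof.
move=> [f1 f2] ha; split.
  apply: derive_at_cast (derive_at_compf f1 ha).
  by rewrite ReImE/= mulr0 subr0.
apply: derive_at_cast (derive_at_compf f2 ha).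
by rewrite ReImE/= mulr0 add0r.
Qed.

Lemma cderive_at_expi (h : R -> R) x a : derive_at h x a ->
  cderive_at (fun t => expi (h t)) x (expi (h x) * (0 +i* a)).
Proof.
move=> ha; split=> /=.
  apply: derive_at_cast; last by apply: derive_at_compf ha; exact: is_derive_cos.
  by ring.
apply: derive_at_cast; last by apply: derive_at_compf ha; exact: is_derive_sin.
by ring.
Qed.

Lemma cderive_at_near f g x z : (\near x, f x = g x) -> cderive_at f x z -> cderive_at g x z.
Proof.
move=> fg [f1 f2]; split.
  by apply: derive_at_near f1; apply: filterS fg => t ->.
by apply: derive_at_near f2; apply: filterS fg => t ->.
Qed.

Definition cwithin a b f : Prop :=
  {within `[a, b], continuous (fun t => complex.Re (f t))} /\
  {within `[a, b], continuous (fun t => complex.Im (f t))}.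

Lemma cwithin_sub a b a' b' f : a' <= a -> b <= b' -> cwithin a' b' f -> cwithin a b f.
Proof.
move=> aa bb; have s : `[a, b] `<=` `[a', b'].
  by apply: subset_itvScc; rewrite bnd_simp.
by move=> [f1 f2]; split; [exact: continuous_subspaceW f1|exact: continuous_subspaceW f2].
Qed.

Lemma cwithin_add a b f g : cwithin a b f -> cwithin a b g -> cwithin a b (fun t => f t + g t).
Proof.
move=> [f1 f2] [g1 g2]; split.
  by rewrite (funext (fun t => ReD (f t) (g t))); exact: within_addf.
by rewrite (funext (fun t => ImD (f t) (g t))); exact: within_addf.
Qed.

Lemma cwithin_opp a b f : cwithin a b f -> cwithin a b (fun t => - f t).
Proof.
move=> [f1 f2]; split.
  by rewrite (funext (fun t => ReN (f t))); exact: within_oppf.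
by rewrite (funext (fun t => ImN (f t))); exact: within_oppf.
Qed.

Lemma cwithin_mul a b f g : cwithin a b f -> cwithin a b g -> cwithin a b (fun t => f t * g t).
Proof.
move=> [f1 f2] [g1 g2]; split.
  rewrite (funext (fun t => ReM (f t) (g t))); apply: within_addf; first exact: within_mulf.
  by apply: within_oppf; exact: within_mulf.
by rewrite (funext (fun t => ImM (f t) (g t))); apply: within_addf; exact: within_mulf.
Qed.

Lemma cwithin_cst a b z : cwithin a b (fun=> z).
Proof. by split=> t; exact: cvg_cst. Qed.

Lemma cwithin_real a b (h : R -> R) : {within `[a, b], continuous h} ->
  cwithin a b (fun t => (h t)%:C).
Proof. by move=> ch; split=> //= t; exact: cvg_cst. Qed.

(* Testing against a unit vector reduces this to the real mean value theorem. *)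
Lemma normc_increment_le f (W : R -> R) (df : R -> R[i]) (dW : R -> R) a b : a <= b ->
  cwithin a b f -> {within `[a, b], continuous W} ->
  (forall x, a < x < b -> cderive_at f x (df x)) ->
  (forall x, a < x < b -> derive_at W x (dW x)) ->
  (forall x, a < x < b -> normc (df x) <= dW x) ->
  normc (f b - f a) <= W b - W a.
Proof.
move=> ab [cf1 cf2] cW dfE dWE le; apply: normc_le_lin => p q pq.
pose h x := W x - (p * complex.Re (f x) + q * complex.Im (f x)).
pose dh x := dW x - (p * complex.Re (df x) + q * complex.Im (df x)).
have hd x : x \in `]a, b[ -> is_derive x 1 h (dh x).
  rewrite in_itv/= => xab; have [d1 d2] := dfE _ xab.
  apply: derive_at_cast; last first.
    apply: derive_at_subf; first exact: dWE.
    by apply: derive_at_addf; apply: derive_at_mulf;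
      [exact: derive_at_cstf|exact: d1|exact: derive_at_cstf|exact: d2].
  by rewrite /= !mul0r !add0r.
have hc : {within `[a, b], continuous h}.
  apply: within_addf => //; apply: within_oppf.
  by apply: within_addf; apply: within_mulf => //; exact: within_cstf.
have [<-|ab'] := eqVneq a b; first by rewrite !subrr/=; lra.
have {}ab : a < b by rewrite lt_neqAle ab'.
have [t tab E] := MVT ab hd hc.
have : 0 <= h b - h a.
  rewrite E mulr_ge0//; last lra.
  rewrite in_itv/= in tab; rewrite /dh subr_ge0.
  by apply: le_trans (normc_ge_lin _ pq) _; exact: le.
by rewrite /h !ReImE; lra.
Qed.

End complex_calculus.

(** * Tails of oscillatory integrals *)

Section oscillatory_tail.
Context {R : realType}.
Notation mu := (@lebesgue_measure R).
Variables (nu : R) (nu01 : 0 < nu < 1).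
Implicit Types (s x w : R).

(** The Laplace transform of [x ^ (- nu) / (x - i)], extended evenly in [s]. *)
Definition osc_kernel s : R[i] :=
  laplace (rker nu 0) `|s| +i* laplace (iker nu 0 1) `|s|.

(* The tail [- \int_s^oo t ^ (nu - 1) exp (i t) dt], through the Laplace
   representation of [t ^ (nu - 1)]. *)
Definition osc s : R[i] := - (Gamma (1 - nu))^-1%:C * (expi s * osc_kernel s).

Let c0 : - (3 / 4) <= (0 : R) <= 1. Proof. by lra. Qed.
Let c0' : - (3 / 4) <= (0 : R). Proof. by lra. Qed.
Let s1 : `|1 : R| <= 1. Proof. by rewrite normr1. Qed.
Let cs : (0 : R) ^+ 2 + 1 ^+ 2 = 1. Proof. by rewrite expr0n expr1n add0r. Qed.
Let G0 := Gamma_gt0 nu01.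

(** The kernel solves [k' = - i k - Gamma (1 - nu) s ^ (nu - 1)]; the factor [expi s] removes the
    homogeneous part. *)
Lemma cderive_at_osc s : 0 < s -> cderive_at osc s ((s `^ (nu - 1))%:C * expi s).
Proof.
move=> s0.
have dk : cderive_at osc_kernel s ((laplace (iker nu 0 1) s - Gamma (1 - nu) * s `^ (nu - 1))
    +i* (- laplace (rker nu 0) s)).
  apply: (@cderive_at_near _ (fun s => laplace (rker nu 0) s +i* laplace (iker nu 0 1) s)).
    by near=> t; rewrite /osc_kernel gtr0_norm//; near: t; exact: lt_nbhsr.
  split=> /=.
    apply: derive_at_cast (derive_at_laplace_rker nu01 c0 s1 cs s0).
    by rewrite mul0r add0r mul1r.
  apply: derive_at_cast (derive_at_laplace_iker nu01 c0 s1 s0).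
  by rewrite mul0r add0r mul1r.
apply: cderive_at_cast; last first.
  apply: cderive_at_mul; first exact: cderive_at_cst.
  apply: cderive_at_mul; last exact: dk.
  by apply: (@cderive_at_expi _ (fun t => t)); exact: derive_at_idf.
rewrite /osc_kernel (gtr0_norm s0).
apply: complex_eq; rewrite !ReImE/= ; field; rewrite gt_eqF//.
Unshelve. all: by end_near. Qed.

Lemma continuous_osc : continuous (fun s => complex.Re (osc s)) /\
  continuous (fun s => complex.Im (osc s)).
Proof.
have cr := continuous_laplace_rker nu01 c0.
have ci := continuous_laplace_iker nu01 c0' s1.
have cM (f g : R -> R) : continuous f -> continuous g -> continuous (fun s => f s * g s).
  by move=> cf cg s; apply: continuousM; [exact: cf|exact: cg].
have cA (f g : R -> R) : continuous f -> continuous g -> continuous (fun s => f s + g s).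
  by move=> cf cg s; apply: continuousD; [exact: cf|exact: cg].
have cK (k : R) : continuous (fun _ : R => k) by move=> s; exact: cvg_cst.
have cc := @continuous_cos R; have csn := @continuous_sin R.
split.
  rewrite (_ : (fun s => _) = (fun s => (- (Gamma (1 - nu))^-1) *
    (cos s * laplace (rker nu 0) `|s| + (- 1) * (sin s * laplace (iker nu 0 1) `|s|)))).
    exact: (cM _ _ (cK _) (cA _ _ (cM _ _ cc cr) (cM _ _ (cK _) (cM _ _ csn ci)))).
  by apply/funext => s; rewrite !ReImE/=; ring.
rewrite (_ : (fun s => _) = (fun s => (- (Gamma (1 - nu))^-1) *
  (cos s * laplace (iker nu 0 1) `|s| + sin s * laplace (rker nu 0) `|s|))).
  exact: (cM _ _ (cK _) (cA _ _ (cM _ _ cc ci) (cM _ _ csn cr))).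
by apply/funext => s; rewrite !ReImE/=; ring.
Qed.

Lemma osc0 : osc 0 = - (Gamma nu)%:C * expi (pi * nu / 2).
Proof.
rewrite /osc /osc_kernel normr0 laplace_rker0// laplace_iker0//.
rewrite (_ : pi * nu / 2 = nu * (pi / 2)); last by ring.
move: (nu * (pi / 2)) => t; rewrite /expi.
have /lt0r_neq0 := G0; move: (Gamma (1 - nu)) (Gamma nu) (cos t) (sin t) => g g' x y g0.
by apply: complex_eq; rewrite !ReImE/= cos0 sin0; field.
Qed.

Let rker_ge0 x : 0 < x -> 0 <= rker nu 0 x.
Proof.
move=> x0; rewrite mulr_ge0 ?powR_ge0// divr_ge0 ?(ltW (rden_gt0 _ _))//; lra.
Qed.

Let iker_ge0 x : 0 < x -> 0 <= iker nu 0 1 x.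
Proof.
by move=> x0; rewrite mulr_ge0 ?powR_ge0// divr_ge0 ?(ltW (rden_gt0 _ _)).
Qed.

Let normc_osc s : normc (osc s) = normc (osc_kernel s) / Gamma (1 - nu).
Proof.
by rewrite /osc !normcM normc_opp normc_real normc_expi mul1r mulrC ger0_norm ?invr_ge0 ?ltW.
Qed.

Let laplace_anti (phi : R -> R) s : 0 <= s -> (forall x, 0 < x -> 0 <= phi x) ->
  (forall s, 0 <= s -> mu.-integrable (`]0, +oo[ : set R) (EFin \o (fun x => phi x * expR (- (x * s))))) ->
  0 <= laplace phi s <= laplace phi 0.
Proof.
move=> s0 p0 intp; apply/andP; split.
  by apply: Rintegral_ge0 => x; rewrite /= in_itv/= andbT => x0; rewrite mulr_ge0 ?expR_ge0 ?p0.
apply: le_Rintegral0y => [||x x0]; try exact: intp.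
by rewrite ler_wpM2l ?p0// mulr0 oppr0 expR0 expR_le1_mul.
Qed.

(** Both components of [osc_kernel] are transforms of nonnegative functions, so each is largest at
    0, and the modulus there is known from [osc0]. *)
Lemma normc_osc_le0 s : normc (osc s) <= Gamma nu.
Proof.
have -> : Gamma nu = normc (osc 0).
  have mu01 : 0 < 1 - nu < 1 by have /andP[? ?] := nu01; apply/andP; split; lra.
  have := Gamma_gt0 mu01; rewrite subKr => h.
  by rewrite osc0 normcM normc_opp normc_real normc_expi mulr1 (ger0_norm (ltW h)).
rewrite 2!normc_osc ler_pM2r; last by rewrite invr_gt0.
rewrite !normcE /osc_kernel/= normr0; apply: ler_wsqrtr.
have /andP[a1 a2] : 0 <= laplace (rker nu 0) `|s| <= laplace (rker nu 0) 0.
  by apply: laplace_anti => // t t0; exact: integrable_laplace_rker.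
have /andP[b1 b2] : 0 <= laplace (iker nu 0 1) `|s| <= laplace (iker nu 0 1) 0.
  by apply: laplace_anti => // t t0; exact: integrable_laplace_iker.
move: a1 a2 b1 b2; move: (laplace _ _) (laplace _ _) (laplace _ _) (laplace _ _) => a a' b b'.
by move=> *; apply: lerD; rewrite !expr2; apply: ler_pM.
Qed.

(** This is [1 / |x - i| <= 1] tested against the unit vector [(p, q)]: the left side is at most
    [|x + i|], and [|x + i| <= |x + i| ^ 2]. *)
Let lin_bound p q x : p ^+ 2 + q ^+ 2 = 1 -> p * x + q <= x ^+ 2 + 1.
Proof.
move=> pq; have := sqr_ge0 (p * x + q); have := sqr_ge0 (p - q * x); have := sqr_ge0 x.
move=> h1 h2 h3; have : (p * x + q) ^+ 2 <= x ^+ 2 + 1.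
  have -> : x ^+ 2 + 1 = (p ^+ 2 + q ^+ 2) * (x ^+ 2 + 1) by rewrite pq mul1r.
  by rewrite -subr_ge0 [X in 0 <= X](_ : _ = (p - q * x) ^+ 2)//; ring.
have [//|my] := leP (p * x + q) (x ^+ 2 + 1).
by nra.
Qed.

Lemma normc_osc_le s : 0 < s -> normc (osc s) <= s `^ (nu - 1).
Proof.
move=> s0; rewrite normc_osc ler_pdivrMr// mulrC -laplace_npow//.
apply: normc_le_lin => p q pq; rewrite /osc_kernel/= (gtr0_norm s0).
have intr := integrable_laplace_rker nu01 c0 (ltW s0).
have inti := integrable_laplace_iker nu01 c0' s1 (ltW s0).
rewrite -(Rintegral_lin p q intr inti); apply: le_Rintegral0y.
- by apply: integrable_addf; apply: integrable_mulf.
- exact: integrable_npow.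
move=> x x0; rewrite /rker /iker.
have d0 : 0 < rden 0 x by exact: rden_gt0.
rewrite [leLHS](_ : _ = npow nu x * expR (- (x * s)) * ((p * x + q) / rden 0 x)); last first.
  by rewrite addr0; ring.
rewrite ler_piMr ?mulr_ge0 ?powR_ge0 ?expR_ge0// ler_pdivrMr// mul1r.
by rewrite /rden mulr0 mul0r addr0 lin_bound.
Qed.

(** Replacing [1 / (x - i)] by its value [i] at [x = 0] produces the leading term. The difference
    [- i x / (x - i)] has modulus at most [x], and [laplace_xnpow] evaluates the transform of
    [x * npow nu x]. *)
Lemma normc_osc_rem s : 0 < s ->
  normc (osc s + 'i * (s `^ (nu - 1))%:C * expi s) <= (1 - nu) * s `^ (nu - 2).
Proof.
move=> s0.
have -> : osc s + 'i * (s `^ (nu - 1))%:C * expi s =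
    - (Gamma (1 - nu))^-1%:C * expi s *
    (osc_kernel s - (0 +i* laplace (npow nu) s)).
  rewrite laplace_npow// /osc; apply: complex_eq; rewrite !ReImE/=; field; rewrite gt_eqF//.
rewrite !normcM normc_opp normc_real normc_expi mulr1 ger0_norm; last by rewrite invr_ge0 ltW.
rewrite [leLHS]mulrC ler_pdivrMr//.
have -> : (1 - nu) * s `^ (nu - 2) * Gamma (1 - nu) = laplace (fun x => x * npow nu x) s.
  have := laplace_xnpow nu01 s0; rewrite laplace_npow// => /eqP.
  rewrite subr_eq0 => /eqP E; apply: (mulfI (lt0r_neq0 s0)); rewrite -E.
  have -> : s `^ (nu - 1) = s `^ (nu - 2) * s.
    by rewrite -[X in _ * X]powRr1 ?(ltW s0)// -powRDx//; congr (_ `^ _); ring.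
  by ring.
apply: normc_le_lin => p q pq; rewrite !ReImE /osc_kernel/= (gtr0_norm s0) oppr0 addr0.
have intr := integrable_laplace_rker nu01 c0 (ltW s0).
have inti := integrable_laplace_iker nu01 c0' s1 (ltW s0).
have intx := integrable_xnpow nu01 s0.
have intn := integrable_npow nu01 s0.
have intri := integrable_addf (integrable_mulf p intr) (integrable_mulf q inti).
rewrite [leLHS](_ : _ = 1 * (p * laplace (rker nu 0) s + q * laplace (iker nu 0 1) s) +
  (- q) * laplace (npow nu) s); last by ring.
rewrite -(Rintegral_lin p q intr inti) -(Rintegral_lin 1 (- q) intri intn).
apply: le_Rintegral0y => //.
  by apply: integrable_addf; apply: integrable_mulf.
move=> x x0; rewrite /rker /iker.
have d0 : 0 < rden 0 x by exact: rden_gt0.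
have dE : rden 0 x = x ^+ 2 + 1 by rewrite /rden mulr0 mul0r addr0.
rewrite dE in d0 *.
rewrite [leLHS](_ : _ =
    x * npow nu x * expR (- (x * s)) * (((- q) * x + p) / (x ^+ 2 + 1))); last first.
  by field; rewrite gt_eqF.
rewrite ler_piMr ?mulr_ge0 ?powR_ge0 ?expR_ge0 ?(ltW x0)// ler_pdivrMr// mul1r.
by rewrite lin_bound// sqrrN addrC.
Qed.

End oscillatory_tail.

Lemma powR_sqrX {R : realType} (x a : R) : 0 <= x -> (x ^+ 2) `^ a = x `^ (2 * a).
Proof. by move=> x0; rewrite powRrM powR_mulrn. Qed.

Lemma powRN1 {R : realType} (x : R) : 0 <= x -> x `^ (- 1) = x^-1.
Proof. by move=> x0; rewrite powRN powRr1. Qed.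

Section scaled_tail.
Context {R : realType}.
Variables (nu : R) (nu01 : 0 < nu < 1) (w : R) (w0 : 0 < w).
Implicit Types s : R.

(** The tail [- \int_s^oo t ^ (nu - 1) exp (i w t) dt], reduced by scaling to the case [w = 1]. *)
Definition oscw s : R[i] := (w `^ (- nu))%:C * osc nu (w * s).

Let powRw s : w `^ (- nu) * (w * s) `^ (nu - 1) = w^-1 * s `^ (nu - 1) \/ s < 0.
Proof.
have [s0|s0] := leP 0 s; last by right.
left; rewrite powRM ?(ltW w0)// mulrA -powRDx// (_ : - nu + (nu - 1) = - 1); last by ring.
by rewrite powRN1 ?(ltW w0).
Qed.

Lemma cderive_at_oscw s : 0 < s -> cderive_at oscw s ((s `^ (nu - 1))%:C * expi (w * s)).
Proof.
move=> s0; have ws0 : 0 < w * s by rewrite mulr_gt0.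
apply: cderive_at_cast; last first.
  apply: cderive_at_mul; first exact: cderive_at_cst.
  apply: cderive_at_comp; first exact: cderive_at_osc.
  by apply: derive_at_mulf; [exact: derive_at_cstf|exact: derive_at_idf].
have [E|] := powRw s; last by move=> /(lt_trans s0); rewrite ltxx.
rewrite /= !mul0r !add0r mulr1.
rewrite (_ : s `^ (nu - 1) = w * (w `^ (- nu) * (w * s) `^ (nu - 1))); last first.
  by rewrite E mulrA mulfV ?gt_eqF// mul1r.
move: (w `^ _) ((w * s) `^ _) (expi _) => a b e.
by apply: complex_eq; rewrite !ReImE/=; ring.
Qed.

Lemma continuous_oscw : continuous (fun s => complex.Re (oscw s)) /\
  continuous (fun s => complex.Im (oscw s)).
Proof.
have [h1 h2] := continuous_osc nu01.
have cw : continuous (fun s : R => w * s).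
  by move=> s; apply: continuousM; [exact: cvg_cst|exact: cvg_id].
have cK (h : R -> R) : continuous h -> continuous (fun s => w `^ (- nu) * h (w * s)).
  move=> ch s.
  have c1 : {for s, continuous (fun s => h (w * s))}.
    exact: (continuous_comp (cw s) (ch (w * s))).
  by apply: (@continuousM _ _ (fun=> w `^ (- nu)) _ s _ c1); exact: cvg_cst.
split.
  rewrite (_ : (fun s => _) = (fun s => w `^ (- nu) * complex.Re (osc nu (w * s)))).
    exact: (cK _ h1).
  by apply/funext => s; rewrite !ReImE/= mul0r subr0.
rewrite (_ : (fun s => _) = (fun s => w `^ (- nu) * complex.Im (osc nu (w * s)))).
  exact: (cK _ h2).
by apply/funext => s; rewrite !ReImE/= mul0r addr0.
Qed.

Lemma oscw0 : oscw 0 = - (Gamma nu * w `^ (- nu))%:C * expi (pi * nu / 2).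
Proof.
rewrite /oscw mulr0 osc0//; move: (w `^ _) (Gamma nu) (expi _) => a b e.
by apply: complex_eq; rewrite !ReImE/=; ring.
Qed.

Lemma normc_oscw_le s : 0 < s -> normc (oscw s) <= w^-1 * s `^ (nu - 1).
Proof.
move=> s0; have [<-|] := powRw s; last by move=> /(lt_trans s0); rewrite ltxx.
rewrite normcM normc_real ger0_norm ?powR_ge0// ler_wpM2l ?powR_ge0//.
by apply: normc_osc_le; rewrite ?mulr_gt0.
Qed.

Lemma normc_oscw_le0 s : normc (oscw s) <= Gamma nu * w `^ (- nu).
Proof.
rewrite normcM normc_real ger0_norm ?powR_ge0// mulrC ler_wpM2r ?powR_ge0//.
exact: normc_osc_le0.
Qed.

Lemma normc_oscw_rem s : 0 < s ->
  normc (oscw s + 'i * (w^-1 * s `^ (nu - 1))%:C * expi (w * s)) <=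
  (1 - nu) * (w^-1 ^+ 2 * s `^ (nu - 2)).
Proof.
move=> s0; have [E|] := powRw s; last by move=> /(lt_trans s0); rewrite ltxx.
rewrite (_ : oscw s + _ = (w `^ (- nu))%:C *
  (osc nu (w * s) + 'i * ((w * s) `^ (nu - 1))%:C * expi (w * s))); last first.
  rewrite -E /oscw; move: (w `^ _) ((w * s) `^ _) (expi _) (osc _ _) => a b e o.
  by apply: complex_eq; rewrite !ReImE/=; ring.
rewrite normcM normc_real ger0_norm ?powR_ge0//.
have -> : (1 - nu) * (w^-1 ^+ 2 * s `^ (nu - 2)) =
    w `^ (- nu) * ((1 - nu) * (w * s) `^ (nu - 2)).
  rewrite powRM ?(ltW w0) ?(ltW s0)// [RHS]mulrCA; congr (_ * _).
  rewrite mulrA -powRDx// (_ : - nu + (nu - 2) = - (1 + 1)); last by ring.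
  by rewrite powRN (powRDx 1 1 w0) powRr1 ?(ltW w0)// expr2 invfM.
by rewrite ler_wpM2l ?powR_ge0//; apply: normc_osc_rem; rewrite ?mulr_gt0.
Qed.

End scaled_tail.

(** * Fresnel tails *)

Section fresnel.
Context {R : realType}.
Variables (w : R) (w0 : 0 < w).
Implicit Types x : R.

Let half01 : (0 : R) < 1 / 2 < (1 : R). Proof. by lra. Qed.

(* The tail [- \int_x^oo exp (- i w t ^ 2) dt]. *)
Definition fresnel x : R[i] := (1 / 2)%:C * conjc (oscw (1 / 2) w (x ^+ 2)).

Let sqr_powRN x : 0 < x -> (x ^+ 2) `^ (1 / 2 - 1) = x^-1.
Proof.
move=> x0; rewrite powR_sqrX ?ltW// (_ : 2 * (1 / 2 - 1) = - 1); last by field.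
by rewrite powRN1 ?ltW.
Qed.

Lemma cderive_at_fresnel x : 0 < x -> cderive_at fresnel x (expi (- (w * x ^+ 2))).
Proof.
move=> x0; have x20 : 0 < x ^+ 2 by rewrite exprn_gt0.
have zx := sqr_powRN x0; have d := cderive_at_oscw half01 w0 x20.
rewrite expr2 in d zx.
apply: cderive_at_cast; last first.
  apply: cderive_at_mul; first exact: cderive_at_cst.
  apply: cderive_at_conj; apply: (@cderive_at_comp _ _ (fun t => t * t)).
    exact: d.
  by apply: derive_at_mulf; exact: derive_at_idf.
rewrite zx expr2 mul0r add0r; apply: complex_eq; rewrite !(ReImE, ReJ, ImJ)/= ?cosN ?sinN.
  by field; rewrite gt_eqF.
by field; rewrite gt_eqF.
Qed.

Lemma continuous_fresnel : continuous (fun t => complex.Re (fresnel t)) /\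
  continuous (fun t => complex.Im (fresnel t)).
Proof.
have [h1 h2] := continuous_oscw half01 w.
have cx : continuous (fun x : R => x ^+ 2) by exact: exprn_continuous.
have cK (k : R) (h : R -> R) : continuous h -> continuous (fun s : R => k * h (s ^+ 2)).
  move=> ch s; have c1 : {for s, continuous (fun s : R => h (s ^+ 2))}.
    exact: (continuous_comp (cx s) (ch (s ^+ 2))).
  by apply: (@continuousM _ _ (fun=> k) _ s _ c1); exact: cvg_cst.
split.
  rewrite (_ : (fun t => _) = (fun t => 1 / 2 * complex.Re (oscw (1 / 2) w (t ^+ 2)))).
    exact: (cK _ _ h1).
  by apply/funext => s; rewrite !(ReImE, ReJ, ImJ)/=; ring.
rewrite (_ : (fun t => _) = (fun t => - (1 / 2) * complex.Im (oscw (1 / 2) w (t ^+ 2)))).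
  exact: (cK _ _ h2).
by apply/funext => s; rewrite !(ReImE, ReJ, ImJ)/=; ring.
Qed.

Lemma fresnel0 : fresnel 0 = - (Num.sqrt pi / 2 * w `^ (- (1 / 2)))%:C * expi (- (pi / 4)).
Proof.
rewrite /fresnel expr0n oscw0// Gamma_half (_ : pi * (1 / 2) / 2 = pi / 4); last by field.
rewrite /expi cosN sinN; move: (w `^ _) (Num.sqrt pi) (cos _) (sin _) => a b e e'.
by apply: complex_eq; rewrite !(ReImE, ReJ, ImJ)/=; field.
Qed.

Let normc_half z : normc ((1 / 2)%:C * z) = normc z / 2 :> R.
Proof. by rewrite normcM normc_real ger0_norm; lra. Qed.

Lemma normc_fresnel_le0 x : normc (fresnel x) <= Num.sqrt pi / 2 * w `^ (- (1 / 2)).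
Proof.
rewrite /fresnel normc_half normc_conj.
by have := normc_oscw_le0 half01 w (x ^+ 2); rewrite Gamma_half; lra.
Qed.

Lemma normc_fresnel_le x : 0 < x -> normc (fresnel x) <= (2 * w * x)^-1.
Proof.
move=> x0; rewrite /fresnel normc_half normc_conj -mulrA invfM mulrC.
rewrite ler_wpM2l ?invr_ge0// invfM -(sqr_powRN x0).
by apply: normc_oscw_le => //; rewrite exprn_gt0.
Qed.

(** With [A] the uniform bound on the tail and [y = K w ^ (- 1 / 2) / x], the right side is
    [A y ^ g]. If [1 <= y], it exceeds [A]. If [y < 1], it exceeds [A y], which equals [sqrt pi * K]
    times [1 / (2 w x)]; that is at least [1 / (2 w x)] because [1 <= pi * K ^ 2]. *)
Lemma normc_fresnel_interp x K delta : 0 < x -> 0 < K -> 1 <= pi * K ^+ 2 ->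
  1 / 2 < delta < 1 ->
  normc (fresnel x) <= Num.sqrt pi / 2 * K `^ (2 * delta - 1) * w `^ (- delta) *
    x `^ (- (2 * delta - 1)).
Proof.
move=> x0 K0 K1 /andP[d1 d2]; set g := 2 * delta - 1.
have g0 : 0 < g by rewrite /g; lra.
have g1 : g < 1 by rewrite /g; lra.
have sp : 0 < Num.sqrt pi :> R by rewrite sqrtr_gt0 pi_gt0.
have A0 : 0 < Num.sqrt pi / 2 * w `^ (- (1 / 2)) by rewrite mulr_gt0 ?divr_gt0 ?powR_gt0.
have -> : Num.sqrt pi / 2 * K `^ g * w `^ (- delta) * x `^ (- g) =
    Num.sqrt pi / 2 * w `^ (- (1 / 2)) * (K * w `^ (- (1 / 2)) * x^-1) `^ g.
  rewrite -(powRN1 (ltW x0)) !powRM ?mulr_ge0 ?powR_ge0 ?(ltW K0)//.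
  rewrite -!powRrM mulN1r (_ : - delta = - (1 / 2) + - (1 / 2) * g); last by rewrite /g; field.
  by rewrite (powRDx (- (1 / 2)) (- (1 / 2) * g) w0); ring.
have [y1|y1] := leP 1 (K * w `^ (- (1 / 2)) * x^-1).
  apply: le_trans (normc_fresnel_le0 x) _.
  rewrite ler_peMr ?(ltW A0)// -[leLHS](powRr0 (K * w `^ (- (1 / 2)) * x^-1)) ler_powR//.
  exact: ltW.
apply: le_trans (normc_fresnel_le x0) _.
apply: (@le_trans _ _ (Num.sqrt pi / 2 * w `^ (- (1 / 2)) * (K * w `^ (- (1 / 2)) * x^-1))).
  have -> : Num.sqrt pi / 2 * w `^ (- (1 / 2)) * (K * w `^ (- (1 / 2)) * x^-1) =
     (Num.sqrt pi * K) * (2 * w * x)^-1.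
    rewrite !invfM -(powRN1 (ltW w0)) (_ : - 1 = - (1 / 2) + - (1 / 2)); last by lra.
    by rewrite powRDx//; field; rewrite gt_eqF.
  rewrite ler_peMl ?invr_ge0 ?mulr_ge0 ?(ltW w0) ?(ltW x0)//.
  rewrite -(@ler_pXn2r _ 2) ?nnegrE ?mulr_ge0 ?(ltW K0) ?(ltW sp)//.
  by rewrite expr1n exprMn sqr_sqrtr// pi_ge0.
rewrite ler_wpM2l ?(ltW A0)//.
have y0 : 0 < K * w `^ (- (1 / 2)) * x^-1 by rewrite !mulr_gt0 ?powR_gt0 ?invr_gt0.
rewrite -[leLHS]powRr1; last exact: ltW.
by rewrite ger_powR ?y0 ?(ltW y1)// ltW.
Qed.

(* The geometric mean of the trivial bound [1 / (w x)] and of the second-order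
   bound [1 / (4 w ^ 2 x ^ 3)]. *)
Lemma normc_fresnel_rem x : 0 < x ->
  normc (fresnel x - 'i * ((2 * w * x)^-1)%:C * expi (- (w * x ^+ 2))) <=
  1 / 2 * w `^ (- (3 / 2)) * (x ^+ 2)^-1.
Proof.
move=> x0; set N := normc _.
have x20 : 0 < x ^+ 2 by rewrite exprn_gt0.
have N0 : 0 <= N by exact: normc_ge0.
have e : (2 * w * x)^-1 = (w * x)^-1 / 2 by field; rewrite !gt_eqF.
have h1 : N <= (w * x)^-1.
  apply: le_trans (normcB _ _) _.
  rewrite [X in _ + X](_ : _ = (w * x)^-1 / 2); last first.
    rewrite -e !normcM normc_expi mulr1 normc_real.
    rewrite [normc 'i](_ : _ = 1); last by rewrite normcE/= expr0n expr1n add0r sqrtr1.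
    by rewrite mul1r ger0_norm ?invr_ge0 ?mulr_ge0 ?(ltW w0) ?(ltW x0).
  by have := normc_fresnel_le x0; rewrite e; lra.
have h2 : N <= 1 / 4 * (w^-1 ^+ 2 * x^-1 ^+ 3).
  have := normc_oscw_rem half01 w0 x20; rewrite sqr_powRN// => H.
  have -> : N = normc (oscw (1 / 2) w (x ^+ 2) +
      'i * (w^-1 * x^-1)%:C * expi (w * x ^+ 2)) / 2.
    rewrite -normc_half -(normc_conj (_%:C * _)); congr normc; rewrite /fresnel.
    move: (oscw _ _ _) => o; rewrite /expi cosN sinN; move: (cos _) (sin _) => a b.
    by apply: complex_eq; rewrite !(ReImE, ReJ, ImJ)/=; field; rewrite !gt_eqF.
  have E : (x ^+ 2) `^ (1 / 2 - 2) = x^-1 ^+ 3.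
    rewrite powR_sqrX ?ltW// (_ : 2 * (1 / 2 - 2) = - (1 + 1 + 1)); last by lra.
    by rewrite powRN !powRDx// powRr1 ?ltW//; field; rewrite gt_eqF.
  by rewrite E in H; lra.
rewrite -(@ler_pXn2r _ 2) ?nnegrE ?mulr_ge0 ?powR_ge0 ?invr_ge0 ?sqr_ge0//.
apply: (@le_trans _ _ ((w * x)^-1 * (1 / 4 * (w^-1 ^+ 2 * x^-1 ^+ 3)))).
  by rewrite expr2 ler_pM.
rewrite !exprMn [(w `^ _) ^+ 2](_ : _ = w^-1 ^+ 3).
  by rewrite le_eqVlt; apply/orP; left; apply/eqP; field; rewrite !gt_eqF.
rewrite -powR_mulrn ?powR_ge0// -powRrM (_ : - (3 / 2) * 2%:R = - (1 + 1 + 1)); last by field.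
by rewrite powRN !powRDx// powRr1 ?ltW//; field; rewrite gt_eqF.
Qed.

End fresnel.

(** * Essential suprema and primitives *)

Section Linfty_bounds.
Context {R : realType}.
Notation mu := (@lebesgue_measure R).
Implicit Types (f : R -> R[i]) (a b B t : R).

Lemma continuous_normc f t :
  {for t, continuous (fun t => complex.Re (f t))} ->
  {for t, continuous (fun t => complex.Im (f t))} ->
  {for t, continuous (fun t => normc (f t))}.
Proof.
move=> c1 c2; rewrite (funext (fun t => normcE (f t))).
have c3 : {for t, continuous (fun t => complex.Re (f t) ^+ 2 + complex.Im (f t) ^+ 2)}.
  by apply: continuousD; [exact: (continuousM c1 c1)|exact: (continuousM c2 c2)].
exact: (continuous_comp c3 (@sqrt_continuous R _)).
Qed.

(** If the modulus exceeded the essential supremum at [t], it would do so on a ball around [t] by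
    continuity, and a ball is not negligible. The bound [B] keeps the supremum finite, so that
    [fine] returns it and not its default value. *)
Lemma normc_le_Linfty f a b B :
  (forall t, a < t < b -> {for t, continuous (fun t => complex.Re (f t))}) ->
  (forall t, a < t < b -> {for t, continuous (fun t => complex.Im (f t))}) ->
  (forall t, a < t < b -> normc (f t) <= B) ->
  forall t, a < t < b -> normc (f t) <= Linfty a b f.
Proof.
move=> c1 c2 fB t tab; have ab : a < b by lra.
rewrite /Linfty unlock /=.
set nu := mrestr _ _.
have nuT : nu setT = (b - a)%:E.
  by rewrite /nu /mrestr setTI lebesgue_measure_itv/= lte_fin ab -EFinB.
rewrite nuT lte_fin subr_gt0 ab.
set h := abse \o _; set E := ess_sup _ _.
have [N [mN N0 subN]] := ess_sup_ge nu h.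
have key : ((normc (f t))%:E <= E)%E.
  rewrite leNgt; apply/negP => Et.
  have : \forall x \near t, (E < (normc (f x))%:E)%E.
    move: Et; case: E => [e| |] Et.
    - have cn := continuous_normc (c1 _ tab) (c2 _ tab).
      move: Et; rewrite lte_fin => Et.
      by near=> x; rewrite lte_fin; near: x; exact: (cvgr_gt _ cn).
    - by move: Et; rewrite ltNge leey.
    - by near=> x; rewrite ltNyr.
  have : \forall x \near t, a < x < b.
    by near=> x; apply/andP; split; near: x; [apply: lt_nbhsr|apply: lt_nbhsl]; case/andP: tab.
  move=> A1 A2.
  have : nbhs t ([set x | a < x < b] `&` [set x | (E < (normc (f x))%:E)%E]) by exact: filterI.
  move=> /nbhs_ballP[r /= r0 br].
  have : (nu (ball t r) <= 0)%E.
    rewrite -N0; apply: le_measure => //; rewrite ?inE//; first exact: measurable_ball.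
    move=> x /br[_ Ex]; apply: subN => /=; apply/negP; rewrite -ltNge.
    by rewrite /h/= ger0_norm// normc_ge0.
  rewrite /nu /mrestr setIidl; last first.
    by move=> x /br[xab _]; rewrite /= in_itv.
  by rewrite lebesgue_measure_ball ?(ltW r0)// lee_fin; lra.
have EB : (E <= B%:E)%E.
  apply/ess_supP; exists (~` `]a, b[%classic); split.
  - exact: measurableC.
  - by transitivity (mu (~` `]a, b[%classic `&` `]a, b[%classic)) => //; rewrite setICl measure0.
  - move=> x; apply: contra_not => /=; rewrite in_itv/= => xab.
    by rewrite /h/= ger0_norm ?normc_ge0// lee_fin fB.
have Efin : E \is a fin_num.
  rewrite fin_numElt; apply/andP; split.
    by apply: lt_le_trans key; rewrite ltNyr.
  by apply: le_lt_trans EB _; rewrite ltry.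
by rewrite -lee_fin fineK.
Unshelve. all: by end_near. Qed.

Lemma within_bounded (h : R -> R) a b : a <= b -> {within `[a, b], continuous h} ->
  exists B, forall t, a <= t <= b -> `|h t| <= B.
Proof.
move=> ab ch.
have cn : {within `[a, b], continuous (fun t => `|h t|)}.
  by move=> t; apply: continuous_comp; [exact: ch|exact: norm_continuous].
have [c _ hc] := EVT_max ab cn.
by exists `|h c| => t tab; apply: hc; rewrite in_itv.
Qed.

Lemma normc_le_abs (z : R[i]) : normc z <= `|complex.Re z| + `|complex.Im z|.
Proof.
have -> : z = (complex.Re z)%:C + 'i * (complex.Im z)%:C.
  by apply: complex_eq; rewrite !ReImE/=; ring.
apply: le_trans (normcD _ _) _; rewrite normcM !normc_real.
rewrite [normc 'i](_ : _ = 1); last by rewrite normcE/= expr0n expr1n add0r sqrtr1.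
by rewrite !ReImE/=; rewrite mul1r !(mul0r, mulr0, mul1r, addr0, add0r, subr0).
Qed.

Section C1.
Variables (a b : R) (u : R -> R[i]).
Hypotheses (ab : a < b) (uC1 : cC1_itvcc a b u).

Lemma cwithin_C1 : cwithin a b u.
Proof.
have [[u1 _] [u2 _]] := uC1.
by split; exact: derivable_oo_LRcontinuous_within.
Qed.

Lemma cderive_at_C1 t : a < t < b -> cderive_at u t (cderive1 u t).
Proof.
move=> tab; have [[[u1 _ _] _] [[u2 _ _] _]] := uC1.
have tI : t \in `]a, b[ by rewrite in_itv.
by split; apply: DeriveDef; [exact: u1|rewrite /= derive1E|exact: u2|rewrite /= derive1E].
Qed.

(** The endpoint [a] is reached by a right limit; it is needed to bound [u p1] in [Kterm]. *)
Lemma normc_le_Linfty_C1 t : a <= t < b -> normc (u t) <= Linfty a b u.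
Proof.
have [B1 B1P] := within_bounded (ltW ab) cwithin_C1.1.
have [B2 B2P] := within_bounded (ltW ab) cwithin_C1.2.
have H s : a < s < b -> normc (u s) <= Linfty a b u.
  apply: (@normc_le_Linfty _ _ _ (B1 + B2)) => {}s sab.
  - by have [h _] := cderive_at_C1 sab; exact: derive_at_continuous h.
  - by have [_ h] := cderive_at_C1 sab; exact: derive_at_continuous h.
  - apply: le_trans (normc_le_abs _) _.
    by rewrite lerD ?B1P ?B2P//; apply/andP; split; lra.
move=> /andP[]; rewrite le_eqVlt => /predU1P[<- _|at_ tb]; last by apply: H; rewrite at_.
have [[[_ c1 _] _] [[_ c2 _] _]] := uC1.
have cn : (fun s => normc (u s)) s @[s --> a^'+] --> normc (u a).
  rewrite (funext (fun t => normcE (u t))) normcE.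
  have c3 : (complex.Re (u s) ^+ 2 + complex.Im (u s) ^+ 2) @[s --> a^'+] -->
      complex.Re (u a) ^+ 2 + complex.Im (u a) ^+ 2.
    by apply: cvgD; [exact: (cvgM c1 c1)|exact: (cvgM c2 c2)].
  exact: (cvg_comp _ _ c3 (@sqrt_continuous R _)).
rewrite -(cvg_lim _ cn)//; apply: limr_le; first by apply/cvg_ex; eexists; exact: cn.
near=> s; apply: H; apply/andP; split.
  by near: s; exact: nbhs_right_gt.
by near: s; exact: nbhs_right_lt.
Unshelve. all: by end_near. Qed.

Lemma normc_cderive1_le_Linfty t : a < t < b ->
  normc (cderive1 u t) <= Linfty a b (cderive1 u).
Proof.
have [[_ [g1 [cg1 g1E]]] [_ [g2 [cg2 g2E]]]] := uC1.
have [B1 B1P] := within_bounded (ltW ab) cg1.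
have [B2 B2P] := within_bounded (ltW ab) cg2.
have cont (d g : R -> R) : {within `[a, b], continuous g} -> {in `]a, b[, d =1 g} ->
    forall s, a < s < b -> {for s, continuous d}.
  move=> cg dE s sab.
  have sI : s \in `]a, b[ by rewrite in_itv.
  have /(continuous_within_itvP _ ab)[cgi _ _] := cg.
  rewrite /prop_for /continuous_at dE//; apply: cvg_trans (cgi _ sI).
  apply: near_eq_cvg; near=> x; apply/esym/dE; rewrite in_itv/=; apply/andP; split.
    by near: x; apply: lt_nbhsr; case/andP: sab.
  by near: x; apply: lt_nbhsl; case/andP: sab.
apply: (@normc_le_Linfty _ _ _ (B1 + B2)) => s sab.
- exact: (cont _ _ cg1 g1E).
- exact: (cont _ _ cg2 g2E).
- apply: le_trans (normc_le_abs _) _.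
  have sI : s \in `]a, b[ by rewrite in_itv.
  rewrite /= g1E// g2E//.
  by rewrite lerD ?B1P ?B2P//; apply/andP; split; lra.
Unshelve. all: by end_near. Qed.

End C1.
End Linfty_bounds.

Section abs_power.
Context {R : realType}.
Implicit Types (x y a b c t : R).

(** For [0 < a] this is continuous on the whole line, so the comparison functions [W] below are
    continuous up to the point where their argument vanishes. *)
Definition abs_powR a y : R := `|y| `^ a.

Lemma continuous_abs_powR a : 0 < a -> continuous (abs_powR a).
Proof.
rewrite /abs_powR; move=> a0 y; have [->|y0] := eqVneq y 0.
  apply/cvgrPdist_le => e e0; near=> t.
  rewrite normr0 powR0 ?gt_eqF// sub0r normrN ger0_norm ?powR_ge0//.
  have -> : e = (e `^ a^-1) `^ a by rewrite -powRrM mulVf ?gt_eqF// powRr1// ltW.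
  apply: ge0_ler_powR; rewrite ?nnegrE ?powR_ge0 ?(ltW a0)//.
  near: t; apply: filterS (@nbhs0_le _ R^o _ (powR_gt0 a^-1 e0)) => t; exact.
have y'0 : 0 < `|y| by rewrite normr_gt0.
have c1 : {for y, continuous (fun t : R => `|t|)} by exact: norm_continuous.
have c2 : {for `|y|, continuous (fun t : R => t `^ a)} by exact: continuous_powf.
exact: (continuous_comp c1 c2).
Unshelve. all: by end_near. Qed.

Lemma derive_at_abs_powR (h : R -> R) t a b : 0 < h t -> derive_at h t b ->
  derive_at (fun t => abs_powR a (h t)) t (a * h t `^ (a - 1) * b).
Proof.
rewrite /abs_powR; move=> h0 hb; apply: (@derive_at_near _ (fun t => h t `^ a)); last exact: derive_at_powf.
have ch := derive_at_continuous hb.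
near=> s; rewrite gtr0_norm//; near: s; exact: (cvgr_gt _ ch).
Unshelve. all: by end_near. Qed.

Lemma within_abs_powR (h : R -> R) a b c : 0 < c -> {within `[a, b], continuous h} ->
  {within `[a, b], continuous (fun t => abs_powR c (h t))}.
Proof.
move=> c0 ch; have ca := continuous_abs_powR c0.
move=> t; apply: (@continuous_comp _ _ _ (h : subspace `[a, b] -> R) (abs_powR c)).
  exact: ch.
exact: ca.
Qed.

End abs_power.

Section primitive.
Context {R : realType}.
Notation mu := (@lebesgue_measure R).
Variables (a b nu : R) (ab : a < b) (nu01 : 0 < nu < 1).

(** The natural primitive [(t - a) ^ nu] is unbounded on []a, +oo[]. The bounded [F] is used
    instead; on []a, b]] its derivative dominates the power up to the factor
    [(1 + y b) ^ 2 / nu]. *)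
Let integrable_power : mu.-integrable (`]a, b] : set R) (EFin \o (fun t => (t - a) `^ (nu - 1))).
Proof.
have [nu0 nu1] := andP nu01.
pose y (x : R) := x - a.
have dy x : derive_at y x 1.
  apply: derive_at_cast; last by apply: derive_at_subf; [exact: derive_at_idf|exact: derive_at_cstf].
  by rewrite subr0.
have dq x : a < x -> derive_at (fun x => y x / (1 + y x)) x (1 / (1 + y x) ^+ 2).
  move=> ax; have x1 : 1 + y x != 0 by rewrite gt_eqF// /y; lra.
  apply: derive_at_cast; last first.
    apply: derive_at_mulf; first exact: dy.
    apply: derive_at_invf; first exact: x1.
    by apply: derive_at_addf; [exact: derive_at_cstf|exact: dy].
  by rewrite /=; field.
pose F (x : R) := (y x / (1 + y x)) `^ nu.
pose f (x : R) := nu * (y x / (1 + y x)) `^ (nu - 1) * (1 / (1 + y x) ^+ 2).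
have q0 x : a < x -> 0 < y x / (1 + y x) by move=> ax; rewrite divr_gt0// /y; lra.
have dF x : a < x -> derive_at F x (f x).
  by move=> ax; apply: derive_at_powf; [exact: q0|exact: dq].
have intf : mu.-integrable (`]a, +oo[ : set R) (EFin \o f).
  apply: (ge0_bounded_integrable (F := F) (M := 1)) => // x ax.
  - apply: mulr_ge0; first by rewrite mulr_ge0 ?powR_ge0 ?(ltW nu0).
    by rewrite divr_ge0 ?exprn_ge0// /y; lra.
  - have x1 : 1 + y x != 0 by rewrite gt_eqF// /y; lra.
    have x2 : (1 + y x) * (1 + y x) != 0 by rewrite mulf_neq0.
    apply: derive_at_continuous; apply: derive_at_mulf.
      apply: derive_at_mulf; first exact: derive_at_cstf.
      by apply: derive_at_powf; [exact: q0|exact: dq].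
    apply: derive_at_mulf; first exact: derive_at_cstf.
    apply: (@derive_at_invf _ (fun x => (1 + y x) * (1 + y x))); first exact: x2.
    by apply: derive_at_mulf; (apply: derive_at_addf; [exact: derive_at_cstf|exact: dy]).
  - rewrite ger0_norm ?powR_ge0// /F -[leRHS](_ : 1 `^ nu = 1); last by rewrite powR1.
    apply: ge0_ler_powR; rewrite ?nnegrE ?(ltW nu0) ?(ltW (q0 _ ax))//.
    by rewrite ler_pdivrMr /y; lra.
have intfb : mu.-integrable (`]a, b] : set R) (EFin \o f).
  apply: (@integrableS _ _ _ mu `]a, +oo[%classic) intf => //.
  by move=> x; rewrite /= !in_itv/= => /andP[-> _].
apply: (integrable_dominated (g := f) (c := (1 + y b) ^+ 2 / nu)) => //.
  have : measurable_fun (`]a, +oo[ : set R) (fun t => (t - a) `^ (nu - 1)).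
    apply: measurable_continuous_itvoy => x ax; apply: derive_at_continuous.
    by apply: derive_at_powf; [|exact: dy]; rewrite subr_gt0.
  by apply: measurable_funS => // x; rewrite /= !in_itv/= => /andP[-> _].
move=> x; rewrite /= in_itv/= => /andP[ax xb].
have y0 : 0 < y x by rewrite /y; lra.
have yb : y x <= y b by rewrite /y; lra.
rewrite ger0_norm ?powR_ge0// -/(y x) /f.
have -> : (1 + y b) ^+ 2 / nu * (nu * (y x / (1 + y x)) `^ (nu - 1) * (1 / (1 + y x) ^+ 2)) =
    (y x / (1 + y x)) `^ (nu - 1) * ((1 + y b) ^+ 2 / (1 + y x) ^+ 2).
  by field; rewrite !gt_eqF//; lra.
rewrite -[leLHS]mulr1; apply: ler_pM; rewrite ?powR_ge0//.
  rewrite -(opprB 1) !powRN lef_pV2 ?posrE ?powR_gt0 ?q0//.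
  apply: ge0_ler_powR; rewrite ?nnegrE ?(ltW y0) ?(ltW (q0 _ ax))//; first lra.
  by rewrite ler_pdivrMr; [nra|lra].
rewrite ler_pdivlMr ?exprn_gt0//; last lra.
by rewrite mul1r lerXn2r ?nnegrE//; lra.
Qed.

Let integrable_closed (h : R -> R) : mu.-integrable (`]a, b] : set R) (EFin \o h) ->
  mu.-integrable (`[a, b] : set R) (EFin \o h).
Proof.
move=> /integrableP[mh ih].
have mh' : measurable_fun (`[a, b] : set R) h.
  by apply/measurable_fun_itv_obnd_cbndP; apply/measurable_EFinP.
apply/integrableP; split; first exact/measurable_EFinP.
rewrite -integral_itv_obnd_cbnd//.
apply/measurable_EFinP; apply: measurableT_comp => //.
exact/measurable_EFinP.
Qed.

(** [h] may blow up at [a]; domination by an integrable power makes the indefinite integral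
    continuous down to [a], so increments can be taken from the singular endpoint. *)
Lemma primitive_exists (h : R -> R) C :
  (forall t, a < t < b -> {for t, continuous h}) ->
  (forall t, a < t <= b -> `|h t| <= C * (t - a) `^ (nu - 1)) ->
  exists S : R -> R, [/\ S a = 0, S b = \int[mu]_(t in `]a, b]) h t,
    {within `[a, b], continuous S} &
    forall t, a < t < b -> derive_at S t (h t)].
Proof.
move=> ch hC.
have mh : measurable_fun (`]a, b] : set R) h.
  apply/measurable_fun_itv_bndo_bndcP; apply: open_continuous_measurable_fun => //.
  by move=> t; rewrite inE/= in_itv/= => /ch.
have inth : mu.-integrable (`]a, b] : set R) (EFin \o h).
  exact: (integrable_dominated (c := C) _ _ integrable_power).
have inthc := integrable_closed inth.
exists (fun t => \int[mu]_(x in `[a, t]) h x); split.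
- by rewrite set_itv1 Rintegral_set1.
- by rewrite Rintegral_itv_obnd_cbnd.
- exact: (parameterized_integral_continuous (ltW ab) inthc).
- move=> t /andP[at_ tb].
  have [] := continuous_FTC1_closed tb inthc at_.
    by apply: ch; rewrite at_.
  by move=> d1 d2; apply: DeriveDef; [exact: d1|rewrite -derive1E].
Qed.

Lemma normc_ge_Re (z : R[i]) : `|complex.Re z| <= normc z.
Proof. by rewrite -sqrtr_sqr normcE ler_wsqrtr// lerDl sqr_ge0. Qed.

Lemma normc_ge_Im (z : R[i]) : `|complex.Im z| <= normc z.
Proof. by rewrite -sqrtr_sqr normcE ler_wsqrtr// lerDr sqr_ge0. Qed.

Lemma cprimitive_exists (g : R -> R[i]) C :
  (forall t, a < t < b -> exists z, cderive_at g t z) ->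
  (forall t, a < t <= b -> normc (g t) <= C * (t - a) `^ (nu - 1)) ->
  exists S : R -> R[i], [/\ S a = 0, S b = cRintegral `]a, b] g,
    cwithin a b S & forall t, a < t < b -> cderive_at S t (g t)].
Proof.
move=> gd gC.
have c1 t : a < t < b -> {for t, continuous (fun t => complex.Re (g t))}.
  by move=> /gd[z [h _]]; exact: derive_at_continuous h.
have c2 t : a < t < b -> {for t, continuous (fun t => complex.Im (g t))}.
  by move=> /gd[z [_ h]]; exact: derive_at_continuous h.
have b1 t : a < t <= b -> `|complex.Re (g t)| <= C * (t - a) `^ (nu - 1).
  by move=> /gC; apply: le_trans; exact: normc_ge_Re.
have b2 t : a < t <= b -> `|complex.Im (g t)| <= C * (t - a) `^ (nu - 1).
  by move=> /gC; apply: le_trans; exact: normc_ge_Im.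
have [S1 [S1a S1b S1c S1d]] := primitive_exists c1 b1.
have [S2 [S2a S2b S2c S2d]] := primitive_exists c2 b2.
exists (fun t => S1 t +i* S2 t); split => //.
- by rewrite S1a S2a.
- by rewrite S1b S2b.
- by move=> t tab; split; [exact: S1d|exact: S2d].
Qed.

End primitive.

(** * Integration by parts around the stationary point *)

Lemma powR_anti {R : realType} (e l x : R) : e <= 0 -> 0 < l -> l <= x -> x `^ e <= l `^ e.
Proof.
move=> e0 l0 lx; have x0 := lt_le_trans l0 lx.
rewrite -(opprK e) !(powRN _ (- e)) lef_pV2 ?posrE ?powR_gt0//.
by apply: ge0_ler_powR; rewrite ?nnegrE ?oppr_ge0 ?(ltW l0) ?(ltW x0).
Qed.

Lemma real_complexM {R : realType} (x y : R) : (x * y)%:C = x%:C * y%:C.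
Proof. exact: rmorphM. Qed.

Lemma derive_at_shift {R : realType} (t l : R) : derive_at (fun t => t - l) t 1.
Proof.
apply: derive_at_cast; last by apply: derive_at_subf; [exact: derive_at_idf|exact: derive_at_cstf].
by rewrite subr0.
Qed.

Lemma derive_at_rshift {R : realType} (t l : R) : derive_at (fun t => l - t) t (- 1).
Proof.
apply: derive_at_cast; last by apply: derive_at_subf; [exact: derive_at_cstf|exact: derive_at_idf].
by rewrite sub0r.
Qed.

Section pieces.
Context {R : realType}.
Variables (a b p0 c nu w : R) (u du : R -> R[i]) (M0 M1 : R).
Hypotheses (ap0 : a < p0) (p0b : p0 < b) (nu01 : 0 < nu < 1) (w0 : 0 < w).
Hypothesis uW : cwithin a b u.
Hypothesis uD : forall t, a < t < b -> cderive_at u t (du t).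
Hypothesis uM : forall t, a <= t < b -> normc (u t) <= M0.
Hypothesis duM : forall t, a < t < b -> normc (du t) <= M1.
Implicit Types t l r : R.

Definition phase t := c - (t - p0) ^+ 2.
Definition amp t : R[i] := ((t - a) `^ (nu - 1))%:C * u t.
Definition osc_integrand t : R[i] := amp t * expi (w * phase t).

Lemma ex_cderive_at_osc_integrand t : a < t < b -> exists z, cderive_at osc_integrand t z.
Proof.
move=> tab; eexists; apply: cderive_at_mul.
  apply: cderive_at_mul; last exact: uD.
  apply: cderive_at_real; apply: derive_at_powf; last exact: derive_at_shift.
  by lra.
apply: cderive_at_expi; apply: derive_at_mulf; first exact: derive_at_cstf.
apply: derive_at_subf; first exact: derive_at_cstf.
by apply: (@derive_at_mulf _ (fun t => t - p0) (fun t => t - p0)); exact: derive_at_shift.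
Qed.

Variable S : R -> R[i].
Hypothesis SW : cwithin a b S.
Hypothesis SD : forall t, a < t < b -> cderive_at S t (osc_integrand t).

Let d := p0 - a.
Let d0 : 0 < d. Proof. by rewrite /d subr_gt0. Qed.
Let nu0 : 0 < nu. Proof. by case/andP: nu01. Qed.
Let nu1 : nu < 1. Proof. by case/andP: nu01. Qed.
Let M0_ge0 : 0 <= M0.
Proof. by apply: le_trans (normc_ge0 (u p0)) (uM _); rewrite (ltW ap0). Qed.
Let M1_ge0 : 0 <= M1.
Proof. by apply: le_trans (normc_ge0 (du p0)) (duM _); rewrite ap0. Qed.

Lemma within_derive (f df : R -> R) l r :
  (forall t, l <= t <= r -> derive_at f t (df t)) -> {within `[l, r], continuous f}.
Proof.
move=> fD; apply: continuous_in_subspaceT => t; rewrite inE/= in_itv/= => /fD.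
exact: derive_at_continuous.
Qed.

(* [t |-> s] is the change of variables that makes the phase linear on the left
   of the stationary point. *)
Let sv t := (t - a) * (2 * d - (t - a)).
(** Chosen so that [kap t * sv t ^ (nu - 1) * (2 * (p0 - t))], the last factor being the derivative
    of [sv], equals [(t - a) ^ (nu - 1)]. The tail then carries the whole singularity at [a], where
    [kap] is smooth. *)
Let kap t := (2 * d - (t - a)) `^ (1 - nu) / (2 * (p0 - t)).
Let dkap t := (2 * d - (t - a)) `^ (1 - nu) *
  ((2 * (p0 - t))^-1 * ((p0 - t)^-1 - (1 - nu) / (2 * d - (t - a)))).
Definition phi_left t : R[i] :=
  (kap t)%:C * u t * oscw nu w (sv t) * expi (w * (c - d ^+ 2)).

Let derive_at_two_d t : derive_at (fun t => 2 * d - (t - a)) t (- 1).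
Proof.
apply: derive_at_cast; last by apply: derive_at_subf; [exact: derive_at_cstf|exact: derive_at_shift].
by rewrite sub0r.
Qed.

Let derive_at_kap t : t < p0 -> derive_at kap t (dkap t).
Proof.
move=> tp; have y0 : 0 < p0 - t by rewrite subr_gt0.
have z0 : 0 < 2 * d - (t - a) by have := ap0; rewrite /d; lra.
apply: derive_at_cast; last first.
  apply: derive_at_mulf.
    by apply: derive_at_powf; [exact: z0|exact: derive_at_two_d].
  apply: derive_at_invf; first by rewrite mulf_neq0// gt_eqF.
  by apply: derive_at_mulf; [exact: derive_at_cstf|exact: derive_at_rshift].
rewrite /dkap /= (powRDx 1 (- nu) z0) powRr1 ?(ltW z0)// (_ : 1 - nu - 1 = - nu); last by ring.
move: (_ `^ (- nu)) => P.
move: y0 z0; move: (p0 - t) (2 * d - (t - a)) => y z y0 z0.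
by field; rewrite !gt_eqF.
Qed.

Let derive_at_sv t : derive_at sv t (2 * (p0 - t)).
Proof.
apply: derive_at_cast; last first.
  by apply: derive_at_mulf; [exact: derive_at_shift|exact: derive_at_two_d].
by rewrite /= /d; ring.
Qed.

Let sv_gt0 t : a < t < p0 -> 0 < sv t.
Proof. by move=> tp; have := ap0; rewrite mulr_gt0// /d; lra. Qed.

Let powR_sv e t : a < t < p0 -> sv t `^ e = (t - a) `^ e * (2 * d - (t - a)) `^ e.
Proof. by move=> tp; have := ap0; rewrite powRM// /d; lra. Qed.

Let powR_two_d t : t < p0 -> (2 * d - (t - a)) `^ (1 - nu) * (2 * d - (t - a)) `^ (nu - 1) = 1.
Proof.
move=> tp; rewrite -powRDx; last by have := ap0; rewrite /d; lra.
by rewrite (_ : 1 - nu + (nu - 1) = 0) ?powRr0//; ring.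
Qed.

Let cderive_at_phi_left t : a < t < p0 -> cderive_at phi_left t
  (((dkap t)%:C * u t + (kap t)%:C * du t) * oscw nu w (sv t) * expi (w * (c - d ^+ 2)) +
   osc_integrand t).
Proof.
move=> tp; have [at_ tp0] := andP tp; have tab : a < t < b by have := p0b; lra.
apply: cderive_at_cast; last first.
  apply: cderive_at_mul; last exact: cderive_at_cst.
  apply: cderive_at_mul.
    apply: cderive_at_mul; last exact: uD.
    by apply: cderive_at_real; exact: derive_at_kap.
  by apply: cderive_at_comp; [apply: cderive_at_oscw => //; exact: sv_gt0|exact: derive_at_sv].
rewrite mulr0 addr0 mulrDl; congr (_ + _).
rewrite /osc_integrand /amp (_ : w * phase t = w * sv t + w * (c - d ^+ 2)); last first.
  by rewrite /phase /sv /d; ring.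
rewrite expiD powR_sv//.
rewrite [in RHS](_ : (t - a) `^ (nu - 1) =
  kap t * ((t - a) `^ (nu - 1) * (2 * d - (t - a)) `^ (nu - 1)) * (2 * (p0 - t))); last first.
  rewrite /kap; have y0 : 2 * (p0 - t) != 0 by rewrite mulf_neq0// gt_eqF// subr_gt0.
  have E := powR_two_d tp0.
  transitivity ((t - a) `^ (nu - 1) *
    ((2 * d - (t - a)) `^ (1 - nu) * (2 * d - (t - a)) `^ (nu - 1))); first by rewrite E mulr1.
  move: E y0 => _; move: (2 * (p0 - t)) (_ `^ (1 - nu)) => v P v0.
  by field.
by rewrite !real_complexM; ring.
Qed.

(** Left of the midpoint [p0 - t >= d / 2], which gives the factors [1 / d] and [2 / d]. The powers
    of [2 * d - (t - a)] coming from [kap] and from the tail bound cancel. *)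
Let normc_dphi_left_le t : a < t < a + d / 2 ->
  normc (((dkap t)%:C * u t + (kap t)%:C * du t) * oscw nu w (sv t) * expi (w * (c - d ^+ 2))) <=
  w^-1 * (2 * M0 / d ^+ 2 + M1 / d) * (t - a) `^ (nu - 1).
Proof.
move=> /andP[at_ tq]; have tp : t < p0 by move: tq d0; rewrite /d; lra.
have tap : a < t < p0 by rewrite at_.
have tab : a < t < b by have := p0b; lra.
have tab' : a <= t < b by have := p0b; lra.
rewrite normcM normc_expi mulr1 normcM.
apply: le_trans (ler_wpM2l (normc_ge0 _) (normc_oscw_le nu01 w0 (sv_gt0 tap))) _.
rewrite powR_sv//.
have x0 : 0 <= (t - a) `^ (nu - 1) by exact: powR_ge0.
have P0 : 0 <= (2 * d - (t - a)) `^ (1 - nu) by exact: powR_ge0.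
have P1 : 0 <= (2 * d - (t - a)) `^ (nu - 1) by exact: powR_ge0.
have E := powR_two_d tp.
have y0 : 0 < p0 - t by rewrite subr_gt0.
have yd : d / 2 <= p0 - t by rewrite /d in tq *; lra.
have z0 : p0 - t <= 2 * d - (t - a) by have := ap0; rewrite /d; lra.
have Dk : normc ((dkap t)%:C * u t + (kap t)%:C * du t) <=
    (2 * d - (t - a)) `^ (1 - nu) * (2 * M0 / d ^+ 2 + M1 / d).
  apply: le_trans (normcD _ _) _; rewrite !normcM !normc_real mulrDr.
  rewrite /dkap /kap normrM [X in _ + X * _]normrM !(ger0_norm P0) -!mulrA.
  have r0 : 0 <= (2 * (p0 - t))^-1 <= d^-1.
    rewrite invr_ge0 mulr_ge0 ?(ltW y0)//= lef_pV2 ?posrE ?mulr_gt0//; lra.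
  have r1 : 0 <= (p0 - t)^-1 - (1 - nu) / (2 * d - (t - a)) <= 2 / d.
    have h1 : (1 - nu) / (2 * d - (t - a)) <= (p0 - t)^-1.
      rewrite ler_pdivrMr; last by lra.
      rewrite mulrC ler_pdivlMr//; have := nu0; nra.
    have h2 : (p0 - t)^-1 <= 2 / d.
      by rewrite -[leRHS]invrK lef_pV2 ?posrE ?invr_gt0 ?divr_gt0// invf_div.
    have h3 : 0 <= (1 - nu) / (2 * d - (t - a)).
      by rewrite divr_ge0; have := nu1; lra.
    by lra.
  apply: lerD; rewrite ler_wpM2l//.
    have [r00 r01] := andP r0; have [r10 r11] := andP r1.
    rewrite ger0_norm ?mulr_ge0//.
    apply: le_trans (ler_pM _ (normc_ge0 _) (ler_pM r00 r10 r01 r11) (uM tab')) _.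
      by rewrite mulr_ge0.
    by rewrite le_eqVlt; apply/orP; left; apply/eqP; field; rewrite gt_eqF.
  have [r00 r01] := andP r0; rewrite ger0_norm// mulrC.
  by apply: ler_pM; rewrite ?normc_ge0//; exact: duM.
apply: le_trans (ler_wpM2r _ Dk) _; first by rewrite mulr_ge0 ?invr_ge0 ?(ltW w0) ?mulr_ge0.
rewrite le_eqVlt; apply/orP; left; apply/eqP.
transitivity ((2 * d - (t - a)) `^ (1 - nu) * (2 * d - (t - a)) `^ (nu - 1) *
   (w^-1 * (2 * M0 / d ^+ 2 + M1 / d) * (t - a) `^ (nu - 1))); first by ring.
by rewrite E mul1r.
Qed.

Lemma left_increment :
  normc ((S (a + d / 2) - phi_left (a + d / 2)) - (S a - phi_left a)) <=
  w^-1 * (2 * M0 / d ^+ 2 + M1 / d) * ((d / 2) `^ nu / nu).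
Proof.
have qp : a + d / 2 < p0 by have := d0; rewrite /d; lra.
have aq : a < a + d / 2 by have := d0; lra.
have nz : nu != 0 by rewrite gt_eqF.
pose A := w^-1 * (2 * M0 / d ^+ 2 + M1 / d).
pose W t := A / nu * abs_powR nu (t - a).
have -> : A * ((d / 2) `^ nu / nu) = W (a + d / 2) - W a.
  rewrite /W /abs_powR (_ : a + d / 2 - a = d / 2); last by ring.
  rewrite subrr normr0 powR0// mulr0 subr0 ger0_norm; last by have := d0; lra.
  by ring.
apply: (normc_increment_le (f := fun t => S t - phi_left t) (W := W)
  (df := fun t => - (((dkap t)%:C * u t + (kap t)%:C * du t) * oscw nu w (sv t) *
    expi (w * (c - d ^+ 2)))) (dW := fun t => A * (t - a) `^ (nu - 1))).
- exact: ltW.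
- apply: cwithin_add.
    by apply: cwithin_sub SW; [|exact: ltW (lt_trans qp p0b)].
  apply: cwithin_opp; apply: cwithin_mul; last exact: cwithin_cst.
  apply: cwithin_mul.
    apply: cwithin_mul.
      apply: cwithin_real; apply: (@within_derive _ dkap) => t tq.
      by apply: derive_at_kap; lra.
    by apply: cwithin_sub uW; [|exact: ltW (lt_trans qp p0b)].
  have [h1 h2] := continuous_oscw nu01 w.
  have cs t : {for t, continuous sv} by exact: derive_at_continuous (derive_at_sv t).
  split; apply: continuous_subspaceT => t.
    exact: (continuous_comp (cs t) (h1 (sv t))).
  exact: (continuous_comp (cs t) (h2 (sv t))).
- apply: within_mulf; first exact: within_cstf.
  apply: within_abs_powR => //.
  by apply: (@within_derive _ (fun=> 1)) => t _; exact: derive_at_shift.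
- move=> t tq; have tap : a < t < p0 by lra.
  apply: cderive_at_cast; last first.
    apply: cderive_at_add; first by apply: SD; have := p0b; lra.
    by apply: cderive_at_opp; exact: cderive_at_phi_left.
  by rewrite opprD addrCA subrr addr0.
- move=> t tq; apply: derive_at_cast; last first.
    apply: derive_at_mulf; first exact: derive_at_cstf.
    by apply: derive_at_abs_powR; [|exact: derive_at_shift]; lra.
  by rewrite mul0r add0r mulr1; field.
- by move=> t tq; rewrite normc_opp; exact: normc_dphi_left_le.
Qed.

Let damp t : R[i] :=
  ((nu - 1) * (t - a) `^ (nu - 2))%:C * u t + ((t - a) `^ (nu - 1))%:C * du t.

Let cderive_at_amp t : a < t < b -> cderive_at amp t (damp t).
Proof.
move=> tab; apply: cderive_at_mul; last exact: uD.
apply: cderive_at_real; apply: derive_at_cast; last first.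
  by apply: derive_at_powf; [|exact: derive_at_shift]; lra.
by rewrite mulr1; congr (_ * _ `^ _); ring.
Qed.

Let cwithin_amp l r : a < l -> r <= b -> cwithin l r amp.
Proof.
move=> al rb; apply: cwithin_mul; last by apply: cwithin_sub uW => //; exact: ltW.
apply: cwithin_real; apply: (@within_derive _ (fun t => (nu - 1) * (t - a) `^ (nu - 1 - 1) * 1)).
by move=> t tlr; apply: derive_at_powf; [|exact: derive_at_shift]; lra.
Qed.

(** Bounds the derivative of [amp] at distance at least [l] from [a]; it is used with [l = d / 2] on
    the middle piece and [l = d] on the right one. *)
Let vbound l := (1 - nu) * l `^ (nu - 2) * M0 + l `^ (nu - 1) * M1.

Let vbound_ge0 l : 0 <= vbound l.
Proof.
by have /ltW n1 := nu1; rewrite /vbound addr_ge0 ?mulr_ge0 ?powR_ge0 ?subr_ge0.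
Qed.

Let normc_damp_le l t : 0 < l -> l <= t - a -> t < b -> normc (damp t) <= vbound l.
Proof.
move=> l0 lt tb; have tab : a < t < b by lra.
have tab' : a <= t < b by lra.
have n1 := nu1.
apply: le_trans (normcD _ _) _; rewrite !normcM !normc_real normrM.
rewrite ler0_norm; last lra.
rewrite opprB !(ger0_norm (powR_ge0 _ _)) /vbound -!mulrA; apply: lerD.
  rewrite ler_wpM2l//; first lra.
  by apply: ler_pM; rewrite ?powR_ge0 ?normc_ge0 ?uM//; apply: powR_anti => //; lra.
by apply: ler_pM; rewrite ?powR_ge0 ?normc_ge0 ?duM//; apply: powR_anti => //; lra.
Qed.

Variables (Lam gam : R) (gam01 : 0 < gam < 1).
Hypothesis fresnelL : forall y, 0 < y -> normc (fresnel w y) <= Lam * y `^ (- gam).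

Let gam1 : 0 < 1 - gam. Proof. by have /andP[] := gam01; lra. Qed.

(** The tail is taken in the distance [p0 - t]; the minus sign compensates for the derivative [- 1]
    of that distance. *)
Definition phi_mid t : R[i] := - (amp t * fresnel w (p0 - t)) * expi (w * c).
Definition phi_right t : R[i] := amp t * fresnel w (t - p0) * expi (w * c).

Let phase_split t : expi (- (w * (t - p0) ^+ 2)) * expi (w * c) = expi (w * phase t).
Proof. by rewrite -expiD; congr expi; rewrite /phase; ring. Qed.

Let cwithin_fresnel_comp (f df : R -> R) l r :
  (forall t, derive_at f t (df t)) -> cwithin l r (fun t => fresnel w (f t)).
Proof.
move=> fD; have [h1 h2] := continuous_fresnel w.
have cs t : {for t, continuous f} by exact: derive_at_continuous (fD t).
split; apply: continuous_subspaceT => t.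
  exact: (continuous_comp (cs t) (h1 (f t))).
exact: (continuous_comp (cs t) (h2 (f t))).
Qed.

Lemma mid_increment :
  normc ((S p0 - phi_mid p0) - (S (a + d / 2) - phi_mid (a + d / 2))) <=
  vbound (d / 2) * Lam * ((d / 2) `^ (1 - gam) / (1 - gam)).
Proof.
have qp : a + d / 2 < p0 by have := d0; rewrite /d; lra.
have aq : a < a + d / 2 by have := d0; lra.
have [[pb ap] d0'] := (p0b, ap0, d0).
have nz : 1 - gam != 0 by rewrite gt_eqF.
pose A := vbound (d / 2) * Lam.
pose W t := - (A / (1 - gam)) * abs_powR (1 - gam) (p0 - t).
have -> : A * ((d / 2) `^ (1 - gam) / (1 - gam)) = W p0 - W (a + d / 2).
  rewrite /W /abs_powR (_ : p0 - (a + d / 2) = d / 2); last by rewrite /d; field.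
  rewrite subrr normr0 powR0// mulr0 sub0r ger0_norm; last by lra.
  by ring.
apply: (normc_increment_le (f := fun t => S t - phi_mid t) (W := W)
  (df := fun t => damp t * fresnel w (p0 - t) * expi (w * c))
  (dW := fun t => A * (p0 - t) `^ (- gam))).
- exact: ltW.
- apply: cwithin_add; first by apply: cwithin_sub SW; exact: ltW.
  apply: cwithin_opp; apply: cwithin_mul; last exact: cwithin_cst.
  apply: cwithin_opp; apply: cwithin_mul; first by apply: cwithin_amp => //; exact: ltW.
  by apply: cwithin_fresnel_comp => t; exact: derive_at_rshift.
- apply: within_mulf; first exact: within_cstf.
  apply: within_abs_powR => //.
  by apply: (@within_derive _ (fun=> - 1)) => t _; exact: derive_at_rshift.
- move=> t tq; have tab : a < t < b by lra.
  apply: cderive_at_cast; last first.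
    apply: cderive_at_add; first exact: SD.
    apply: cderive_at_opp; apply: cderive_at_mul; last exact: cderive_at_cst.
    apply: cderive_at_opp; apply: cderive_at_mul; first exact: cderive_at_amp.
    by apply: cderive_at_comp; [apply: cderive_at_fresnel => //; lra|exact: derive_at_rshift].
  rewrite /osc_integrand -phase_split (_ : (p0 - t) ^+ 2 = (t - p0) ^+ 2); last by ring.
  by rewrite mulr0 addr0 (_ : (- 1)%:C = - 1 :> R[i]) ?rmorphN//; ring.
- move=> t tq; apply: derive_at_cast; last first.
    apply: derive_at_mulf; first exact: derive_at_cstf.
    by apply: derive_at_abs_powR; [|exact: derive_at_rshift]; lra.
  rewrite mul0r add0r (_ : 1 - gam - 1 = - gam); last by ring.
  by field.
- move=> t tq; rewrite normcM normc_expi mulr1 normcM /A -mulrA.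
  apply: ler_pM; rewrite ?normc_ge0//.
    by apply: normc_damp_le; lra.
  by apply: fresnelL; lra.
Qed.

Lemma right_increment :
  normc ((S b - phi_right b) - (S p0 - phi_right p0)) <=
  vbound d * Lam * ((b - p0) `^ (1 - gam) / (1 - gam)).
Proof.
have [[pb ap] d0'] := (p0b, ap0, d0).
have nz : 1 - gam != 0 by rewrite gt_eqF.
pose A := vbound d * Lam.
pose W t := A / (1 - gam) * abs_powR (1 - gam) (t - p0).
have -> : A * ((b - p0) `^ (1 - gam) / (1 - gam)) = W b - W p0.
  rewrite /W /abs_powR subrr normr0 powR0// mulr0 subr0 ger0_norm; last by lra.
  by ring.
apply: (normc_increment_le (f := fun t => S t - phi_right t) (W := W)
  (df := fun t => - (damp t * fresnel w (t - p0) * expi (w * c)))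
  (dW := fun t => A * (t - p0) `^ (- gam))).
- exact: ltW.
- apply: cwithin_add; first by apply: cwithin_sub SW => //; exact: ltW.
  apply: cwithin_opp; apply: cwithin_mul; last exact: cwithin_cst.
  apply: cwithin_mul; first by apply: cwithin_amp => //; exact: ltW.
  by apply: cwithin_fresnel_comp => t; exact: derive_at_shift.
- apply: within_mulf; first exact: within_cstf.
  apply: within_abs_powR => //.
  by apply: (@within_derive _ (fun=> 1)) => t _; exact: derive_at_shift.
- move=> t tq; have tab : a < t < b by lra.
  apply: cderive_at_cast; last first.
    apply: cderive_at_add; first exact: SD.
    apply: cderive_at_opp; apply: cderive_at_mul; last exact: cderive_at_cst.
    apply: cderive_at_mul; first exact: cderive_at_amp.
    by apply: cderive_at_comp; [apply: cderive_at_fresnel => //; lra|exact: derive_at_shift].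
  by rewrite /osc_integrand -phase_split mulr0 addr0 mulr1; ring.
- move=> t tq; apply: derive_at_cast; last first.
    apply: derive_at_mulf; first exact: derive_at_cstf.
    by apply: derive_at_abs_powR; [|exact: derive_at_shift]; lra.
  rewrite mul0r add0r mulr1 (_ : 1 - gam - 1 = - gam); last by ring.
  by field.
- move=> t tq; rewrite normc_opp normcM normc_expi mulr1 normcM /A -mulrA.
  apply: ler_pM; rewrite ?normc_ge0//.
    by apply: normc_damp_le; move: d0' tq; rewrite /d; lra.
  by apply: fresnelL; lra.
Qed.

(* At the junction the leading terms of the two tails cancel. *)
Lemma junction_le :
  normc (phi_left (a + d / 2) - phi_mid (a + d / 2)) <=
  (1 - nu) * (2 `^ (3 - nu) / 3) * M0 * d `^ (nu - 4) * w^-1 ^+ 2 +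
  2 `^ (2 - nu) * M0 * d `^ (nu - 3) * w `^ (- (3 / 2)).
Proof.
have [[[pb ap] dp] n1] := (p0b, ap0, d0, nu1).
set q := a + d / 2.
have yE : p0 - q = d / 2 by rewrite /q /d; field.
have xE : q - a = d / 2 by rewrite /q; ring.
have d20 : 0 < d / 2 by lra.
have qab : a <= q < b by rewrite /q; move: dp; rewrite /d; lra.
have z0 : 0 < 3 * d / 2 by lra.
have zE : 2 * d - (q - a) = 3 * d / 2 by rewrite xE; field.
have sE : sv q = (d / 2) * (3 * d / 2) by rewrite /sv zE xE.
have s0 : 0 < sv q by rewrite sE mulr_gt0.
pose P := (3 * d / 2) `^ (1 - nu).
have kE : kap q = P / d by rewrite /kap zE yE; congr (_ / _); field.
have PQ : P * (3 * d / 2) `^ (nu - 1) = 1.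
  by rewrite -powRDx// (_ : 1 - nu + (nu - 1) = 0) ?powRr0//; ring.
(* Both leading terms at [q] have amplitude [(d / 2) ^ (nu - 1) / (w d)], apart from [u q], and by
   [ee] the same phase. Only the remainders [r1] and [r2] survive. *)
have ksE : kap q * (sv q) `^ (nu - 1) = (d / 2) `^ (nu - 1) / d.
  rewrite sE powRM ?(ltW d20) ?(ltW z0)// kE.
  transitivity (P * (3 * d / 2) `^ (nu - 1) * ((d / 2) `^ (nu - 1) / d)); first by ring.
  by rewrite PQ mul1r.
pose e1 := expi (w * sv q); pose e2 := expi (w * (c - d ^+ 2)).
pose r1 := oscw nu w (sv q) + 'i * (w^-1 * (sv q) `^ (nu - 1))%:C * e1.
pose r2 := fresnel w (d / 2) - 'i * ((2 * w * (d / 2))^-1)%:C * expi (- (w * (d / 2) ^+ 2)).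
have -> : phi_left q - phi_mid q =
    (kap q)%:C * u q * r1 * e2 + amp q * r2 * expi (w * c).
  rewrite /phi_left /phi_mid yE /r1 /r2 -/e2 mulNr opprK /amp xE.
  have ee : e1 * e2 = expi (- (w * (d / 2) ^+ 2)) * expi (w * c).
    by rewrite /e1 /e2 -!expiD; congr expi; rewrite sE; field.
  have wE : (2 * w * (d / 2))^-1 = w^-1 / d.
    by field; rewrite !gt_eqF.
  rewrite wE; set o := oscw _ _ _; set f := fresnel _ _.
  suff E : (kap q)%:C * u q * ('i * (w^-1 * sv q `^ (nu - 1))%:C * e1) * e2 =
    ((d / 2) `^ (nu - 1))%:C * u q * ('i * (w^-1 / d)%:C * expi (- (w * (d / 2) ^+ 2))) * expi (w * c).
    rewrite [in RHS]mulrDr [in RHS]mulrDl E; ring.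
  transitivity ((kap q * sv q `^ (nu - 1) * w^-1)%:C * u q * 'i * (e1 * e2)).
    by rewrite !real_complexM; ring.
  by rewrite ee ksE !real_complexM; ring.
have halfE : (d / 2) `^ (nu - 1) = d `^ (nu - 1) * 2 `^ (1 - nu).
  by rewrite powRM ?(ltW dp)// powRVx// -powRN opprB.
apply: le_trans (normcD _ _) _; rewrite !normcM !normc_expi !mulr1 !normc_real.
have uq := uM qab; have u0 := normc_ge0 (u q).
rewrite !(ger0_norm (powR_ge0 _ _)) xE; apply: lerD.
  have H := normc_oscw_rem nu01 w0 s0; rewrite -/e1 -/r1 in H.
  have kq0 : 0 <= kap q by rewrite kE divr_ge0 ?powR_ge0// ltW.
  rewrite ger0_norm//.
  apply: (@le_trans _ _ (kap q * M0 * ((1 - nu) * (w^-1 ^+ 2 * sv q `^ (nu - 2))))).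
    apply: ler_pM; [by rewrite mulr_ge0 ?normc_ge0|by rewrite normc_ge0|by rewrite ler_wpM2l|exact: H].
  rewrite le_eqVlt; apply/orP; left; apply/eqP.
  have -> : (1 - nu) * (2 `^ (3 - nu) / 3) * M0 * d `^ (nu - 4) * w^-1 ^+ 2 =
    (2 `^ (3 - nu) / 3 * d `^ (nu - 4)) * (M0 * ((1 - nu) * w^-1 ^+ 2)) by ring.
  (* Compared with [ksE] there is one more division by [sv q = 3 d ^ 2 / 4]; this is the origin of
     the factor [2 ^ (3 - nu) / 3]. *)
  have -> : 2 `^ (3 - nu) / 3 * d `^ (nu - 4) = kap q * sv q `^ (nu - 2).
    rewrite (_ : nu - 2 = (nu - 1) + - 1); last by ring.
    rewrite (powRDx (nu - 1) (- 1) s0) mulrA ksE powRN1 ?(ltW s0)// sE halfE.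
    have -> : 2 `^ (3 - nu) = 2 `^ (1 - nu) * 4 :> R.
      rewrite (_ : 3 - nu = 1 - nu + 2%:R); last by ring.
      by rewrite powRDx// powR_mulrn//; ring.
    have -> : d `^ (nu - 4) = d `^ (nu - 1) / d ^+ 3.
      rewrite (_ : nu - 4 = nu - 1 - 3%:R); last by ring.
      by rewrite powRDx// powRN powR_mulrn// ltW.
    by field; rewrite gt_eqF.
  by ring.
have H := normc_fresnel_rem w0 d20; rewrite -/r2 in H.
apply: (@le_trans _ _ ((d / 2) `^ (nu - 1) * M0 * (1 / 2 * w `^ (- (3 / 2)) * ((d / 2) ^+ 2)^-1))).
  apply: ler_pM; [by rewrite mulr_ge0 ?powR_ge0 ?normc_ge0|by rewrite normc_ge0|
    by rewrite ler_wpM2l ?powR_ge0|exact: H].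
rewrite le_eqVlt; apply/orP; left; apply/eqP.
rewrite halfE.
have -> : 2 `^ (2 - nu) = 2 `^ (1 - nu) * 2 :> R.
  rewrite (_ : 2 - nu = 1 - nu + 1%:R); last by ring.
  by rewrite powRDx// powR_mulrn.
have -> : d `^ (nu - 3) = d `^ (nu - 1) / d ^+ 2.
  rewrite (_ : nu - 3 = nu - 1 - 2%:R); last by ring.
  by rewrite powRDx// powRN powR_mulrn// ltW.
by field; rewrite gt_eqF.
Qed.

(** At [a] the tail takes its value at 0, and [kap a = (2 d) ^ (- nu)] accounts for the power of 2
    in [Kterm]. *)
Lemma phi_left_start : phi_left a =
  - ((Gamma nu / 2 `^ nu)%:C * expi (pi * nu / 2) * expi (w * (c - d ^+ 2)) * u a *
     (d `^ (- nu) * w `^ (- nu))%:C).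
Proof.
have dp := d0; rewrite /phi_left /sv subrr mul0r oscw0// /kap subrr subr0 -/d.
have -> : (2 * d) `^ (1 - nu) / (2 * d) = (2 `^ nu)^-1 * d `^ (- nu).
  have d2 : 0 < 2 * d by rewrite mulr_gt0.
  rewrite (powRDx 1 (- nu) d2) powRr1 ?(ltW d2)// mulrAC mulfV ?gt_eqF// mul1r.
  by rewrite powRM ?(ltW dp)// powRN.
by rewrite !real_complexM; ring.
Qed.

(** Each side of [p0] contributes half of the full Fresnel integral, hence half of [Hterm]. *)
Lemma phi_mid_stop : phi_mid p0 =
  amp p0 * (Num.sqrt pi / 2 * w `^ (- (1 / 2)))%:C * expi (- (pi / 4)) * expi (w * c).
Proof. by rewrite /phi_mid subrr fresnel0; ring. Qed.

Lemma phi_right_start : phi_right p0 =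
  - (amp p0 * (Num.sqrt pi / 2 * w `^ (- (1 / 2)))%:C * expi (- (pi / 4)) * expi (w * c)).
Proof. by rewrite /phi_right subrr fresnel0; ring. Qed.

(** Telescoping: the values of [S] at the midpoint and at [p0] cancel between neighbouring pieces,
    and the mismatch of [phi_left] and [phi_mid] at the midpoint is [junction_le]. *)
Lemma phi_left_mid_right_le :
  normc (S b - (S a + phi_right b - phi_right p0 + phi_mid p0 - phi_left a)) <=
  w^-1 * (2 * M0 / d ^+ 2 + M1 / d) * ((d / 2) `^ nu / nu) +
  ((1 - nu) * (2 `^ (3 - nu) / 3) * M0 * d `^ (nu - 4) * w^-1 ^+ 2 +
   2 `^ (2 - nu) * M0 * d `^ (nu - 3) * w `^ (- (3 / 2))) +
  ((1 - nu) * (d / 2) `^ (nu - 2) * M0 + (d / 2) `^ (nu - 1) * M1) * Lam *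
    ((d / 2) `^ (1 - gam) / (1 - gam)) +
  ((1 - nu) * d `^ (nu - 2) * M0 + d `^ (nu - 1) * M1) * Lam *
    ((b - p0) `^ (1 - gam) / (1 - gam)).
Proof.
apply: le_trans (lerD (lerD (lerD left_increment junction_le) mid_increment) right_increment).
set q := a + d / 2.
rewrite (_ : S b - _ = (S q - phi_left q - (S a - phi_left a)) + (phi_left q - phi_mid q) +
  (S p0 - phi_mid p0 - (S q - phi_mid q)) + (S b - phi_right b - (S p0 - phi_right p0))); last first.
  move: (S b) (S q) (S p0) (S a) (phi_left q) (phi_left a) => x1 x2 x3 x4 x5 x6.
  by move: (phi_mid p0) (phi_mid q) (phi_right b) (phi_right p0) => x7 x8 x9 x10; ring.
apply: le_trans (normcD _ _) _; rewrite lerD2r.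
apply: le_trans (normcD _ _) _; rewrite lerD2r.
by apply: le_trans (normcD _ _) _; rewrite lerD2r.
Qed.

End pieces.

(** * The eight remainder terms *)

Lemma pi_ge1 {R : realType} : 1 <= pi :> R.
Proof. by have := pi_ge2 R; lra. Qed.

Section remainder_terms.
Context {R : realType}.
Variables (a b p0 nu w delta L M0 M1 : R).
Hypotheses (ap0 : a < p0) (p0b : p0 < b) (nu01 : 0 < nu < 1) (w0 : 0 < w).
Hypotheses (delta01 : 1 / 2 < delta < 1) (L0 : 0 <= L) (M0_ge0 : 0 <= M0) (M1_ge0 : 0 <= M1).

Let d := p0 - a.
Let gam := 2 * delta - 1.
Let d0 : 0 < d. Proof. by rewrite /d subr_gt0. Qed.
Let gam01 : 0 < gam < 1. Proof. by have := delta01; rewrite /gam; lra. Qed.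

Let powR_half e : (d / 2) `^ e = d `^ e * 2 `^ (- e).
Proof. by rewrite powRM ?(ltW d0)// powRVx// -powRN. Qed.

Let powR2_le e f : e <= f -> 2 `^ e <= 2 `^ f :> R.
Proof. by move=> ef; rewrite ler_powR// ler1n. Qed.

(** After a common positive factor is taken out, this compares [2 M0] with [4 (2 - nu) (M0 + M1)]
    and [M1] with [2 (M0 + M1)]. *)
Lemma remainder_left :
  w^-1 * (2 * M0 / d ^+ 2 + M1 / d) * ((d / 2) `^ nu / nu) <=
  2 `^ (2 - nu) / nu * (2 - nu) * (M0 + M1) * d `^ (- (2 - nu)) * w `^ (- 1) +
  2 `^ (1 - nu) / nu * (M0 + M1) * d `^ (- (1 - nu)) * w `^ (- 1).
Proof.
have [nu0 nu1] := andP nu01; have dp := d0.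
rewrite powR_half powRN1 ?(ltW w0)//.
have -> : d `^ (- (2 - nu)) = d `^ nu / d ^+ 2.
  by rewrite opprB powRDx// powRN powR_mulrn// ltW.
have -> : d `^ (- (1 - nu)) = d `^ nu / d.
  by rewrite opprB powRDx// powRN powRr1// ltW.
have -> : 2 `^ (2 - nu) = 2 `^ (- nu) * 4 :> R.
  rewrite (_ : 2 - nu = - nu + 2%:R); last by ring.
  by rewrite powRDx// powR_mulrn//; ring.
have -> : 2 `^ (1 - nu) = 2 `^ (- nu) * 2 :> R.
  by rewrite addrC powRDx// powRr1.
have D0 := powR_ge0 d nu; have T0 := powR_ge0 (2 : R) (- nu).
move: (d `^ nu) (2 `^ (- nu)) D0 T0 => D T D0 T0.
rewrite -subr_ge0.
have -> : T * 4 / nu * (2 - nu) * (M0 + M1) * (D / d ^+ 2) / w +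
    T * 2 / nu * (M0 + M1) * (D / d) / w - w^-1 * (2 * M0 / d ^+ 2 + M1 / d) * (D * T / nu) =
    T * D / (nu * w * d ^+ 2) * ((4 * (2 - nu) * (M0 + M1) - 2 * M0) + (2 * (M0 + M1) - M1) * d).
  by field; rewrite !gt_eqF.
rewrite mulr_ge0 ?divr_ge0 ?mulr_ge0 ?exprn_ge0 ?(ltW w0) ?(ltW nu0) ?(ltW dp)//.
rewrite addr_ge0 ?mulr_ge0 ?(ltW dp)//; last by have := M0_ge0; have := M1_ge0; lra.
by have := M0_ge0; have := M1_ge0; nra.
Qed.

(** The first terms agree. In the second the only slack is [1 <= sqrt pi]. *)
Lemma remainder_junction :
  (1 - nu) * (2 `^ (3 - nu) / 3) * M0 * d `^ (nu - 4) * w^-1 ^+ 2 +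
   2 `^ (2 - nu) * M0 * d `^ (nu - 3) * w `^ (- (3 / 2)) <=
  (1 - nu) * (2 `^ (3 - nu) / 3) * M0 * d `^ (- (4 - nu)) * w `^ (- 2) +
  Num.sqrt pi / 2 `^ (nu - 2) * M0 * d `^ (- (3 - nu)) * w `^ (- (3 / 2)).
Proof.
rewrite !opprB (powRN w 2) powR_mulrn ?(ltW w0)// exprVn lerD2l.
rewrite !ler_wpM2r ?powR_ge0// -powRN opprB -[leLHS]mul1r ler_wpM2r ?powR_ge0//.
by rewrite -[leLHS]sqrtr1 ler_wsqrtr// pi_ge1.
Qed.

Lemma remainder_mid :
  ((1 - nu) * (d / 2) `^ (nu - 2) * M0 + (d / 2) `^ (nu - 1) * M1) * (L * w `^ (- delta)) *
    ((d / 2) `^ (1 - gam) / (1 - gam)) <=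
  L / (1 - gam) * 2 `^ (2 - nu) * (1 - nu) * (M0 + M1) * d `^ (- (1 + gam - nu)) * w `^ (- delta) +
  L / (1 - gam) * 2 `^ (1 - nu) * (M0 + M1) * d `^ (- (gam - nu)) * w `^ (- delta).
Proof.
have [nu0 nu1] := andP nu01; have [g0 g1] := andP gam01; have dp := d0.
have h0 : 0 < d / 2 by rewrite divr_gt0.
have E1 : (d / 2) `^ (nu - 2) * (d / 2) `^ (1 - gam) = d `^ (- (1 + gam - nu)) * 2 `^ (1 + gam - nu).
  rewrite -powRDx// (_ : nu - 2 + (1 - gam) = - (1 + gam - nu)); last by ring.
  by rewrite powR_half opprK.
have E2 : (d / 2) `^ (nu - 1) * (d / 2) `^ (1 - gam) = d `^ (- (gam - nu)) * 2 `^ (gam - nu).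
  rewrite -powRDx// (_ : nu - 1 + (1 - gam) = - (gam - nu)); last by ring.
  by rewrite powR_half opprK.
(* The exact powers of 2 depend on [gam]; [gam < 1] allows the listed ones, which do not. *)
have T1 : 2 `^ (1 + gam - nu) <= 2 `^ (2 - nu) :> R by apply: powR2_le; lra.
have T2 : 2 `^ (gam - nu) <= 2 `^ (1 - nu) :> R by apply: powR2_le; lra.
have -> : ((1 - nu) * (d / 2) `^ (nu - 2) * M0 + (d / 2) `^ (nu - 1) * M1) * (L * w `^ (- delta)) *
    ((d / 2) `^ (1 - gam) / (1 - gam)) =
    (1 - nu) * M0 * (L / (1 - gam) * w `^ (- delta)) * ((d / 2) `^ (nu - 2) * (d / 2) `^ (1 - gam)) +
    M1 * (L / (1 - gam) * w `^ (- delta)) * ((d / 2) `^ (nu - 1) * (d / 2) `^ (1 - gam)).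
  by ring.
rewrite E1 E2.
have LW : 0 <= L / (1 - gam) * w `^ (- delta).
  by rewrite mulr_ge0 ?powR_ge0// divr_ge0//; lra.
have D1 := powR_ge0 d (- (1 + gam - nu)); have D2 := powR_ge0 d (- (gam - nu)).
have P1 := powR_ge0 (2 : R) (2 - nu); have P2 := powR_ge0 (2 : R) (1 - nu).
have MM0 : M0 <= M0 + M1 by rewrite lerDl.
have MM1 : M1 <= M0 + M1 by rewrite lerDr.
apply: lerD.
  rewrite [leRHS](_ : _ = (1 - nu) * (M0 + M1) * (L / (1 - gam) * w `^ (- delta)) *
    (d `^ (- (1 + gam - nu)) * 2 `^ (2 - nu))); last by ring.
  apply: ler_pM.
  - by apply: mulr_ge0 => //; rewrite mulr_ge0// subr_ge0 ltW.
  - by rewrite mulr_ge0 ?powR_ge0.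
  - by rewrite ler_wpM2r// ler_wpM2l// subr_ge0 ltW.
  - by rewrite ler_wpM2l.
rewrite [leRHS](_ : _ = (M0 + M1) * (L / (1 - gam) * w `^ (- delta)) *
  (d `^ (- (gam - nu)) * 2 `^ (1 - nu))); last by ring.
apply: ler_pM.
- by apply: mulr_ge0.
- by rewrite mulr_ge0 ?powR_ge0.
- by rewrite ler_wpM2r.
- by rewrite ler_wpM2l.
Qed.

Lemma remainder_right :
  ((1 - nu) * d `^ (nu - 2) * M0 + d `^ (nu - 1) * M1) * (L * w `^ (- delta)) *
    ((b - p0) `^ (1 - gam) / (1 - gam)) <=
  L / (1 - gam) * (1 - nu) * (b - a) `^ (1 - gam) * (M0 + M1) * d `^ (- (2 - nu)) * w `^ (- delta) +
  L / (1 - gam) * (b - a) `^ (1 - gam) * (M0 + M1) * d `^ (- (1 - nu)) * w `^ (- delta).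
Proof.
have [nu0 nu1] := andP nu01; have [g0 g1] := andP gam01; have dp := d0.
have [pb ap] := (p0b, ap0).
have B1 : (b - p0) `^ (1 - gam) <= (b - a) `^ (1 - gam).
  by apply: ge0_ler_powR; rewrite ?nnegrE; lra.
have LW : 0 <= L / (1 - gam) * w `^ (- delta).
  by rewrite mulr_ge0 ?powR_ge0// divr_ge0//; lra.
have MM0 : M0 <= M0 + M1 by rewrite lerDl.
have MM1 : M1 <= M0 + M1 by rewrite lerDr.
have D1 := powR_ge0 d (nu - 2); have D2 := powR_ge0 d (nu - 1).
rewrite (opprB 2) (opprB 1 nu).
have -> : ((1 - nu) * d `^ (nu - 2) * M0 + d `^ (nu - 1) * M1) * (L * w `^ (- delta)) *
    ((b - p0) `^ (1 - gam) / (1 - gam)) =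
    (1 - nu) * M0 * (L / (1 - gam) * w `^ (- delta) * d `^ (nu - 2)) * (b - p0) `^ (1 - gam) +
    M1 * (L / (1 - gam) * w `^ (- delta) * d `^ (nu - 1)) * (b - p0) `^ (1 - gam) by ring.
apply: lerD.
  rewrite [leRHS](_ : _ = (1 - nu) * (M0 + M1) * (L / (1 - gam) * w `^ (- delta) * d `^ (nu - 2)) *
     (b - a) `^ (1 - gam)); last by ring.
  have LD := mulr_ge0 LW D1.
  apply: ler_pM; rewrite ?powR_ge0//.
    by apply: mulr_ge0 => //; rewrite mulr_ge0// subr_ge0 ltW.
  by rewrite ler_wpM2r// ler_wpM2l// subr_ge0 ltW.
rewrite [leRHS](_ : _ = (M0 + M1) * (L / (1 - gam) * w `^ (- delta) * d `^ (nu - 1)) *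
   (b - a) `^ (1 - gam)); last by ring.
have LD := mulr_ge0 LW D2.
apply: ler_pM; rewrite ?powR_ge0//; first exact: mulr_ge0.
by rewrite ler_wpM2r.
Qed.

End remainder_terms.

(** * The expansion with both main terms *)

Section stationary_phase.
Context {R : realType}.
Variables (p1 p2 p0 c mu delta K : R) (psi : R -> R) (u U : R -> R[i]).
Hypotheses (p1_lt_p2 : p1 < p2) (p0_in : p1 < p0 < p2).
Hypothesis psiE : forall p, p1 <= p <= p2 -> psi p = - (p - p0) ^+ 2 + c.
Hypothesis mu_in : 0 < mu < 1.
Hypothesis u_C1 : cC1_itvcc p1 p2 u.
Hypothesis UE : forall p, p1 < p <= p2 -> U p = ((p - p1) `^ (mu - 1))%:C * u p.
Hypothesis U_p2 : U p2 = 0.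
Hypotheses (delta_in : 1 / 2 < delta < 1) (K_gt0 : 0 < K).
Hypothesis KE : Num.sqrt pi / 2 * K ^+ 2 - 1 / 2 * K - Num.sqrt pi / 4 = 0.
Variable w : R.
Hypothesis w0 : 0 < w.

(** The equation for [K] reads [sqrt pi * (K ^ 2 - 1 / 2) = K], so [K ^ 2 > 1 / 2], and
    [pi >= 2]. *)
Lemma pi_sqrK_ge1 : 1 <= pi * K ^+ 2.
Proof.
have s0 : 0 < Num.sqrt pi :> R by rewrite sqrtr_gt0 pi_gt0.
have K2 : 1 / 2 <= K ^+ 2.
  have := KE; have := K_gt0; set s := Num.sqrt pi in s0 *; set k := K ^+ 2 => k0 E.
  have : 0 < s * (k - 1 / 2) by lra.
  by rewrite pmulr_rgt0// subr_gt0 => /ltW.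
by have := pi_ge2 R; nra.
Qed.

(** Both main terms are kept whatever [mu] is, so this single estimate yields all three cases. *)
Lemma stationary_phase_le :
  normc (cRintegral `]p1, p2] (fun p => U p * expi (w * psi p)) -
    (Hterm p0 c w u * ((p0 - p1) `^ (mu - 1) * w `^ (- (1 / 2)))%:C +
     Kterm p1 mu w psi u * ((p0 - p1) `^ (- mu) * w `^ (- mu))%:C)) <=
  \sum_(k < 8) (rem_r p1 p2 mu delta K u)`_k * (p0 - p1) `^ (- (rem_a mu delta)`_k) *
    w `^ (- (rem_b delta)`_k).
Proof.
have [ap pb] := andP p0_in.
pose M0 := Linfty p1 p2 u; pose M1 := Linfty p1 p2 (cderive1 u).
have uW := cwithin_C1 u_C1.
have uD := cderive_at_C1 u_C1.
have uM := normc_le_Linfty_C1 p1_lt_p2 u_C1.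
have duM := normc_cderive1_le_Linfty p1_lt_p2 u_C1.
have M0_ge0 : 0 <= M0.
  by apply: le_trans (normc_ge0 (u p0)) (uM _ _); rewrite (ltW ap).
have M1_ge0 : 0 <= M1 by exact: le_trans (normc_ge0 (cderive1 u p0)) (duM _ p0_in).
have IE : cRintegral `]p1, p2] (fun p => U p * expi (w * psi p)) =
    cRintegral `]p1, p2] (osc_integrand p1 p0 c mu w u).
  have gE p : p1 < p <= p2 -> U p * expi (w * psi p) = osc_integrand p1 p0 c mu w u p.
    move=> pI; rewrite UE// psiE /osc_integrand /amp /phase.
      by congr (_ * expi (_ * _)); rewrite addrC.
    by have [/ltW -> ->] := andP pI.
  by congr (_ +i* _); apply: eq_Rintegral => p; rewrite inE/= in_itv/= => /gE ->.
(* Crude bounds on the closed interval, for the existence of the primitive: [uM] stops short of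
   [p2]. *)
have [B1 B1P] := within_bounded (ltW p1_lt_p2) uW.1.
have [B2 B2P] := within_bounded (ltW p1_lt_p2) uW.2.
have gC t : p1 < t <= p2 -> normc (osc_integrand p1 p0 c mu w u t) <=
    (B1 + B2) * (t - p1) `^ (mu - 1).
  move=> /andP[/ltW t1 t2]; rewrite normcM normc_expi mulr1 normcM normc_real.
  rewrite (ger0_norm (powR_ge0 _ _)) mulrC ler_wpM2r ?powR_ge0//.
  by apply: le_trans (normc_le_abs _) _; rewrite lerD ?B1P ?B2P ?t1.
have gD := ex_cderive_at_osc_integrand p0 c mu w uD.
have [S [S1 S2 SW SD]] := cprimitive_exists p1_lt_p2 mu_in gD gC.
pose L := Num.sqrt pi / 2 * K `^ (2 * delta - 1).
have fL y : 0 < y -> normc (fresnel w y) <= L * w `^ (- delta) * y `^ (- (2 * delta - 1)).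
  by move=> y0; exact: normc_fresnel_interp pi_sqrK_ge1 delta_in.
have gam01 : 0 < 2 * delta - 1 < 1 by have := delta_in; lra.
have L0 : 0 <= L by rewrite mulr_ge0 ?powR_ge0// divr_ge0// sqrtr_ge0.
have main := phi_left_mid_right_le ap pb mu_in w0 uW uD uM duM SW SD gam01 fL.
have u2 : amp p1 mu u p2 = 0 by rewrite /amp -UE ?U_p2// p1_lt_p2 lexx.
have XE : S p1 + phi_right p1 p0 c mu w u p2 - phi_right p1 p0 c mu w u p0 +
    phi_mid p1 p0 c mu w u p0 - phi_left p1 p0 c mu w u p1 =
    Hterm p0 c w u * ((p0 - p1) `^ (mu - 1) * w `^ (- (1 / 2)))%:C +
    Kterm p1 mu w psi u * ((p0 - p1) `^ (- mu) * w `^ (- mu))%:C.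
  rewrite S1 {1}/phi_right u2 !mul0r !add0r phi_right_start phi_mid_stop phi_left_start//.
  rewrite !opprK; congr (_ + _).
    have h : (2^-1)%:C + (2^-1)%:C = 1 :> R[i].
      by rewrite -rmorphD/= -[RHS](rmorph1 (@real_complex R)); congr _%:C; field.
    rewrite /Hterm /amp !real_complexM -[RHS]mul1r -h.
    move: (_%:C) (_%:C) (_%:C) (_%:C) (expi _) (expi _) (u _) => *; ring.
  rewrite /Kterm psiE ?lexx ?(ltW p1_lt_p2)// (_ : - (p1 - p0) ^+ 2 + c = c - (p0 - p1) ^+ 2)//.
  by ring.
rewrite IE -S2 -XE; apply: le_trans main _.
have := lerD (lerD (lerD (remainder_left ap mu_in w0 M0_ge0 M1_ge0)
  (remainder_junction p1 p0 mu w0 M0_ge0))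
  (remainder_mid w ap mu_in delta_in L0 M0_ge0 M1_ge0))
  (remainder_right w ap pb mu_in delta_in L0 M0_ge0 M1_ge0).
move=> /le_trans; apply; rewrite !big_ord_recl big_ord0 /= addr0.
rewrite le_eqVlt; apply/orP; left; apply/eqP.
rewrite /rem_r /rem_a /rem_b /= -/L /W1infty -/M0 -/M1.
ring.
Qed.

End stationary_phase.

Theorem corollary3p2 (R : realType) (p1 p2 p0 c mu delta K : R)
    (psi : R -> R) (u U : R -> R[i])
    (p1_lt_p2 : p1 < p2)
    (p0_in : p1 < p0 < p2)
    (psiE : forall p, p1 <= p <= p2 -> psi p = - (p - p0) ^+ 2 + c)
    (mu_in : 0 < mu < 1)
    (u_C1 : cC1_itvcc p1 p2 u)
    (UE : forall p, p1 < p <= p2 -> U p = ((p - p1) `^ (mu - 1))%:C * u p)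
    (u_p1 : u p1 <> 0)
    (U_p2 : U p2 = 0)
    (delta_in : 1 / 2 < delta < 1)
    (K_gt0 : 0 < K)
    (KE : Num.sqrt pi / 2 * K ^+ 2 - 1 / 2 * K - Num.sqrt pi / 4 = 0) :
  forall omega : R, 0 < omega ->
  let I := cRintegral `]p1, p2] (fun p => U p * expi (omega * psi p)) in
  let H := Hterm p0 c omega u in
  let Kmu := Kterm p1 mu omega psi u in
  [/\ (1 / 2 < mu ->
        (forall k : 'I_9, 1 / 2 < (rem_beta1 mu delta)`_k) /\
        normc (I - H * ((p0 - p1) `^ (mu - 1) * omega `^ (- (1 / 2)))%:C)
        <= \sum_(k < 9) (rem_R1 p1 p2 mu delta K u)`_k
             * (p0 - p1) `^ (- (rem_alpha1 mu delta)`_k)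
             * omega `^ (- (rem_beta1 mu delta)`_k)),
      (mu = 1 / 2 ->
        (forall k : 'I_8, 1 / 2 < (rem_beta2 delta)`_k) /\
        normc (I - (H + Kmu)
                 * ((p0 - p1) `^ (- (1 / 2)) * omega `^ (- (1 / 2)))%:C)
        <= \sum_(k < 8) (rem_R2 p1 p2 mu delta K u)`_k
             * (p0 - p1) `^ (- (rem_alpha2 mu delta)`_k)
             * omega `^ (- (rem_beta2 delta)`_k))
    & (mu < 1 / 2 ->
        (forall k : 'I_9, mu < (rem_beta3 delta)`_k) /\
        normc (I - Kmu * ((p0 - p1) `^ (- mu) * omega `^ (- mu))%:C)
        <= \sum_(k < 9) (rem_R3 p1 p2 mu delta K u)`_k
             * (p0 - p1) `^ (- (rem_alpha3 mu delta)`_k)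
             * omega `^ (- (rem_beta3 delta)`_k))].
Proof.
move=> w w0 I H Kmu; have [mu0 mu1] := andP mu_in.
have [pa pb] := andP p0_in; have [d1 d2] := andP delta_in.
have P := stationary_phase_le p1_lt_p2 p0_in psiE mu_in u_C1 UE U_p2 delta_in K_gt0 KE w0.
rewrite -/I -/H -/Kmu in P.
have uM := normc_le_Linfty_C1 p1_lt_p2 u_C1.
have G0 : 0 <= Gamma mu / 2 `^ mu.
  have mu01 : 0 < 1 - mu < 1 by lra.
  by rewrite divr_ge0 ?powR_ge0//; have := Gamma_gt0 mu01; rewrite subKr => /ltW.
have KM : normc Kmu <= Gamma mu / 2 `^ mu * Linfty p1 p2 u.
  rewrite /Kmu /Kterm !normcM !normc_expi !mulr1 normc_real ger0_norm//.
  by rewrite ler_wpM2l// uM// lexx.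
have HM : normc H <= Num.sqrt pi * Linfty p1 p2 u.
  rewrite /H /Hterm !normcM !normc_expi !mulr1 normc_real ger0_norm ?sqrtr_ge0//.
  by rewrite ler_wpM2l ?sqrtr_ge0// uM// (ltW pa).
(* The displaced main term [y] becomes entry 0 of the longer list, so its bound [r'] stands in front
   of the common sum. *)
have tri (z x y : R[i]) (r r' : R) : normc (z - (x + y)) <= r -> normc y <= r' ->
    normc (z - x) <= r' + r.
  move=> zr yr; rewrite (_ : z - x = y + (z - (x + y))); last by ring.
  by apply: le_trans (normcD _ _) _; exact: lerD.
have cM (z : R[i]) (x y : R) : normc (z * (x `^ y)%:C) = normc z * x `^ y.
  by rewrite normcM normc_real ger0_norm// powR_ge0.
have powM (x y : R) : 0 <= x `^ y by exact: powR_ge0.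
split=> [mu2|mu2|mu2]; split.
- by case=> m /= mk; do 9 (case: m mk => [|m] mk; first by rewrite /=; lra).
- rewrite big_ord_recl; apply: (tri _ _ _ _ _ P).
  by rewrite /= real_complexM mulrA !cM ler_wpM2r// ler_wpM2r.
- by case=> m /= mk; do 8 (case: m mk => [|m] mk; first by rewrite /=; lra).
- have E1 : mu - 1 = - (1 / 2) by rewrite mu2; field.
  have E2 : - mu = - (1 / 2) by rewrite mu2.
  by move: P; rewrite E1 E2 -mulrDl.
- by case=> m /= mk; do 9 (case: m mk => [|m] mk; first by rewrite /=; lra).
- rewrite big_ord_recl; rewrite (addrC (H * _)) in P; apply: (tri _ _ _ _ _ P).
  rewrite /= opprB mul1r real_complexM mulrA !cM.
  by rewrite ler_wpM2r// ler_wpM2r.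
Qed.
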